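(* There exists a constant $C'>0$ such that for every $k$, every real $m$ with $C'\leq m\leq k^{22}$, every complete $k$-partite graph $H$ on $mk$ vertices, and every integer $n\geq10^{60}mk\log^4k$, the cycle $C_n$ is $H$-good, i.e. $R(C_n,H)=(\chi(H)-1)(n-1)+\sigma(H)$.
   Context: Logarithms are natural. $R(F,H)$ is the minimum $N$ such that every $N$-vertex graph either contains $F$ or its complement contains $H$. $C_n$ is the $n$-vertex cycle; $\chi(H)$ is the chromatic number and $\sigma(H)$ is the minimum size of a colour class over all proper $\chi(H)$-colourings of $H$. *)

(* Defs.v *)
From Stdlib Require Import Reals.
From mathcomp Require Import all_boot.
Set Implicit Arguments. Unset Strict Implicit. Unset Printing Implicit Defensive.

(* A (simple) graph on a finType V is a relation E : rel V, assumed symmetric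
   and irreflexive where relevant. *)

Definition contains (T1 T2 : finType) (F : rel T1) (G : rel T2) : Prop :=
  exists f : T1 -> T2, injective f /\ forall x y, F x y -> G (f x) (f y).

Definition compl (T : finType) (G : rel T) : rel T :=
  fun x y => (x != y) && ~~ G x y.

Definition ramsey_prop (T1 T2 : finType) (F : rel T1) (H : rel T2) (N : nat) : Prop :=
  forall G : rel 'I_N, irreflexive G -> symmetric G ->
    contains F G \/ contains H (compl G).

Definition is_ramsey_number (T1 T2 : finType) (F : rel T1) (H : rel T2) (N : nat) : Prop :=
  ramsey_prop F H N /\ forall N', (N' < N)%N -> ~ ramsey_prop F H N'.

(* the cycle C_n on vertex set 'I_n (a genuine cycle for n >= 3) *)
Definition cycle_graph (n : nat) : rel 'I_n :=
  fun x y => (val y == (val x).+1 %% n) || (val x == (val y).+1 %% n).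

Arguments cycle_graph n : clear implicits.

Definition proper_col (V : finType) (E : rel V) (c : nat) (f : {ffun V -> 'I_c}) : bool :=
  [forall x, forall y, E x y ==> (f x != f y)].

(* chromatic number: least c admitting a proper c-colouring
   (for irreflexive graphs such c <= #|V| always exists) *)
Definition chromatic_number (V : finType) (E : rel V) : nat :=
  \big[minn/#|V|]_(c < #|V|.+1 | [exists f : {ffun V -> 'I_c}, proper_col E f]) (c : nat).

Definition sigma_num (V : finType) (E : rel V) : nat :=
  \big[minn/#|V|]_(f : {ffun V -> 'I_(chromatic_number E)} | proper_col E f)
     \big[minn/#|V|]_(i < chromatic_number E) #|[set x | f x == i]|.

Definition complete_multipartite (v k : nat) (f : 'I_v -> 'I_k) : rel 'I_v :=
  fun x y => f x != f y.

Definition is_good (n : nat) (V : finType) (H : rel V) : Prop :=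
  is_ramsey_number (cycle_graph n) H
    ((chromatic_number H - 1) * (n - 1) + sigma_num H).

(* Main.v *)
Require Import Defs.
From Stdlib Require Import Reals Lra.
From mathcomp Require Import all_boot.
From mathcomp Require Import zify.
From mathcomp Require Import boolp.
Set Implicit Arguments. Unset Strict Implicit. Unset Printing Implicit Defensive.

(* Write M for the order of H and h for its binary logarithm; n is at least a large multiple
   of M h^2.  The upper bound goes by induction on the number of parts.  If G has no copy of H in
   its complement, then for the largest part we may assume: every set of M vertices together with
   its neighbourhood has at least n vertices (otherwise delete it and use induction), two
   nonadjacent such sets reach almost 2n vertices, independent sets are smaller than M, and every
   set missing fewer than n vertices contains M vertices that meet or are adjacent to every
   M-set.  These four conditions force a cycle of length exactly n.

   A Friedman-Pippenger embedding grows a path made of items, each of which offers two routes of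
   lengths differing by one, found as two adjacent leaves of a binary tree of depth h.  When the
   path cannot be continued it closes to a cycle Z of length nearly n.  If Z is not joined (some
   two M-subsets of Z are nonadjacent), Menger's theorem and Posa rotations outside Z give a
   cycle of length at least n through half of Z; chords shorten it and the items correct its length.
   If Z is joined, a subset of exactly n vertices that is joined and expands is obtained by adding
   centres of disjoint stars, and a bounded number of rotations shows that it is Hamiltonian:
   one segment of a longest path is left intact for many pairs of ends, and rotations inside
   it are valid for all of them at once.

   The lower bound is given by disjoint cliques. *)

(** The factor [h^2] has two sources. A chord supplied by the independence bound skips anything from
    one to about [2M] vertices, so an exact length needs about [2M] items, each adjustable by one.
    An item may contain [h] vertices off its main route, and about [100M] items fit on a cycle of
    length [n], so [Z] and the joined set fall short of [n] by a gap [g] of order [M h].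
    Hamiltonicity then takes about [h] rotations at each end, so [r] of order [h] disjoint segments
    are needed for one of them to survive, and each must be long compared with [t = 4g]. Hence [n]
    has to exceed a multiple of [r t], which is of order [M h^2]. The obstacle in closing a longest
    path is that the heads reached by rotating one end depend on the path, hence on the other end,
    so joinedness cannot be applied to two sets of ends. Rotations confined to an intact segment
    give one set of heads common to many other ends, and joinedness applies to that pair of sets.
    The condition [m <= k^22] makes [h] comparable with [ln k]. *)

Lemma ex_max_nat (P : nat -> Prop) b :
  (exists i, P i) -> (forall i, P i -> i <= b) ->
  exists2 i, P i & forall j, P j -> j <= i.
Proof.
move=> [i0 Pi0] Pb.
have ex : exists i, `[< P i >] by exists i0; apply/asboolP.
have bd : forall i, `[< P i >] -> i <= b by move=> i /asboolP; apply: Pb.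
case: (ex_maxnP ex bd) => i /asboolP Pi mx.
by exists i => // j Pj; apply: mx; apply/asboolP.
Qed.

Lemma subset_card_eq (T : finType) (A : {set T}) k :
  k <= #|A| -> exists2 B : {set T}, B \subset A & #|B| = k.
Proof.
move=> kA; exists [set x in take k (enum A)].
  apply/subsetP => x; rewrite inE => /mem_take; by rewrite mem_enum.
rewrite cardsE; have /card_uniqP -> : uniq (take k (enum A)).
  by apply: take_uniq; apply: enum_uniq.
by rewrite size_takel // -cardE.
Qed.

Lemma cardUle (T : finType) (A B : {set T}) : #|A :|: B| <= #|A| + #|B|.
Proof. exact: leq_card_setU. Qed.

(** * Rotations of paths *)

Section Adjacent.
Variable V : eqType.

Fixpoint adjs (p : seq V) (x y : V) : bool :=
  if p is a :: p' then
    (if p' is b :: _ then (a == x) && (b == y) else false) || adjs p' x y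
  else false.

Lemma adjs_cat s a b t x y :
  adjs (rcons s a ++ b :: t) x y =
  [|| adjs (rcons s a) x y, (a == x) && (b == y) | adjs (b :: t) x y].
Proof.
elim: s => [|c s IH] //.
rewrite rcons_cons cat_cons [LHS]/= IH.
by case: s {IH} => [|d s] /=; rewrite -?orbA ?orbF.
Qed.

Lemma adjs_cat0 s t x y : adjs (s ++ t) x y = 
  [|| adjs s x y, adjs t x y | [&& s != [::], t != [::], last x s == x & head y t == y]].
Proof.
case/lastP: s => [|s a]; first by rewrite /= orbF.
case: t => [|b t]; first by rewrite cats0 /= andbF orbF.
rewrite adjs_cat last_rcons; have -> : rcons s a != [::] by case: s.
by rewrite [head _ _]/=; rewrite orbCA orbC -orbA.
Qed.

Lemma adjs_rcons s a x y :
  adjs (rcons s a) x y = adjs s x y || [&& s != [::], last x s == x & a == y].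
Proof. by rewrite -cats1 adjs_cat0 /= ; case: (adjs s x y) => //=. Qed.

Lemma adjs_rev s x y : adjs (rev s) x y = adjs s y x.
Proof.
elim: s => [|a s IH] //; rewrite rev_cons adjs_rcons IH.
case: s IH => [|b s] IH //; rewrite [in RHS]/= orbC.
have -> : rev (b :: s) != [::] by rewrite rev_cons; case: (rev s).
by rewrite rev_cons last_rcons andTb [(b == x) && _]andbC.
Qed.

Lemma adjs_mem s x y : adjs s x y -> (x \in s) && (y \in s).
Proof.
elim: s => [|a [|b s] IH] // /orP[/andP[/eqP-> /eqP->]|/IH /andP[xs ys]].
  by rewrite !inE !eqxx orbT.
by rewrite inE xs orbT inE ys orbT.
Qed.

Lemma adjs_pred (s : seq V) v : uniq s -> v \in s -> v <> head v s ->
  exists x u w, s = rcons u x ++ v :: w.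
Proof.
move=> us /splitPr sv; case: sv us => u w us.
by case/lastP: u us => [|u x] us //= _; exists x, u, w.
Qed.

Lemma adjs_mid u x v w y : uniq (rcons u x ++ v :: w) ->
  adjs (rcons u x ++ v :: w) y v -> y = x.
Proof.
move=> U; rewrite adjs_cat => /or3P[/adjs_mem/andP[_]|/andP[/eqP-> _] //|].
  by move: U; rewrite cat_uniq => /and3P[_ /hasPn/(_ v)]; rewrite inE eqxx => /(_ isT) /= /negbTE->.
case: w U => [|b w] //= U /orP[/andP[_ /eqP bv]|].
  by move: U; rewrite bv cat_uniq => /and3P[_ _]; rewrite cons_uniq inE eqxx.
move=> /(@adjs_mem (b :: w)) /andP[_ vw].
by move: U; rewrite cat_uniq => /and3P[_ _]; rewrite cons_uniq vw.
Qed.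

Lemma adjs_mid_succ u v w y : uniq (u ++ v :: w) ->
  adjs (u ++ v :: w) v y -> exists w', w = y :: w'.
Proof.
move=> U; rewrite adjs_cat0 => /or3P[/adjs_mem/andP[vu _]|A|/and4P[u0 _ /eqP lv _]].
- by move: U; rewrite cat_uniq => /and3P[_ /hasPn/(_ v)]; rewrite inE eqxx => /(_ isT) /=; rewrite vu.
- case: w U A => [|b w] //= U /orP[/andP[_ /eqP->]|]; first by exists w.
  move=> /(@adjs_mem (b :: w)) /andP[vw _].
  by move: U; rewrite cat_uniq => /and3P[_ _]; rewrite cons_uniq vw.
- have vu : v \in u by case: u u0 lv {U} => [|c u] //= _ <-; apply: mem_last.
  by move: U; rewrite cat_uniq => /and3P[_ /hasPn/(_ v)]; rewrite inE eqxx => /(_ isT) /=; rewrite vu.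
Qed.

Lemma adjs_uniq_l p x x' v : uniq p -> adjs p x v -> adjs p x' v -> x = x'.
Proof.
move=> up xv; have /andP[xp vp] := adjs_mem xv.
have hv : v <> head v p.
  move=> hv; case: p up xv hv vp xp => [|a p] // up xv /= va _ _.
  have := adjs_rev (a :: p) v x; rewrite xv rev_cons -cats1 -va => E.
  have U : uniq (rev p ++ v :: [::]) by rewrite cats1 va -rev_cons rev_uniq.
  by case: (adjs_mid_succ U E).
case: (adjs_pred up vp hv) => y [u [w E]]; move: up xv; rewrite E => up xv x'v.
by rewrite (adjs_mid up xv) (adjs_mid up x'v).
Qed.

Lemma adjs_uniq_r p x v v' : uniq p -> adjs p x v -> adjs p x v' -> v = v'.
Proof.
by move=> up; rewrite -[adjs p x v]adjs_rev -[adjs p x v']adjs_rev; apply: adjs_uniq_l; rewrite rev_uniq.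
Qed.

(** Unordered, because a rotation reverses part of the path. *)
Definition adjb p x y := adjs p x y || adjs p y x.

Lemma adjbC p x y : adjb p x y = adjb p y x.
Proof. exact: orbC. Qed.

Lemma adjb_rev p x y : adjb (rev p) x y = adjb p x y.
Proof. by rewrite /adjb !adjs_rev orbC. Qed.

Lemma adjb_mem p x y : adjb p x y -> (x \in p) && (y \in p).
Proof. by case/orP=> /adjs_mem // /andP[-> ->]. Qed.

Lemma adjb_two p v : uniq p -> v \in p -> v <> head v p -> v <> last v p ->
  exists x y, [/\ adjs p x v, adjs p v y & x != y].
Proof.
move=> up vp hv lv; case: (adjs_pred up vp hv) => x [u [w E]].
move: up lv; rewrite {}E => up lv; case: w up lv => [|y w] up lv.
  by rewrite last_cat in lv.
exists x, y; split.
- by rewrite adjs_cat !eqxx orbT.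
- by rewrite adjs_cat /= !eqxx /= !orbT.
- apply/eqP => xy; move: up; rewrite cat_uniq => /and3P[_ /hasPn/(_ y)].
  by rewrite !inE eqxx !orbT => /(_ isT) /=; rewrite mem_rcons inE xy eqxx.
Qed.

End Adjacent.

Section Rotation.
Variables (V : finType) (G : rel V) (K : V -> V -> Prop).

(* The rotation at the head breaks the edge [y x]; [K] restricts which edges may be broken. *)
Inductive rot1 : seq V -> seq V -> Prop :=
| Rot1 u y x w : G (head y (rcons u y)) x -> K y x ->
    rot1 (rcons u y ++ x :: w) (y :: rev u ++ x :: w).

(** [rotn0] holds at every index, so the index only bounds the number of rotations from above. *)
Inductive rotn (p : seq V) : nat -> seq V -> Prop :=
| rotn0 i : rotn p i p
| rotnS i q q' : rotn p i q -> rot1 q q' -> rotn p i.+1 q'.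

Lemma rotn_mono p i j q : i <= j -> rotn p i q -> rotn p j q.
Proof.
move=> ij r; elim: r j ij => [i' j _|i' q1 q2 _ IH r1 [|j] //= ij]; first exact: rotn0.
by apply: rotnS r1; apply: IH.
Qed.

Lemma rot1E p q : rot1 p q -> exists u y x w,
  [/\ p = rcons u y ++ x :: w, q = rev (rcons u y) ++ x :: w,
      G (head y (rcons u y)) x & K y x].
Proof. by case=> u y x w g k; exists u, y, x, w; rewrite rev_rcons. Qed.

Lemma rot1_perm p q : rot1 p q -> perm_eq p q.
Proof.
move=> /rot1E [u [y [x [w [-> -> _ _]]]]].
by rewrite perm_cat2r perm_sym perm_rev.
Qed.

Lemma rotn_perm p i q : rotn p i q -> perm_eq p q.
Proof. by elim=> // i' q1 q2 _ IH /rot1_perm; apply: perm_trans. Qed.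

Lemma rot1_last p q x0 : rot1 p q -> last x0 q = last x0 p.
Proof. by move=> /rot1E [u [y [x [w [-> -> _ _]]]]]; rewrite !last_cat. Qed.

Lemma rotn_last p i q x0 : rotn p i q -> last x0 q = last x0 p.
Proof. by elim=> // i' q1 q2 _ IH /(@rot1_last _ _ x0) ->. Qed.

(** The single edge that a rotation destroys has the new head as an end, so edges avoiding the new
    head survive, possibly reversed. *)
Lemma rot1_adjb p q a b : rot1 p q -> adjb p a b ->
  (forall y q', q = y :: q' -> (y != a) && (y != b)) -> adjb q a b.
Proof.
case=> u y x w _ _ pab /(_ _ _ erefl) /andP[ya yb].
have -> : y :: rev u ++ x :: w = rev (rcons u y) ++ x :: w by rewrite rev_rcons.
have aux : forall c d, y != c -> y != d -> adjs (rcons u y ++ x :: w) c d -> adjb (rev (rcons u y) ++ x :: w) c d.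
  move=> c d yc yd; rewrite adjs_cat => /or3P[A|/andP[/eqP yc'] _|A].
  - by rewrite /adjb !adjs_cat0 !adjs_rev A /= !orbT.
  - by rewrite yc' eqxx in yc.
  - by rewrite /adjb !adjs_cat0 A /= !orbT.
by case/orP: pab => A; [|rewrite adjbC]; apply: aux.
Qed.

Definition heads p i : {set V} := [set y | `[< exists q, rotn p i (y :: q) >]].

Lemma headsP p i y : reflect (exists q, rotn p i (y :: q)) (y \in heads p i).
Proof. by rewrite inE; apply: asboolP. Qed.

Lemma heads_mono p i j : i <= j -> heads p i \subset heads p j.
Proof.
move=> ij; apply/subsetP => y /headsP[q r]; apply/headsP; exists q.
exact: rotn_mono r.
Qed.

Lemma heads_sub p i y : y \in heads p i -> y \in p.
Proof. by case/headsP=> q /rotn_perm /perm_mem ->; rewrite inE eqxx. Qed.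

Lemma rotn_adjb p i q a b : rotn p i q -> adjb p a b ->
  a \notin heads p i -> b \notin heads p i -> adjb q a b.
Proof.
elim=> // i' q1 q2 r IH r1 pab an bn.
have sub := subsetP (heads_mono p (leqnSn i')).
apply: (rot1_adjb r1).
  by apply: IH => //; [apply: contra an|apply: contra bn]; apply: sub.
move=> y q' E; have yh : y \in heads p i'.+1.
  by apply/headsP; exists q'; rewrite -E; apply: rotnS r r1.
by apply/andP; split; apply: contraTneq yh => ->.
Qed.

(* An edge of [p] survives all rotations unless one of its ends became a head,
   so the vertex preceding [v] is still one of its neighbours on [p]. *)
Lemma posa_step p i y q v : uniq p -> rotn p i (y :: q) -> v \in p ->
  v \notin heads p i -> G y v -> (forall u, adjb p u v -> K u v) ->
  exists2 u, u \in heads p i.+1 & adjb p u v.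
Proof.
move=> up r vp vh gyv Kv.
have pe := rotn_perm r.
have uq : uniq (y :: q) by rewrite -(perm_uniq pe).
have vq : v \in y :: q by rewrite -(perm_mem pe).
have vy : v <> y by move=> vy; case/negP: vh; rewrite vy; apply/headsP; exists q.
have [pr [u [w E]]] := adjs_pred uq vq vy.
have [ex|nex] := pselect (exists2 a, a \in heads p i & adjb p a v).
  by case: ex => a ah av; exists a => //; apply: (subsetP (heads_mono p (leqnSn i))).
have pers a : adjb p a v -> adjb (y :: q) a v.
  move=> av; apply: (rotn_adjb r av) => //.
  by apply/negP => ah; apply: nex; exists a.
(* If no neighbour of [v] on [p] has been a head, all of them are still next to [v]: before it, as
   [pr], or after it. *)
have cand a : adjb p a v -> a = pr \/ exists w', w = a :: w'.
  move=> /pers; rewrite E => /orP[A|A]; first by left; apply: adjs_mid A; rewrite -E.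
  by right; apply: adjs_mid_succ A; rewrite -E.
(* The rotation with pivot [v] makes [pr] the head, so [pr] only has to be an original neighbour. *)
suff prv : adjb p pr v.
  exists pr => //; apply/headsP; exists (rev u ++ v :: w).
  apply: (rotnS r); rewrite E; apply: Rot1; last exact: Kv.
  by case: (u) E => [|c u'] /= [<- _].
have hv : v <> head v p.
  move=> hv; case/negP: vh; apply/headsP; case: (p) vp hv => [|a p'] //= _ ->.
  by exists p'; apply: rotn0.
(* Rotations fix the last vertex: if [v] ends [p], it has no successor now either. Otherwise [v] has
   two neighbours on [p], and only one of them can be the successor. *)
have [lv|lv] := eqVneq v (last v p).
  have [a [u' [w' Ep]]] := adjs_pred up vp hv.
  have av : adjb p a v by rewrite Ep /adjb adjs_cat !eqxx orbT.
  case: (cand a av) => [<- //|[w'' Ew]].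
  move: uq; have := rotn_last v r; rewrite -lv E Ew last_cat /= => Lv.
  by rewrite cat_uniq cons_uniq -{2}Lv mem_last /= !andbF.
have [a [b [av vb ab]]] := adjb_two up vp hv (elimN eqP lv).
have av' : adjb p a v by rewrite /adjb av.
have bv' : adjb p b v by rewrite /adjb vb orbT.
case: (cand a av') => [<- //|[w1 E1]]; case: (cand b bv') => [<- //|[w2 E2]].
by move: E2; rewrite E1 => -[/eqP]; rewrite (negbTE ab).
Qed.

End Rotation.

(** * Neighbourhoods; arcs and ears of cycles *)

Section Basics.
Variables (V : finType) (G : rel V).

Definition nb (A : {set V}) : {set V} := [set y | [exists x in A, G x y]].
Definition cn (A : {set V}) : {set V} := A :|: nb A.
(** Disjointness is included, so such a pair spans a complete bipartite graph in the complement. *)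
Definition nadj (A B : {set V}) : bool :=
  [forall x in A, forall y in B, (x != y) && ~~ G x y].

Implicit Types A B : {set V}.

Lemma nbP A y : reflect (exists2 x, x \in A & G x y) (y \in nb A).
Proof. by rewrite inE; apply: exists_inP. Qed.

Lemma nbS A B : A \subset B -> nb A \subset nb B.
Proof. by move=> sAB; apply/subsetP => y /nbP[x /(subsetP sAB) xB g]; apply/nbP; exists x. Qed.

Lemma nbU A B : nb (A :|: B) = nb A :|: nb B.
Proof.
apply/setP => y; rewrite in_setU; apply/nbP/orP => [[x]|].
  by rewrite inE => /orP[xA|xB] g; [left|right]; apply/nbP; exists x.
by case=> /nbP[x xA g]; exists x => //; rewrite inE xA ?orbT.
Qed.

Lemma nb0 : nb set0 = set0.
Proof. by apply/setP => y; rewrite in_set0; apply/negP => /nbP[x]; rewrite inE. Qed.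

Lemma cnS A B : A \subset B -> cn A \subset cn B.
Proof. by move=> sAB; apply: setUSS => //; apply: nbS. Qed.

Lemma nadjP A B :
  reflect (forall x y, x \in A -> y \in B -> x <> y /\ ~~ G x y) (nadj A B).
Proof.
apply: (iffP forall_inP) => [h x y xA yB|h x xA].
  by have /forall_inP/(_ y yB)/andP[/eqP ? ?] := h x xA.
by apply/forall_inP => y yB; have [/eqP-> ->] := h x y xA yB.
Qed.

Lemma nadj_cn A B : nadj A B = [disjoint B & cn A].
Proof.
rewrite disjoint_subset; apply/nadjP/subsetP => [h y yB|h x y xA yB].
  rewrite !inE negb_or; apply/andP; split.
    by apply/negP => yA; case: (h y y yA yB).
  by apply/negP => /exists_inP[x xA g]; have [_] := h x y xA yB; rewrite g.
have := h y yB; rewrite !inE negb_or => /andP[yA /exists_inP nx]; split.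
  by move=> xy; move: yA; rewrite -xy xA.
by apply/negP => g; apply: nx; exists x.
Qed.

Lemma nadjS A B A' B' : A' \subset A -> B' \subset B -> nadj A B -> nadj A' B'.
Proof.
move=> /subsetP sA /subsetP sB /nadjP h; apply/nadjP => x y /sA xA /sB yB.
exact: h.
Qed.

Hypothesis Gs : symmetric G.

Lemma nadjC A B : nadj A B = nadj B A.
Proof.
by apply/nadjP/nadjP => h x y xA yB; have [/nesym ? g] := h y x yB xA; rewrite Gs.
Qed.

Lemma sorted_revG p : sorted G (rev p) = sorted G p.
Proof.
rewrite rev_sorted; apply: eq_sorted => x y; exact: Gs.
Qed.

Lemma sorted_catG p x y q :
  sorted G (rcons p x ++ y :: q) = [&& sorted G (rcons p x), G x y & sorted G (y :: q)].
Proof.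
case: p => [|a p] //=; rewrite ?andbT //.
by rewrite cat_path last_rcons /=.
Qed.

Lemma rot1_sorted K p q : rot1 G K p q -> sorted G p -> sorted G q.
Proof.
move=> /rot1E[u [y [x [w [-> -> gx _]]]]]; rewrite sorted_catG => /and3P[s1 _ s2].
case: u gx s1 => [|a u] /= gx s1; first by rewrite gx.
rewrite rev_cons sorted_catG gx s2 !andbT -rev_cons sorted_revG; exact: s1.
Qed.

Lemma rotn_sorted K p i q : rotn G K p i q -> sorted G p -> sorted G q.
Proof. by elim=> // i' q1 q2 _ IH /rot1_sorted r /IH; exact: r. Qed.

Lemma cycle_consG x p : cycle G (x :: p) = path G x p && G (last x p) x.
Proof. by rewrite /= rcons_path. Qed.

Lemma cycle_sorted p : cycle G p -> sorted G p.
Proof. by case: p => [|x p] //; rewrite cycle_consG => /andP[]. Qed.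

(** One of the two truncated differences is zero, so this is the absolute difference of
    positions. *)
Definition index_gap (Z : seq V) u v := (index u Z - index v Z) + (index v Z - index u Z).

Lemma index_gapC Z u v : index_gap Z u v = index_gap Z v u.
Proof. exact: addnC. Qed.

(** A longer arc between [u] and [v], ends included, opens a suitable rotation of [Z]; at which of
    the two it starts depends on their order and on which arc is longer. *)
Lemma arc_spec Z u v : uniq Z -> u \in Z -> v \in Z -> u != v ->
  exists k a b, [/\ rot k Z = a ++ b,
    size a = (maxn (index_gap Z u v) (size Z - index_gap Z u v)).+1
    & (exists a', a = u :: rcons a' v) \/ (exists a', a = v :: rcons a' u)].
Proof.
move=> uZ; wlog lt : u v / index u Z < index v Z.
  move=> H uin vin uv; have := ltngtP (index u Z) (index v Z); case=> [lt|lt|eq].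
  - exact: H.
  - have [||//|k [a [b [E S O]]]] := H v u lt => //; first by rewrite eq_sym.
    by exists k, a, b; rewrite index_gapC; split => //; case: O => O; [right|left].
  - by case/eqP: uv; rewrite -(nth_index u uin) eq nth_index.
move=> /splitPr sp; case: sp uZ lt => A R uZ lt vZ uv.
have iu : index u (A ++ u :: R) = size A.
  rewrite index_cat; case: ifP => [uA|_]; last by rewrite /= eqxx addn0.
  by move: uZ; rewrite cat_uniq => /and3P[_ /hasPn/(_ u)]; rewrite inE eqxx => /(_ isT) /=; rewrite uA.
have vA : v \notin A.
  apply/negP => vA; move: lt; rewrite iu index_cat vA.
  by have := index_mem v A; rewrite vA => ? ?; lia.
have vR : v \in R by move: vZ; rewrite mem_cat (negbTE vA) inE eq_sym (negbTE uv).
case/splitPr: vR uZ lt vZ iu => B C uZ lt vZ iu.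
have vB : v \notin B.
  apply/negP => vB; move: uZ; rewrite -cat_rcons catA cat_uniq => /and3P[_ /hasPn/(_ v)].
  by rewrite inE eqxx => /(_ isT) /=; rewrite mem_cat vB orbT.
have iv : index v (A ++ u :: B ++ v :: C) = (size A + size B).+1.
  by rewrite index_cat (negbTE vA) /= (negbTE uv) index_cat (negbTE vB) /= eqxx addn0 addnS.
have dE : index_gap (A ++ u :: B ++ v :: C) u v = (size B).+1 by rewrite /index_gap iu iv; lia.
have sE : size (A ++ u :: B ++ v :: C) = (size A + size B + size C).+2.
  by rewrite !size_cat /= size_cat /=; lia.
rewrite dE sE; case: (leqP ((size A + size B + size C).+2 - (size B).+1) (size B).+1) => le.
  exists (size A), (u :: rcons B v), (C ++ A); split.
  - by rewrite rot_size_cat /= cat_rcons -catA.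
  - by rewrite /= size_rcons; lia.
  - by left; exists B.
exists (size (A ++ u :: B)), (v :: rcons (C ++ A) u), B; split.
- have -> : A ++ u :: B ++ v :: C = (A ++ u :: B) ++ v :: C by rewrite -catA.
  by rewrite rot_size_cat /= cat_rcons -catA.
- by rewrite /= size_rcons size_cat; lia.
- by right; exists (C ++ A).
Qed.

Lemma rev_headE (x : V) (k : seq V) :
  exists2 k', rev (x :: k) = last x k :: k' & last (last x k) k' = x.
Proof.
exists (rev (belast x k)); first by rewrite lastI rev_rcons.
by case: k => [|y k] //=; rewrite rev_cons last_rcons.
Qed.

Lemma cycle_cat2 x p y q :
  cycle G ((x :: p) ++ (y :: q)) =
  [&& path G x p, G (last x p) y, path G y q & G (last y q) x].
Proof. by rewrite cat_cons cycle_consG cat_path last_cat /= -!andbA. Qed.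

(** A shorter arc is replaced by the outside path. Only [perm_eq] is claimed for the inserted part,
    since it may be traversed backwards. *)
Lemma ear_spec Z u v x0 k0 : cycle G Z -> uniq Z -> u \in Z -> v \in Z -> u != v ->
  path G x0 k0 -> uniq (x0 :: k0) -> G u x0 -> G (last x0 k0) v ->
  (forall x, x \in x0 :: k0 -> x \notin Z) ->
  exists k a b ka, [/\ rot k Z = a ++ b,
    size a = (maxn (index_gap Z u v) (size Z - index_gap Z u v)).+1,
    cycle G (a ++ ka), uniq (a ++ ka) & perm_eq ka (x0 :: k0)].
Proof.
move=> cZ uZ uin vin uv sk uk g1 g2 dk.
have [k [a [b [E S O]]]] := arc_spec uZ uin vin uv.
have sa : sorted G a.
  have : sorted G (rot k Z) by apply: cycle_sorted; rewrite rot_cycle.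
  rewrite E; case: (a) => [|x a'] //=; rewrite cat_path => /andP[] //.
have ua : uniq a by move: uZ; rewrite -(rot_uniq k) E cat_uniq => /and3P[].
have dis ka : perm_eq ka (x0 :: k0) -> uniq (a ++ ka).
  move=> pk; rewrite cat_uniq ua (perm_uniq pk) uk andbT /=.
  apply/hasPn => x; rewrite (perm_mem pk) => /dk; apply: contra => xa.
  by rewrite -(mem_rot k) E mem_cat xa.
have pr : perm_eq (rev (x0 :: k0)) (x0 :: k0) by rewrite perm_rev.
case: O => -[a' Ea].
- exists k, a, b, (rev (x0 :: k0)); split => //; last exact: dis.
  have := sorted_revG (x0 :: k0); have [k' Ek Lk] := rev_headE x0 k0.
  rewrite Ek Ea cycle_cat2 last_rcons -[path G u _]/(sorted G (u :: rcons a' v)) -Ea sa Lk.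
  by rewrite [G v _]Gs g2 [G x0 u]Gs g1 /= sk => ->.
- exists k, a, b, (x0 :: k0); split => //; last exact: dis.
  rewrite Ea cycle_cat2 last_rcons -[path G v _]/(sorted G (v :: rcons a' u)) -Ea sa.
  by rewrite g1 sk g2.
Qed.

End Basics.

Lemma split_last (T : eqType) (P : pred T) (s : seq T) : has P s ->
  exists A w B, [/\ s = A ++ w :: B, P w & ~~ has P B].
Proof.
elim/last_ind: s => [|s x IH] //; rewrite has_rcons.
have [Px _|nPx /= /IH[A [w [B [-> Pw nB]]]]] := boolP (P x).
  by exists s, x, [::]; rewrite cats1.
by exists A, w, (rcons B x); rewrite rcons_cat rcons_cons has_rcons negb_or nPx.
Qed.

Lemma cat_cons_inj (T : eqType) (x : T) s1 t1 s2 t2 :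
  uniq (s1 ++ x :: t1) -> s1 ++ x :: t1 = s2 ++ x :: t2 -> s1 = s2 /\ t1 = t2.
Proof.
move=> u1 E; have nin s t : uniq (s ++ x :: t) -> x \in s = false.
  by rewrite cat_uniq => /and3P[_ /hasPn/(_ x)]; rewrite inE eqxx => /(_ isT) /negbTE.
have u2 : uniq (s2 ++ x :: t2) by rewrite -E.
have := congr1 (index x) E; rewrite !index_cat (nin _ _ u1) (nin _ _ u2) /= eqxx !addn0.
move=> sz; have /eqP := E; rewrite eqseq_cat // => /andP[/eqP-> /eqP[->]].
by [].
Qed.

Lemma cat_cons_split (T : eqType) (x w : T) s t A B :
  uniq (s ++ x :: t) -> s ++ x :: t = A ++ w :: B -> x != w -> x \notin B ->
  exists2 A', A = s ++ x :: A' & t = A' ++ w :: B.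
Proof.
move=> u E xw xB; have : x \in A ++ w :: B by rewrite -E mem_cat inE eqxx orbT.
rewrite mem_cat inE (negbTE xw) (negbTE xB) !orbF => /splitPr sp.
case: sp E => A1 A2; rewrite -catA cat_cons => E.
by have [-> ->] := cat_cons_inj u E; exists A2.
Qed.

(** * Posa's lemma for longest paths with one end fixed *)

Section Posa.
Variables (V : finType) (G : rel V).
Hypothesis Gs : symmetric G.
Hypothesis Gi : irreflexive G.

(** A vertex has at most one successor and one predecessor on [p], so the images of [S] under the
    two maps cover [B]. *)
Lemma adj_nbrs_card (p : seq V) (S B : {set V}) : uniq p ->
  (forall v, v \in B -> exists2 u, u \in S & adjb p u v) -> #|B| <= 2 * #|S|.
Proof.
move=> up h.
pose nx u := odflt u [pick v | adjs p u v].
pose pv u := odflt u [pick v | adjs p v u].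
have nxE u v : adjs p u v -> nx u = v.
  move=> uv; rewrite /nx; case: pickP => [v' uv'|/(_ v)]; last by rewrite uv.
  exact: adjs_uniq_r up uv' uv.
have pvE u v : adjs p v u -> pv u = v.
  move=> uv; rewrite /pv; case: pickP => [v' uv'|/(_ v)]; last by rewrite uv.
  exact: adjs_uniq_l up uv' uv.
have sub : B \subset [set nx u | u in S] :|: [set pv u | u in S].
  apply/subsetP => v /h[u uS /orP[/nxE E|/pvE E]]; rewrite inE; apply/orP; [left|right];
  by apply/imsetP; exists u.
apply: (leq_trans (subset_leq_card sub)); apply: (leq_trans (leq_card_setU _ _)).
by rewrite mul2n -addnn leq_add // leq_imset_card.
Qed.

(** [S] consists of all heads reached by rotations. For the cycle, let [w] be the last vertex of [p]
    in [S] or its neighbourhood. All pivots lie in that set, so no rotation alters [p] from [w] on;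
    [w] is adjacent to some head [s], and the path from [s] closes at [w] around the whole set. *)
Lemma posa_main (Y : {set V}) p x0 : uniq p -> sorted G p -> {subset p <= Y} ->
  p <> [::] -> last x0 p = x0 ->
  (forall q, uniq q -> sorted G q -> {subset q <= Y} -> last x0 q = x0 -> size q <= size p) ->
  exists S : {set V},
    [/\ S != set0, {subset S <= p}, nb G S :&: Y \subset p, #|(nb G S :&: Y) :\: S| <= 2 * #|S| &
    (forall s, s \in S -> exists q, [/\ perm_eq p (s :: q), path G s q & last s q = x0]) /\
    (nb G S :&: Y != set0 -> exists c, [/\ cycle G c, uniq c, {subset c <= p} &
       forall x, x \in S :|: (nb G S :&: Y) -> x \in c])].
Proof.
move=> up sp pY p0 lp mx.
pose K := fun _ _ : V => True.
(* Head sets grow with the number of rotations; [i] is a point from which they are stable. *)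
have [c [i Ec] cm] : exists2 c, (exists i, c = #|heads G K p i|) & forall j, (exists i, j = #|heads G K p i|) -> j <= c.
  apply: (@ex_max_nat _ #|V|); first by exists #|heads G K p 0|, 0.
  by move=> j [i ->]; apply: max_card.
set S := heads G K p i in Ec.
have SE j : i <= j -> heads G K p j = S.
  move=> ij; apply/esym/eqP; rewrite eqEcard heads_mono //= -Ec; apply: cm.
  by exists j.
have hS j : heads G K p j \subset S.
  by rewrite -(SE (maxn i j)) ?leq_maxl //; apply: heads_mono; rewrite leq_maxr.
have SP s : s \in S -> exists q, [/\ rotn G K p i (s :: q), perm_eq p (s :: q), path G s q & last s q = x0].
  case/headsP=> q r; exists q; split => //; first exact: (rotn_perm r).
    by have := rotn_sorted Gs r sp.
  have := rotn_last x0 r; rewrite lp /=; exact.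
have hp : head x0 p \in S.
  apply: (subsetP (hS 0)); apply/headsP; case: (p) p0 => [|a p'] // _.
  by exists p'; apply: rotn0.
have nbp : nb G S :&: Y \subset p.
  apply/subsetP => v; rewrite inE => /andP[/nbP[s sS g] vY].
  have [q [r pq sq lq]] := SP s sS; apply/negPn/negP => vp.
  have := mx (v :: s :: q); rewrite /= Gs g sq lq (perm_size pq) /= ltnn.
  have -> : (v \notin s :: q) && ((s \notin q) && uniq q).
    by rewrite -(perm_mem pq) vp -[_ && _]/(uniq (s :: q)) -(perm_uniq pq).
  move=> H; have : false by apply: H => // z; rewrite inE => /orP[/eqP-> //|]; rewrite -(perm_mem pq); apply: pY.
  by [].
have nbadj v : v \in (nb G S :&: Y) :\: S -> exists2 u, u \in S & adjb p u v.
  rewrite in_setD in_setI => /andP[vS /andP[/nbP[s sS g] vY]].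
  have [q [r pq sq lq]] := SP s sS.
  have vp : v \in p by apply: (subsetP nbp); rewrite inE vY andbT; apply/nbP; exists s.
  have [|u uS a] := posa_step up r vp vS g; first by [].
  by exists u => //; apply: (subsetP (hS i.+1)).
exists S; split => //.
- by apply/set0Pn; exists (head x0 p).
- by move=> s /heads_sub.
- exact: adj_nbrs_card up nbadj.
split; first by move=> s /SP[q [_ pq sq lq]]; exists q.
move=> nb0; set D := S :|: (nb G S :&: Y).
have Dp : {subset D <= p}.
  by move=> x; rewrite in_setU => /orP[/heads_sub //|/(subsetP nbp)].
have hD : has (mem D) p.
  case/set0Pn: nb0 => x xn; apply/hasP; exists x; last by rewrite inE /= /D inE xn orbT.
  by apply: (subsetP nbp).
have [A [w [B [Ep wD nB]]]] := split_last hD.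
have pivD x s : s \in S -> x \in p -> G s x -> x \in D.
  by move=> sS xp g; rewrite in_setU in_setI (pY _ xp) andbT; apply/orP; right; apply/nbP; exists s.
have form j q : rotn G K p j q -> exists2 A', perm_eq A A' & q = A' ++ w :: B.
  elim=> [j'|j' q1 q2 r [A1 pA1 E1] r1]; first by exists A.
  have q1S : forall y q', q1 = y :: q' -> y \in S.
    by move=> y q' E; apply: (subsetP (hS j')); apply/headsP; exists q'; rewrite -E.
  have q1p := perm_mem (rotn_perm r).
  have [u [y [x [v [Eq1 -> gx _]]]]] := rot1E r1.
  have xD : x \in D.
    apply: (pivD x (head y (rcons u y))) => //; last by rewrite q1p Eq1 mem_cat inE eqxx orbT.
    by move: Eq1; case: (u) => [|a u'] /= Eq1; apply: (q1S _ _ Eq1).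
  have xnB : x \notin B by apply: contra nB => xB; apply/hasP; exists x.
  have uq1 : uniq q1 by rewrite -(perm_uniq (rotn_perm r)).
  move: uq1 Eq1; rewrite E1 => uq1 Eq1.
  have [xw|xw] := eqVneq x w.
    move: uq1 Eq1; rewrite -xw => uq1 /(cat_cons_inj uq1) [EA <-].
    by exists (rev (rcons u y)) => //; rewrite -EA perm_sym perm_rev perm_sym.
  have [A' EA ->] : exists2 A', A1 = rcons u y ++ x :: A' & v = A' ++ w :: B.
    by apply: (cat_cons_split _ (esym Eq1) xw xnB); rewrite -Eq1.
  exists (rev (rcons u y) ++ x :: A'); last by rewrite -catA.
  by rewrite (perm_trans pA1) // EA perm_sym perm_cat2r perm_rev.
(* With nothing before [w], the set [D] is just [w], and a neighbour of a head would be a loop. *)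
have [A0|A0] := eqVneq A [::].
  exfalso; have Ep' : p = w :: B by rewrite Ep A0.
  have DE x : x \in D -> x = w.
    move=> xD; have := Dp _ xD; rewrite Ep' inE => /orP[/eqP //|xB].
    by case/negP: nB; apply/hasP; exists x.
  case/set0Pn: nb0 => x; rewrite inE => /andP[/nbP[s sS g] xY].
  have xs : x = s.
    rewrite [RHS](_ : s = w); first apply: DE; last by apply: DE; rewrite in_setU sS.
    by rewrite in_setU in_setI xY andbT; apply/orP; right; apply/nbP; exists s.
  by move: g; rewrite xs Gi.
(* A head opens its path, whereas [w] always has a rearrangement of the nonempty [A] before it. *)
have wS : w \notin S.
  apply/negP => /SP[q [r _ _ _]]; have [A' pA E] := form _ _ r.
  have : uniq (w :: q) by rewrite -(perm_uniq (rotn_perm r)).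
  case: A' pA E => [|a A'] pA E; first by move/perm_size: pA; move: A0; rewrite -size_eq0 => /eqP.
  by case: E => _ ->; rewrite /= mem_cat inE eqxx orbT.
have : w \in nb G S by move: wD; rewrite /= in_setU in_setI (negbTE wS) => /andP[].
case/nbP => s sS g; have [q [r pq sq lq]] := SP s sS.
have [A' pA E] := form _ _ r.
case: A' pA E => [|a A'] pA E; first by move/perm_size: pA; move: A0; rewrite -size_eq0 => /eqP.
case: E => Es Eq; subst a.
have ucc : uniq (s :: A' ++ w :: B) by rewrite -Eq -(perm_uniq pq).
exists (s :: rcons A' w); split.
- rewrite cycle_consG last_rcons Gs g andbT.
  by move: sq; rewrite Eq -cat_rcons cat_path => /andP[].
- by move: ucc; rewrite -cat_rcons -cat_cons cat_uniq => /and3P[].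
- move=> x xc; rewrite (perm_mem pq) Eq -cat_rcons -cat_cons mem_cat; apply/orP; left.
  exact: xc.
- move=> x xD; have := Dp _ xD; rewrite (perm_mem pq) Eq -cat_rcons -cat_cons mem_cat.
  by case/orP=> // xB; case/negP: nB; apply/hasP; exists x.
Qed.

End Posa.

Lemma split_first (T : eqType) (P : pred T) (s : seq T) : has P s ->
  exists A w B, [/\ s = A ++ w :: B, P w & ~~ has P A].
Proof.
elim: s => [|x s IH] //=.
have [Px _|nPx /= /IH[A [w [B [-> Pw nB]]]]] := boolP (P x).
  by exists [::], x, s.
by exists (x :: A), w, B; rewrite /= negb_or nPx.
Qed.

(** * Menger's theorem and merging of cycles *)

Section Menger.
Variable V : finType.
Implicit Types (E : rel V) (A B S : {set V}).

Definition separates E A B S := forall x p, x \in A -> path E x p ->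
  last x p \in B -> has (mem S) (x :: p).

Lemma sorted_cat_l E s t : sorted E (s ++ t) -> sorted E s.
Proof. by case: s => [|x s] //=; rewrite cat_path => /andP[]. Qed.

Lemma sorted_cat_r E s t : sorted E (s ++ t) -> sorted E t.
Proof.
elim: s => [|x s IH] //= /path_sorted; exact: IH.
Qed.

Lemma sorted_cat_mid E s v t : sorted E (s ++ v :: t) -> sorted E (rcons s v).
Proof. by rewrite -cat_rcons; apply: sorted_cat_l. Qed.

Lemma sorted_glue E s v t : sorted E (rcons s v) -> sorted E (v :: t) -> sorted E (s ++ v :: t).
Proof.
case: s => [|x s] //=; rewrite -cats1 !cat_path /= => /and3P[-> -> _] /=.
by [].
Qed.

Section DelEdge.
Variables (E : rel V) (x y : V).
Definition deledge : rel V := [rel a b | E a b && ((a, b) != (x, y))].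

Lemma deledgeE a b : deledge a b = E a b && ((a, b) != (x, y)).
Proof. by []. Qed.

Lemma deledge_sub : subrel deledge E.
Proof. by move=> a b /andP[]. Qed.

Lemma deledge_path s : sorted E s -> sorted deledge s \/ (x \in s /\ y \in s).
Proof.
elim: s => [|a [|b s] IH] //=; [by left | by left |].
move=> /andP[ab ps]; case: (IH ps) => [ps'|[xs ys]]; last first.
  by right; rewrite !inE in xs ys *; rewrite xs ys !orbT.
have [[-> ->]|ne] := pselect ((a, b) = (x, y)).
  by right; rewrite !inE !eqxx orbT.
by left; apply/andP; split => //; rewrite deledgeE ab; apply/eqP.
Qed.

Lemma deledge_src s v : sorted E (rcons s v) -> x \notin s -> sorted deledge (rcons s v).
Proof.
elim: s v => [|a s IH] v //; rewrite inE negb_or => srt /andP[xa xs].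
have := IH v; case: s srt {IH} xs => [|b s] /=.
  by rewrite !andbT => ab _ _; rewrite deledgeE ab /= xpair_eqE eq_sym (negbTE xa).
move=> /andP[ab ps] xs IH; rewrite deledgeE ab xpair_eqE eq_sym (negbTE xa) /=; exact: IH.
Qed.

Lemma deledge_tgt v s : sorted E (v :: s) -> y \notin s -> sorted deledge (v :: s).
Proof.
elim: s v => [|a s IH] v //=; rewrite inE negb_or => /andP[va ps] /andP[ya ys].
by rewrite deledgeE va xpair_eqE [a == y]eq_sym (negbTE ya) andbF /=; apply: IH.
Qed.
End DelEdge.

Definition linked E A B k (D : {set V}) (P : V -> seq V) :=
  [/\ D \subset A, #|D| = k,
     forall d, d \in D -> [/\ path E d (P d), uniq (d :: P d) & last d (P d) \in B] &
     forall d e v, d \in D -> e \in D -> v \in d :: P d -> v \in e :: P e -> d = e].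

(** Goering's induction on the number of arcs. If deleting the arc [(x, y)] creates a separator [S]
    with fewer than [k] elements, then [x |: S] and [y |: S] separate [A] from [B] in [E] and have
    exactly [k] elements; systems of paths from [A] to [x |: S] and from [y |: S] to [B] are glued
    along [S] and the deleted arc. *)
Theorem menger E A B k : (forall S, separates E A B S -> k <= #|S|) ->
  exists D P, linked E A B k D P.
Proof.
have [N] := ubnP #|[set e : V * V | E e.1 e.2]|.
elim: N E A B => // N IH E A B ltN sep.
have [[[x y] xyE]|noE] := pselect (exists e : V * V, E e.1 e.2); last first.
  have [D DAB cD] : exists2 D : {set V}, D \subset A :&: B & #|D| = k.
    apply: subset_card_eq; apply: sep => z [|w p] zA /=; last first.
      by case/andP=> zw _; case: noE; exists (z, w).
    by move=> _ zB; rewrite orbF inE /= zA.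
  exists D, (fun _ => [::]); split => //.
  - by apply: subset_trans DAB _; apply: subsetIl.
  - by move=> d /(subsetP DAB); rewrite inE => /andP[_ dB].
  - by move=> d e v _ _; rewrite !inE => /eqP<- /eqP.
set E' := deledge E x y.
have E'E : subrel E' E by apply: deledge_sub.
have ltE' : #|[set e : V * V | E' e.1 e.2]| < N.
  rewrite -ltnS; apply: leq_trans ltN; rewrite ltnS; apply: proper_card.
  apply/properP; split; first by apply/subsetP => e; rewrite !inE => /andP[].
  by exists (x, y); rewrite inE ?[E' _ _]deledgeE ?eqxx ?andbF.
have [sep'|/asboolPn] := pselect (forall S, separates E' A B S -> k <= #|S|).
  have [D [P [DA cD hP dis]]] := IH _ _ _ ltE' sep'.
  exists D, P; split => // d dD; have [pd ud ld] := hP d dD; split => //.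
  exact: (sub_path E'E).
move=> /asboolPn/existsNP[S /not_implyP[sS /negP]]; rewrite -ltnNge => ltS.
have sX : separates E A B (x |: S).
  move=> a p aA pp lp; case: (@deledge_path E x y (a :: p) pp) => [pp'|[xp yp]].
    have /hasP[s sp sS'] := sS a p aA pp' lp; apply/hasP; exists s => //.
    by apply/setU1P; right.
  by apply/hasP; exists x => //; apply: setU11.
have sY : separates E A B (y |: S).
  move=> a p aA pp lp; case: (@deledge_path E x y (a :: p) pp) => [pp'|[xp yp]].
    have /hasP[s sp sS'] := sS a p aA pp' lp; apply/hasP; exists s => //.
    by apply/setU1P; right.
  by apply/hasP; exists y => //; apply: setU11.
have cX : #|x |: S| = k /\ x \notin S.
  by have := sep _ sX; have := cardsU1 x S; case: (x \in S) => /= ? ?; split => //; lia.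
have cY : #|y |: S| = k /\ y \notin S.
  by have := sep _ sY; have := cardsU1 y S; case: (y \in S) => /= ? ?; split => //; lia.
case: cX cY => cX xS [cY yS].
(* A separator of [A] from [x |: S] in [E'] separates [A] from [B] in [E]: up to its first vertex in
   [x |: S], a path cannot have used the arc leaving [x]. The second system is symmetric. *)
have [D1 [P1 [D1A cD1 hP1 dis1]]] : exists D P, linked E' A (x |: S) k D P.
  apply: IH => // T sT; apply: sep => a p aA pp lp.
  have [u [v [w [Es vX nu]]]] := split_first (sX a p aA pp lp).
  have xu : x \notin u by apply: contra nu => xu; apply/hasP; exists x => //; apply: setU11.
  have srt : sorted E' (rcons u v).
    by apply: deledge_src => //; apply: (@sorted_cat_mid _ _ _ w); rewrite -Es.
  have : has (mem T) (rcons u v).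
    case: u Es srt {nu xu} => [|b u] [Ea Ep] srt; subst.
      by apply: (sT v [::]) => //=; rewrite -?Ea.
    by apply: (sT b (rcons u v)) => //; rewrite last_rcons.
  by rewrite Es -cat_rcons has_cat => ->.
have [D2 [P2 [D2Y cD2 hP2 dis2]]] : exists D P, linked E' (y |: S) B k D P.
  apply: IH => // T sT; apply: sep => a p aA pp lp.
  have [u [v [w [Es vY nw]]]] := split_last (sY a p aA pp lp).
  have yw : y \notin w by apply: contra nw => yw; apply/hasP; exists y => //; apply: setU11.
  have srt : sorted E' (v :: w).
    by apply: deledge_tgt => //; apply: (@sorted_cat_r _ u); rewrite -Es.
  have lw : last v w = last a p by rewrite -[RHS]/(last a (a :: p)) Es last_cat.
  have : has (mem T) (v :: w) by apply: (sT v w) => //; rewrite lw.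
  by rewrite Es has_cat => ->; rewrite orbT.
have D2E : D2 = y |: S by apply/eqP; rewrite eqEcard D2Y cD2 cY leqnn.
subst D2.
pose l d := last d (P1 d).
have lin d : l d \in d :: P1 d by apply: mem_last.
have lX d : d \in D1 -> l d \in x |: S by case/hP1.
have linj : {in D1 &, injective l}.
  by move=> d e dD eD lde; apply: (dis1 d e (l d)) => //; rewrite lde.
have limg : l @: D1 = x |: S.
  apply/eqP; rewrite eqEcard card_in_imset // cD1 cX leqnn andbT.
  by apply/subsetP => z /imsetP[d dD ->]; apply: lX.
have onX d v : d \in D1 -> v \in d :: P1 d -> v \in x |: S -> v = l d.
  move=> dD vd; rewrite -limg => /imsetP[e eD ve].
  by rewrite ve; congr l; apply/esym; apply: (dis1 d e v) => //; rewrite ve.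
have onY q v : q \in y |: S -> v \in q :: P2 q -> v \in y |: S -> v = q.
  by move=> qY vq vY; apply: (dis2 v q v) => //; rewrite inE eqxx.
(* If paths of the two systems meet at [v], the walk switching at [v] runs from [A] to [B] in [E']
   and hits [S], which each system meets only at its junction ends. *)
have cross d q v : d \in D1 -> q \in y |: S -> v \in d :: P1 d -> v \in q :: P2 q ->
    [/\ v = l d, v = q & v \in S].
  move=> dD qY vd vq.
  have [pd ud ld] := hP1 d dD; have [pq uq lq] := hP2 q qY.
  suff : v \in S.
    move=> vS; split=> //; first by apply: onX => //; rewrite in_setU1 vS orbT.
    by apply: onY => //; rewrite in_setU1 vS orbT.
  have [u [w Ed]] : exists u w, d :: P1 d = u ++ v :: w by case/splitPr: vd => u w; exists u, w.
  have [u' [w' Eq]] : exists u w, q :: P2 q = u ++ v :: w by case/splitPr: vq => u' w'; exists u', w'.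
  have srt : sorted E' (u ++ v :: w').
    apply: sorted_glue; first by apply: (@sorted_cat_mid _ _ _ w); rewrite -Ed.
    by apply: (@sorted_cat_r _ u'); rewrite -Eq.
  have lw' : last v w' \in B by have := lq; rewrite -[last q _]/(last q (q :: P2 q)) Eq last_cat.
  have /hasP[s] : has (mem S) (u ++ v :: w').
    case: u Ed srt => [|b u] [Ed Ep] srt.
      by apply: (sS v w') => //; rewrite -Ed; apply: (subsetP D1A).
    by apply: (sS b (u ++ v :: w')) => //=; rewrite ?last_cat // -Ed; apply: (subsetP D1A).
  rewrite mem_cat => /orP[su|sw] sS'.
    have sd : s \in d :: P1 d by rewrite Ed mem_cat su.
    have Es : s = l d by apply: onX => //; rewrite in_setU1 [s \in S]sS' orbT.
    have lE : l d = last v w by rewrite /l -[last d _]/(last d (d :: P1 d)) Ed last_cat.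
    move: ud; rewrite Ed cat_uniq => /and3P[_ /hasPn/(_ s)].
    by rewrite Es lE mem_last => /(_ isT) /=; rewrite -lE -Es su.
  have sq : s \in q :: P2 q by rewrite Eq mem_cat sw orbT.
  have Es : s = q by apply: onY => //; rewrite in_setU1 [s \in S]sS' orbT.
  case: u' Eq => [|b u'] [Eq1 Eq2]; first by rewrite -Eq1 -Es.
  by move: uq; rewrite Eq2 /= -{1}Es mem_cat sw orbT.
(* The start of the path to append: [y], across the deleted arc, when the first path ends at [x]. *)
pose q d := if l d == x then y else l d.
have qY d : d \in D1 -> q d \in y |: S.
  move=> dD; rewrite /q; case: eqP => [_|/eqP ne]; first by rewrite in_setU1 eqxx.
  by have := lX d dD; rewrite !in_setU1 (negbTE ne) /= => ->; rewrite orbT.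
have qinj : {in D1 &, injective q}.
  move=> d e dD eD; rewrite /q; case: eqP => [ld|/eqP ld]; case: eqP => [le|/eqP le] E0.
  - by apply: linj => //; rewrite ld le.
  - by have := lX e eD; rewrite in_setU1 (negbTE le) -E0 (negbTE yS).
  - by have := lX d dD; rewrite in_setU1 (negbTE ld) E0 (negbTE yS).
  - exact: linj.
pose P d := P1 d ++ (if l d == x then y :: P2 y else P2 (l d)).
have Pmem d v : v \in d :: P d -> v \in d :: P1 d \/ v \in q d :: P2 (q d).
  rewrite /P -cat_cons mem_cat => /orP[->|]; first by left.
  by rewrite /q; case: eqP => _ vi; right => //; rewrite inE vi orbT.
exists D1, P; split => //.
- move=> d dD; have [pd ud ld] := hP1 d dD; have [pq uq lq] := hP2 _ (qY d dD).
  have pE s t : path E' s t -> path E s t by apply: (sub_path E'E).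
  rewrite /P cat_path last_cat -/(l d) -cat_cons cat_uniq ud (pE _ _ pd) /=.
  move: pq uq lq (fun v => cross d (q d) v dD (qY d dD)); rewrite /q.
  case: eqP => [Ex|/eqP Ex] pq uq lq cr.
    split => //=; first by rewrite Ex xyE (pE _ _ pq).
    rewrite -[_ || _]/(has (mem (d :: P1 d)) (y :: P2 y)) -[X in _ && X]/(uniq (y :: P2 y)).
    rewrite uq andbT; apply/hasPn => v vq; apply/negP => vd.
    by have [_ vy vS] := cr v vd vq; move: yS; rewrite -vy vS.
  split => //; first exact: pE.
  move: uq => /= /andP[nq ->]; rewrite andbT; apply/hasPn => v vq; apply/negP => vd.
  have vq' : v \in l d :: P2 (l d) by rewrite inE vq orbT.
  by have [_ vy vS] := cr v vd vq'; case/negP: nq; rewrite -{1}vy.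
- move=> d e v dD eD vd ve.
  have hc d' e' : d' \in D1 -> e' \in D1 -> v \in d' :: P1 d' -> v \in q e' :: P2 (q e') -> d' = e'.
    move=> dD' eD' v1 v2; have [vl vq vS] := cross _ _ _ dD' (qY _ eD') v1 v2.
    apply: linj => //; rewrite -vl; move: vq; rewrite /q; case: eqP => // _ vy.
    by move: yS; rewrite -vy vS.
  case: (Pmem _ _ vd) => v1; case: (Pmem _ _ ve) => v2.
  + exact: (dis1 d e v).
  + exact: hc.
  + by apply/esym; apply: hc.
  + by apply: qinj => //; apply: (dis2 _ _ v) => //; apply: qY.
Qed.

End Menger.

(** Cut at the first vertex in [B], then at the last one in [A] before it. The condition on
    [take 1 s] says that [s] starts in [A] without naming its head. *)
Lemma trim_path (T : eqType) (A B : pred T) (s : seq T) : has A (take 1 s) -> has B s ->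
  (forall x, A x -> ~~ B x) ->
  exists u a k b w, [/\ s = u ++ a :: k ++ b :: w, A a, B b & ~~ has (predU A B) k].
Proof.
move=> hA hB AB; have [s1 [b [w [Es Bb nB]]]] := split_first hB.
have hA1 : has A s1.
  case: s1 Es nB => [|x s1] Es nB; last by move: hA; rewrite Es /= take0 !orbF => ->.
  by move: hA; rewrite Es /= take0 orbF => /AB; rewrite Bb.
have [u [a [k [E1 Aa nA]]]] := split_last hA1.
exists u, a, k, b, w; split => //; first by rewrite Es E1 -catA.
apply/hasPn => x xk /=; rewrite negb_or (hasPn nA) //=.
by apply: (hasPn nB); rewrite E1 mem_cat inE xk !orbT.
Qed.

Lemma merge_arith x y L L' sm sa kd ke : x < L -> y < L' ->
  sm.+2 = (maxn y (L' - y)).+1 -> sa = (maxn x (L - x)).+1 ->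
  3 * (minn x (L - x) + minn y (L' - y)) <= L + L' ->
  2 * (L + L') <= 3 * (sa + (kd + (sm.+2 + ke))).
Proof.
move=> xL yL.
have -> : maxn y (L' - y) = L' - minn y (L' - y) by lia.
have -> : maxn x (L - x) = L - minn x (L - x) by lia.
have : minn x (L - x) <= L by lia.
have : minn y (L' - y) <= L' by lia.
move: (minn _ _) (minn _ _) => p q; lia.
Qed.

Section Merge.
Variables (V : finType) (G : rel V).
Hypothesis Gs : symmetric G.
Hypothesis Gi : irreflexive G.

Lemma ear_spec2 Z u v K : cycle G Z -> uniq Z -> u \in Z -> v \in Z -> u != v ->
  K <> [::] -> sorted G (u :: rcons K v) -> uniq K ->
  (forall x, x \in K -> x \notin Z) ->
  exists k a b ka, [/\ rot k Z = a ++ b,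
    size a = (maxn (index_gap Z u v) (size Z - index_gap Z u v)).+1,
    cycle G (a ++ ka), uniq (a ++ ka) & perm_eq ka K].
Proof.
case: K => [|x0 k0] // cZ uZ uin vin uv _ /= /andP[gu].
rewrite rcons_path => /andP[pk gv] uk dk.
exact: ear_spec uk gu gv dk.
Qed.

Lemma arc_path (Z : seq V) u v : cycle G Z -> uniq Z -> u \in Z -> v \in Z -> u != v ->
  exists m, [/\ sorted G (u :: rcons m v), uniq (u :: rcons m v),
    {subset u :: rcons m v <= Z} &
    (size m).+2 = (maxn (index_gap Z u v) (size Z - index_gap Z u v)).+1].
Proof.
move=> cZ uZ uin vin uv; have [k [a [b [E S O]]]] := arc_spec uZ uin vin uv.
have sa : sorted G a.
  by have := cycle_sorted (etrans (rot_cycle _ _ _) cZ : cycle G (rot k Z)); rewrite E; apply: sorted_cat_l.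
have ua : uniq a by move: uZ; rewrite -(rot_uniq k) E cat_uniq => /and3P[].
have sub : {subset a <= Z} by move=> x xa; rewrite -(mem_rot k) E mem_cat xa.
case: O => -[a' Ea].
  by exists a'; rewrite -Ea; split => //; rewrite -S Ea /= size_rcons.
exists (rev a').
have -> : u :: rcons (rev a') v = rev a by rewrite Ea rev_cons rev_rcons.
split; rewrite ?sorted_revG ?rev_uniq //.
  by move=> x; rewrite mem_rev; apply: sub.
by rewrite -S Ea /= size_rcons size_rev.
Qed.

Lemma index_gap_lt (Z : seq V) u v : u \in Z -> v \in Z -> index_gap Z u v < size Z.
Proof.
move=> uZ vZ; rewrite /index_gap; have hu : index u Z < size Z by rewrite index_mem.
have hv : index v Z < size Z by rewrite index_mem.
by lia.
Qed.

(** Three points cut the cycle into arcs of total length [size Z], and each minimum is at most the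
    piece with the same ends. *)
Lemma index_gap_three (Z : seq V) x y z : x \in Z -> y \in Z -> z \in Z ->
  minn (index_gap Z x y) (size Z - index_gap Z x y) + minn (index_gap Z y z) (size Z - index_gap Z y z)
   + minn (index_gap Z x z) (size Z - index_gap Z x z) <= size Z.
Proof.
move=> xZ yZ zZ; have hx : index x Z < size Z by rewrite index_mem.
have hy : index y Z < size Z by rewrite index_mem.
have hz : index z Z < size Z by rewrite index_mem.
by rewrite /index_gap; lia.
Qed.

(** Only the positions in a window around the antipode of [a] leave both arcs with at most [y]
    vertices, and the window is too small to hold [I :\ a]. *)
Lemma arc_choice (Z : seq V) a (I : {set V}) : uniq Z -> a \in Z -> {subset I <= Z} -> 2 <= #|I| ->
  exists v, [/\ v \in I, v != a & size Z + #|I| <= 2 * (maxn (index_gap Z a v) (size Z - index_gap Z a v)).+1].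
Proof.
move=> uZ aZ IZ I2; apply: contrapT => /forallNP H.
have lt v : v \in I -> v != a -> 2 * (maxn (index_gap Z a v) (size Z - index_gap Z a v)).+1 < size Z + #|I|.
  by move=> vI va; rewrite ltnNge; apply/negP => ?; apply: (H v).
set L := size Z in lt *.
have [k Z' EZ] := rot_to aZ.
(* the cyclic position of [v] as seen from [a] *)
pose f v := if index a Z <= index v Z then index v Z - index a Z else L + index v Z - index a Z.
(* The largest arc size compatible with the strict bound [lt]. *)
pose y := (L + #|I|).-1./2.
have fI v : v \in I :\ a -> f v \in iota (L - y).+1 (2 * y - L - 1).
  rewrite in_setD1 => /andP[va vI]; have := lt v vI va.
  have vZ : index v Z < L by rewrite index_mem; apply: IZ.
  have aL : index a Z < L by rewrite index_mem.
  have : index v Z != index a Z.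
    apply/eqP => E; case/eqP: va; rewrite -(nth_index a (IZ _ vI)) E nth_index //.
  by rewrite mem_iota /f /y /index_gap; case: ifP; lia.
have finj : {in I :\ a &, injective f}.
  move=> v w /setD1P[_ vI] /setD1P[_ wI].
  have vZ : index v Z < L by rewrite index_mem; apply: IZ.
  have wZ : index w Z < L by rewrite index_mem; apply: IZ.
  have aL : index a Z < L by rewrite index_mem.
  move=> E; rewrite -(nth_index a (IZ _ vI)) -[RHS](nth_index a (IZ _ wI)); congr nth.
  by move: E; rewrite /f; case: ifP; case: ifP; lia.
have : #|I :\ a| <= 2 * y - L - 1.
  rewrite cardE -(size_map f) -[X in _ <= X](size_iota (L - y).+1); apply: uniq_leq_size.
    rewrite map_inj_in_uniq ?enum_uniq // => v w; rewrite !mem_enum; exact: finj.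
  by move=> x /mapP[v]; rewrite mem_enum => vI ->; apply: fI.
by have := cardsD1 a I; rewrite /y; case: (a \in I) => /= ? ?; lia.
Qed.

(** Averaging [index_gap_three] over the pairs among three linking paths, some pair has shorter arcs
    on [Z] and [Z'] of total length at most a third of [size Z + size Z']; routing along the longer
    arcs keeps two thirds. *)
Lemma merge_cycles Z Z' E D P : subrel E G ->
  cycle G Z -> uniq Z -> cycle G Z' -> uniq Z' -> (forall x, x \in Z -> x \notin Z') ->
  linked E [set x in Z] [set x in Z'] 3 D P ->
  exists k a b c, [/\ rot k Z = a ++ b, cycle G (a ++ c), uniq (a ++ c),
    2 * (size Z + size Z') <= 3 * size (a ++ c) & size Z <= 2 * size a /\
    forall x, x \in c -> x \in Z' \/ exists2 d, d \in D & x \in d :: P d].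
Proof.
move=> EG cZ uZ cZ' uZ' dZ [DA cD hP dis].
pose A := [pred x | x \in Z]; pose B := [pred x | x \in Z'].
pose Q (d : V) (t : V * seq V * V) := 
    [/\ t.1.1 \in Z, t.2 \in Z', sorted G (t.1.1 :: rcons t.1.2 t.2),
      {subset t.1.1 :: rcons t.1.2 t.2 <= d :: P d} &
      uniq t.1.2 /\ (forall x, x \in t.1.2 -> x \notin Z /\ x \notin Z')].
(* Each linking path is trimmed so that only its ends lie on the cycles; the triple holds the first
   end, the inside and the last end. *)
have tr d : exists t, d \in D -> Q d t.
  have [dD|dD] := boolP (d \in D); last by exists ((d, [::]), d).
  have [pd ud ld] := hP d dD.
  have [|||u [a [k [b [w [Es Aa Bb nk]]]]]] := @trim_path _ A B (d :: P d).
  - by rewrite /= take0 orbF; move/(subsetP DA): dD; rewrite inE.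
  - by apply/hasP; exists (last d (P d)); [apply: mem_last|move: ld; rewrite inE].
  - exact: dZ.
  have Es' : d :: P d = u ++ (a :: rcons k b) ++ w by rewrite Es /= cat_rcons.
  exists ((a, k), b) => _; split => //=.
  - have := sorted_cat_l (sorted_cat_r (_ : sorted E (u ++ (a :: rcons k b) ++ w))).
    rewrite -Es' => /(_ pd) srt; exact: (sub_path EG).
  - by move=> x xk; rewrite Es' !mem_cat xk orbT.
  - split; last by move=> x xk; move/hasPn: nk => /(_ x xk) /=; rewrite negb_or => /andP[].
    by move: ud; rewrite Es cat_uniq /= cat_uniq => /and5P[_ _ _].
have [t ht] := choice tr.
have [d1 [d2 [d3 [d1D d2D d3D [n12 n13 n23]]]]] : exists d1 d2 d3,
   [/\ d1 \in D, d2 \in D, d3 \in D & [/\ d1 != d2, d1 != d3 & d2 != d3]].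
  have : size (enum D) = 3 by rewrite -cardE.
  have := enum_uniq D; have mD x := mem_enum D x.
  case: (enum D) mD => [|d1 [|d2 [|d3 [|? ?]]]] // mD; rewrite /= !inE !negb_or !andbT.
  move=> /andP[/andP[n12 n13] n23] _; exists d1, d2, d3.
  by rewrite -!mD !inE !eqxx !orbT.
pose a d := (t d).1.1; pose b d := (t d).2; pose k d := (t d).1.2.
pose ls (Y : seq V) u v := minn (index_gap Y u v) (size Y - index_gap Y u v).
have [d [e [dD eD nde bnd]]] : exists d e, [/\ d \in D, e \in D, d != e &
    3 * (ls Z (a d) (a e) + ls Z' (b d) (b e)) <= size Z + size Z'].
  have inZ d : d \in D -> a d \in Z by case/ht.
  have inZ' d : d \in D -> b d \in Z' by case/ht.
  have h1 := index_gap_three (inZ _ d1D) (inZ _ d2D) (inZ _ d3D).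
  have h2 := index_gap_three (inZ' _ d1D) (inZ' _ d2D) (inZ' _ d3D).
  rewrite -!/(ls _ _ _) in h1 h2.
  have [c12|c12] := leqP (3 * (ls Z (a d1) (a d2) + ls Z' (b d1) (b d2))) (size Z + size Z').
    by exists d1, d2.
  have [c13|c13] := leqP (3 * (ls Z (a d1) (a d3) + ls Z' (b d1) (b d3))) (size Z + size Z').
    by exists d1, d3.
  by exists d2, d3; split => //; lia.
have [adZ bdZ sd subd [ukd dkd]] := ht d dD.
have [aeZ beZ se sube [uke dke]] := ht e eD.
rewrite -/(a d) -/(b d) -/(k d) -/(a e) -/(b e) -/(k e) in adZ bdZ sd subd ukd dkd aeZ beZ se sube uke dke.
have disj x : x \in a d :: rcons (k d) (b d) -> x \in a e :: rcons (k e) (b e) -> False.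
  move=> /subd xd /sube xe; move/negP: nde; apply; apply/eqP; exact: (dis d e x).
have nab : a d != a e by apply/eqP => Ea; apply: (disj (a d)); rewrite ?Ea inE eqxx.
have nbb : b d != b e.
  by apply/eqP => Eb; apply: (disj (b d)); rewrite ?Eb inE mem_rcons inE eqxx orbT.
have [m [sm um subm szm]] := arc_path cZ' uZ' bdZ beZ nbb.
pose K := k d ++ (b d :: rcons m (b e)) ++ rev (k e).
have kd' x : x \in k d -> x \in a d :: rcons (k d) (b d) by move=> xk; rewrite inE mem_rcons inE xk !orbT.
have ke' x : x \in k e -> x \in a e :: rcons (k e) (b e) by move=> xk; rewrite inE mem_rcons inE xk !orbT.
have [||||kk [A1 [B1 [ka [E1 S1 C1 U1 P1]]]]] := @ear_spec2 Z (a d) (a e) K cZ uZ adZ aeZ nab.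
- by rewrite /K; case: (k d).
- have -> : a d :: rcons K (a e) = (a d :: k d) ++ b d :: (m ++ b e :: rcons (rev (k e)) (a e)).
    by rewrite /K rcons_cat rcons_cat /= cat_rcons.
  apply: sorted_glue; first exact: sd.
  rewrite -cat_cons; apply: sorted_glue; first exact: sm.
  have -> : b e :: rcons (rev (k e)) (a e) = rev (a e :: rcons (k e) (b e)).
    by rewrite rev_cons rev_rcons.
  by rewrite sorted_revG.
- rewrite /K cat_uniq ukd cat_uniq rev_uniq uke um andbT /=; apply/andP; split.
    rewrite -[_ || _]/(has (mem (k d)) ((b d :: rcons m (b e)) ++ rev (k e))).
    apply/hasPn => x; rewrite mem_cat mem_rev => /orP[/subm xZ|xke]; apply/negP => xkd.
      by have [_] := dkd x xkd; rewrite xZ.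
    by apply: (disj x); [apply: kd'|apply: ke'].
  apply/hasPn => x; rewrite mem_rev => xke; apply/negP => /subm xZ.
  by have [_] := dke x xke; rewrite xZ.
- move=> x; rewrite /K !mem_cat mem_rev => /or3P[/dkd[] //|/subm xZ'|/dke[] //].
  by apply/negP => /dZ; rewrite xZ'.
exists kk, A1, B1, ka; split => //.
- have lt1 := index_gap_lt adZ aeZ; have lt2 := index_gap_lt bdZ beZ.
  rewrite size_cat (perm_size P1) /K !size_cat [size (_ :: _)]/= size_rcons.
  exact: merge_arith szm S1 bnd.
- split; first by move: S1; clear; lia.
  move=> x; rewrite (perm_mem P1) /K !mem_cat mem_rev => /or3P[xk|/subm xZ'|xk].
  + by right; exists d => //; apply: subd; apply: kd'.
  + by left.
  + by right; exists e => //; apply: sube; apply: ke'.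
Qed.

End Merge.

(** * Cycles whose vertex set is not joined *)

Section Restrict.
Variables (V : finType) (G : rel V).

Definition indep (A : {set V}) := forall x y, x \in A -> y \in A -> ~~ G x y.

Definition ext (A Y : {set V}) : {set V} := (nb G A :&: Y) :\: A.

Definition Gr (K : {set V}) : rel V := [rel x y | [&& G x y, x \in K & y \in K]].

Implicit Types K : {set V}.

Lemma GrE K x y : Gr K x y = [&& G x y, x \in K & y \in K].
Proof. by []. Qed.

Lemma Gr_sub K : subrel (Gr K) G.
Proof. by move=> x y /and3P[]. Qed.

Lemma Gr_path K x p : x \in K -> path (Gr K) x p -> {subset x :: p <= K}.
Proof.
elim: p x => [|y p IH] x xK /=; first by move=> _ z; rewrite inE => /eqP->.
move=> /andP[/and3P[_ _ yK] /(IH _ yK) s] z; rewrite inE => /orP[/eqP-> //|]; exact: s.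
Qed.

Lemma ex_maxcard (P : {set V} -> Prop) : (exists A, P A) ->
  exists2 A, P A & forall B, P B -> #|B| <= #|A|.
Proof.
move=> [A0 PA0].
have [c [A PA <-] mx] : exists2 c, (exists2 A, P A & #|A| = c) & forall j, (exists2 A, P A & #|A| = j) -> j <= c.
  apply: (@ex_max_nat _ #|V|); first by exists #|A0|, A0.
  by move=> i [A _ <-]; apply: max_card.
by exists A => // B PB; apply: mx; exists B.
Qed.

(* Removing a largest set that expands badly leaves a set in which everything small expands. *)
Lemma clean_set (c M : nat) (Y : {set V}) :
  (forall B : {set V}, B \subset Y -> M <= #|B| <= 2 * M -> c * #|B| < #|ext B Y|) ->
  exists Y3 : {set V}, [/\ Y3 \subset Y, #|Y :\: Y3| < M.+1 &
    forall A : {set V}, A \subset Y3 -> A != set0 -> #|A| <= M -> c * #|A| < #|ext A Y3|].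
Proof.
move=> big.
have [|B0 [B0Y B0M B0c] mx] := @ex_maxcard (fun B => [/\ B \subset Y, #|B| <= 2 * M & #|ext B Y| <= c * #|B|]).
  exists set0; rewrite sub0set cards0; split => //.
  by rewrite /ext nb0 set0I set0D cards0.
have B0lt : #|B0| <= M.
  rewrite leqNgt; apply/negP => lt; have := big _ B0Y; rewrite B0M ltnW //= => /(_ isT).
  by rewrite ltnNge B0c.
exists (Y :\: B0); split; first exact: subsetDl.
  by rewrite setDDr setDv set0U (setIidPr B0Y).
move=> A AY A0 AM; rewrite ltnNge; apply/negP => le.
have AY' : A \subset Y by apply: subset_trans AY (subsetDl _ _).
have dAB : [disjoint A & B0].
  by rewrite disjoint_subset; apply/subsetP => x /(subsetP AY); rewrite !inE => /andP[].
have cU : #|B0 :|: A| = #|B0| + #|A|.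
  by rewrite cardsU; have := dAB; rewrite disjoint_sym -setI_eq0 => /eqP->; rewrite cards0 subn0.
have /mx : [/\ B0 :|: A \subset Y, #|B0 :|: A| <= 2 * M & #|ext (B0 :|: A) Y| <= c * #|B0 :|: A|].
  split; [by rewrite subUset B0Y|by rewrite cU; lia|].
  rewrite cU mulnDr; apply: leq_trans (leq_add B0c le).
  apply: leq_trans (cardUle _ _); apply: subset_leq_card.
  apply/subsetP => x; rewrite /ext nbU !inE negb_or => /andP[/andP[xB xA] /andP[h ->]].
  by rewrite xB xA !andbT /=.
by rewrite cU; move: A0; rewrite -card_gt0; lia.
Qed.

End Restrict.

Section NonJoined.
Variables (V : finType) (G : rel V).
Hypothesis Gs : symmetric G.
Hypothesis Gi : irreflexive G.
Variables (n M g : nat) (V1 : {set V}).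
Hypothesis M0 : 0 < M.
Hypothesis Mg : 4 * M <= g.
Hypothesis gn : 200 * g <= n.
Hypothesis alpha : forall A : {set V}, indep G A -> #|A| < M.
Hypothesis P2 : forall A : {set V}, A \subset V1 -> M <= #|A| -> n <= #|cn G A :&: V1| + g.
Hypothesis P22 : forall A B : {set V}, A \subset V1 -> B \subset V1 -> nadj G A B ->
  M <= #|A| -> M <= #|B| -> 2 * n <= #|cn G (A :|: B) :&: V1| + 2 * g.
Variable Z : seq V.
Hypothesis cZ : cycle G Z.
Hypothesis uZ : uniq Z.
Hypothesis ZV : {subset Z <= V1}.
Hypothesis Zn : n <= size Z + g.
Hypothesis Zlt : size Z < n.

(** The arc [a] of [Z] survives contiguously, so the items on it can still be switched to correct
    the length. *)
Definition long_detour := exists k a b c, [/\ rot k Z = a ++ b, cycle G (a ++ c), uniq (a ++ c),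
  {subset a ++ c <= V1} & n <= size (a ++ c) /\ size Z <= 2 * size a].

Definition reach (F : {set V}) : {set V} :=
  [set y | [exists z, [&& z \in Z, z \notin F & connect (Gr G (V1 :\: F)) z y]]].

Implicit Types F I : {set V}.

Lemma reachP F y : reflect (exists z, [/\ z \in Z, z \notin F & connect (Gr G (V1 :\: F)) z y]) (y \in reach F).
Proof.
rewrite inE; apply: (iffP existsP) => -[z]; first by case/and3P; exists z.
by case=> zZ zF c; exists z; rewrite zZ zF.
Qed.

Lemma reach_sub F : reach F \subset V1 :\: F.
Proof.
apply/subsetP => y /reachP[z [zZ zF /connectP[p pp ->]]].
have zK : z \in V1 :\: F by rewrite inE zF ZV.
by apply: (Gr_path zK pp); apply: mem_last.
Qed.

Lemma reach_Z F z : z \in Z -> z \notin F -> z \in reach F.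
Proof. by move=> zZ zF; apply/reachP; exists z. Qed.

Lemma reach_step F x y : x \in reach F -> G x y -> y \in V1 -> y \notin F -> y \in reach F.
Proof.
move=> xR gxy yV yF; have xK := subsetP (reach_sub F) _ xR.
case/reachP: xR => z [zZ zF c]; apply/reachP; exists z; split => //.
by apply: connect_trans c (connect1 _); rewrite GrE gxy xK inE yF yV.
Qed.

Lemma reach_mono F F' : F \subset F' -> reach F' \subset reach F.
Proof.
move=> sF; apply/subsetP => y /reachP[z [zZ zF c]]; apply/reachP; exists z; split => //.
  by apply: contra zF; apply: (subsetP sF).
apply: connect_sub c => a b /and3P[gab aK bK]; apply: connect1; rewrite GrE gab.
by rewrite !(subsetP (setDS V1 sF)).
Qed.

Lemma cn_reach F (A : {set V}) : A \subset reach F -> cn G A :&: V1 \subset reach F :|: F.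
Proof.
move=> AR; apply/subsetP => y; rewrite !in_setI !in_setU => /andP[/orP[/(subsetP AR) -> //|/nbP[x xA gxy]] yV].
have [yF|yF] := boolP (y \in F); first by rewrite orbT.
by rewrite orbF; apply: reach_step gxy yV yF; apply: (subsetP AR).
Qed.

(* Three disjoint paths between [Z] and [c] would merge them into a long detour, so by Menger's
   theorem two vertices separate them. *)
Definition isolating (F I : {set V}) :=
  [/\ F \subset V1, #|F| <= 2 * #|I|, indep G I, I \subset V1 :\: F & [disjoint I & reach F]].

Lemma cut_cycle F I c : ~ long_detour -> isolating F I -> cycle G c -> uniq c ->
  {subset c <= reach F :\: [set x in Z]} -> n <= size c + 20 * g ->
  exists F' I', isolating F' I' /\ #|I| < #|I'|.
Proof.
move=> nld [FV cF iI IV dI] cc uc csub cn'.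
have cR x : x \in c -> x \in reach F by move/csub; rewrite in_setD => /andP[].
have cZ' x : x \in c -> x \notin Z by move/csub; rewrite in_setD !inE => /andP[].
set E := Gr G (V1 :\: F).
have EG : subrel E G by apply: Gr_sub.
have [sep|/asboolPn] := pselect (forall S : {set V}, separates E [set x in Z | x \notin F] [set x in c] S -> 3 <= #|S|).
  case: nld; have [D [P lk]] := menger sep.
  have [DA cD hP dis] := lk.
  have lk' : linked E [set x in Z] [set x in c] 3 D P.
    by split => //; apply: subset_trans DA _; apply/subsetP => x; rewrite !inE => /andP[].
  have [|k [a [b [d [E1 C1 U1 S1 [S2 hd]]]]]] := merge_cycles Gs EG cZ uZ cc uc _ lk'.
    by move=> x xZ; apply/negP => /cZ'; rewrite xZ.
  exists k, a, b, d; split => //; last by split => //; move: S1 cn' Zn gn; clear; lia.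
  move=> x; rewrite mem_cat => /orP[xa|/hd[/cR xR|[e eD xe]]].
  - by apply: ZV; rewrite -(mem_rot k) E1 mem_cat xa.
  - by move/(subsetP (reach_sub F)): xR; rewrite inE => /andP[].
  - have [pe _ _] := hP e eD; have eK : e \in V1 :\: F.
      by move/(subsetP DA): eD; rewrite !inE => /andP[/ZV-> ->].
    by have := Gr_path eK pe xe; rewrite inE => /andP[].
move=> /asboolPn/existsNP[S /not_implyP[sS /negP]]; rewrite -ltnNge ltnS => cS.
set S' := S :&: reach F.
have cS' : #|S'| <= 2 by apply: leq_trans cS; apply: subset_leq_card; apply: subsetIl.
(* The separator has at most two vertices and misses some [w] of [c]; [w] joins [I] when [S'] joins
   [F]. *)
have [w wc wS] : exists2 w, w \in c & w \notin S'.
  apply: contrapT => /forall2NP h.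
  have : size c <= #|S'|.
    rewrite -(card_uniqP uc); apply: subset_leq_card; apply/subsetP => x xc.
    by case: (h x) => // /negP; rewrite negbK.
  by move: cn' gn cS' M0 Mg; clear; lia.
have wF : w \notin F by move/cR/(subsetP (reach_sub F)): wc; rewrite inE => /andP[].
exists (F :|: S'), (w |: I); split; last first.
  rewrite cardsU1; have -> : w \notin I; last by [].
  by apply/negP => wI; move/disjointFr: dI => /(_ _ wI); rewrite cR.
(* While [w] is still reachable, so would be any neighbour of it in [I]. *)
have wI x : x \in I -> ~~ G w x.
  move=> xI; apply/negP => gwx; have xK := subsetP IV _ xI.
  have : x \in reach F by move: xK; rewrite inE => /andP[xF xV]; apply: (reach_step (cR w wc) gwx).
  by move/disjointFr: dI => /(_ _ xI) ->.
have nwR : w \notin reach (F :|: S').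
  apply/negP => /reachP[z [zZ zF /connectP[p pp wp]]].
  have zK : z \in V1 :\: (F :|: S') by rewrite inE zF ZV.
  have sub : V1 :\: (F :|: S') \subset V1 :\: F by apply: setDS; apply: subsetUl.
  have pE : path E z p.
    apply: sub_path pp => a b /and3P[gab aK bK].
    by rewrite /E GrE gab (subsetP sub _ aK) (subsetP sub _ bK).
  have zF' : z \notin F by apply: contra zF; rewrite inE => ->.
  have := sS z p; rewrite !inE zZ zF' -wp wc => /(_ isT pE isT) /hasP[s sp sS1].
  have sR : s \in reach F.
    apply/reachP; exists z; split => //; case/splitPl: sp pE => p1 p2 <-.
    by rewrite cat_path => /andP[p1E _]; apply/connectP; exists p1.
  have := Gr_path zK pp sp; rewrite in_setD in_setU in_setI sR andbT.
  by rewrite [s \in S]sS1 orbT.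
split.
- rewrite subUset FV /=; apply/subsetP => x; rewrite inE => /andP[_ /(subsetP (reach_sub F))].
  by rewrite inE => /andP[].
- rewrite cardsU1; have -> : w \notin I.
    by apply/negP => xI; move/disjointFr: dI => /(_ _ xI); rewrite cR.
  by apply: leq_trans (cardUle _ _) _; move: cF cS'; clear; lia.
- move=> x y; rewrite !in_setU1 => /orP[/eqP->|xI] /orP[/eqP->|yI].
  + by rewrite Gi.
  + exact: wI.
  + by rewrite Gs; apply: wI.
  + exact: iI.
- apply/subsetP => x; rewrite in_setU1 => /orP[/eqP->|xI].
    rewrite in_setD in_setU negb_or wF wS /=.
    by move/cR/(subsetP (reach_sub F)): wc; rewrite inE => /andP[].
  have := subsetP IV _ xI; rewrite !in_setD in_setU negb_or => /andP[-> ->]; rewrite !andbT /=.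
  by rewrite in_setI; move/disjointFr: dI => /(_ _ xI) ->; rewrite andbF.
- rewrite disjoint_subset; apply/subsetP => x; rewrite in_setU1 inE => /orP[/eqP-> //|xI].
  apply/negP => /(subsetP (reach_mono (subsetUl F S'))).
  by move/disjointFr: dI => /(_ _ xI) ->.
Qed.

(** Each use of [cut_cycle] enlarges the independent set [I], which has fewer than [M] vertices; so
    the process stops while [F] has fewer than [2 * M]. *)
Lemma isolating_max : ~ long_detour -> exists F I, isolating F I /\
  forall c, cycle G c -> uniq c -> {subset c <= reach F :\: [set x in Z]} -> size c + 20 * g < n.
Proof.
move=> nld.
have [||m [F [I [iFI <-]]] mx] := @ex_max_nat (fun m => exists F I, isolating F I /\ #|I| = m) M.
- exists 0, set0, set0; rewrite cards0; split => //; split.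
  + exact: sub0set.
  + by rewrite cards0.
  + by move=> x y; rewrite inE.
  + exact: sub0set.
  + by rewrite disjoint_subset; apply/subsetP => x; rewrite inE.
- by move=> i [F [I [[_ _ iI _ _] <-]]]; apply: ltnW; apply: alpha.
exists F, I; split => // c cc uc cs; rewrite ltnNge; apply/negP => le.
have [F' [I' [iso lt]]] := cut_cycle nld iFI cc uc cs le.
have : #|I'| <= #|I| by apply: mx; exists F', I'.
by rewrite leqNgt lt.
Qed.

(** The margin [5] pays for the losses of [g] in [z], [2 * g] in [b], and [M] in each of [b] and
    [q]. *)
Lemma detour_arith z b q t l kap : n <= z + g -> z < n ->
  n <= t + M + l * g + b + 2 * g -> t <= q -> kap * g < q + M -> l + 5 <= kap -> 
  2 * n <= z + b + 2 * q.
Proof.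
move=> h1 h2 h3 h4 h5 h6.
have [e E] : exists e, kap = l + 5 + e by exists (kap - (l + 5)); lia.
by move: h1 h2 h3 h4 h5 Mg; rewrite E !mulnDl; clear; lia.
Qed.

(** Two large nonadjacent sets in [Z] minus [F] would force almost [n] reachable vertices off [Z]. A
    longest path among these, hung on [Z] at [a], has many possible heads. If the heads see two
    vertices of [Z], the path is an ear replacing a short arc; otherwise it closes to a cycle of
    almost [n] vertices, which the choice of [F] excludes. *)
Lemma joined_or_detour : ~ long_detour ->
  exists X : {set V}, [/\ {subset X <= Z}, n <= #|X| + 2 * g &
    forall A B : {set V}, A \subset X -> B \subset X -> nadj G A B -> M <= #|A| -> M <= #|B| -> False].
Proof.
move=> nld; have [F [I [[FV cF iI IV dI] nocyc]]] := isolating_max nld.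
have Fg : #|F| <= g by have := alpha iI; move: cF Mg; clear; lia.
pose ZF := [set x in Z] :\: F.
have cZs : #|[set x in Z]| = size Z by rewrite cardsE; apply/card_uniqP.
exists ZF; split.
- by move=> x; rewrite !inE => /andP[].
- have := cardsID F [set x in Z]; rewrite cZs -/ZF.
  have : #|[set x in Z] :&: F| <= #|F| by apply: subset_leq_card; apply: subsetIr.
  by move: Zn Fg; clear; lia.
move=> A1 A2 A1X A2X nA M1 M2.
set R := reach F; pose Y := R :\: [set x in Z].
have ZFR : ZF \subset R.
  by apply/subsetP => x; rewrite inE => /andP[xF]; rewrite inE => xZ; apply: reach_Z.
have RV : R \subset V1 by apply: subset_trans (reach_sub F) (subsetDl _ _).
have YR : Y \subset R by apply: subsetDl.
have cRF : #|R :|: F| <= #|Y| + size Z + #|F|.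
  apply: leq_trans (cardUle _ _) _; rewrite leq_add2r -cZs.
  apply: leq_trans (cardUle _ _); apply: subset_leq_card.
  by apply/subsetP => x xR; rewrite in_setU in_setD xR andbT orNb.
have Ybig : n <= #|Y| + 4 * g.
  have A1R := subset_trans A1X ZFR; have A2R := subset_trans A2X ZFR.
  have := P22 (subset_trans A1R RV) (subset_trans A2R RV) nA M1 M2.
  have : A1 :|: A2 \subset R by rewrite subUset A1R.
  by move/cn_reach/subset_leq_card; rewrite -/R; move: cRF Zlt Fg; clear; lia.
(* Either every set of [M] to [2 * M] vertices gains more than [10 * g] in [Y], or the closed
   neighbourhood of an exception [B1] is deleted at the cost of [11 * g]. In the second case every
   remaining set is nonadjacent to [B1], so [P22] gives it almost [n] new vertices, far more than
   [40 * g]. *)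
have [Y2 [l [kap [Y2Y cY2 lk exp2]]]] : exists (Y2 : {set V}) l kap, [/\ Y2 \subset Y,
    #|Y :\: Y2| <= l * g, l + 5 <= kap <= 40 /\ l <= 11 & forall B : {set V}, B \subset Y2 -> M <= #|B| <= 2 * M ->
      kap * g < #|ext G B Y2|].
  have [[B1 [B1Y B1M B1x]]|noB] := pselect (exists B1 : {set V}, [/\ B1 \subset Y, M <= #|B1| <= 2 * M & #|ext G B1 Y| <= 10 * g]); last first.
    exists Y, 0, 10; split => //; first by rewrite setDv cards0.
    by move=> B BY BM; rewrite ltnNge; apply/negP => le; apply: noB; exists B.
  have cB1 : #|Y :&: cn G B1| <= 11 * g.
    have : Y :&: cn G B1 \subset B1 :|: ext G B1 Y.
      apply/subsetP => x; rewrite /cn /ext in_setI !in_setU in_setD in_setI => /andP[-> /orP[->//|->]].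
      by rewrite !andbT orbN.
    move/subset_leq_card/leq_trans => /(_ _ (cardUle _ _)); move: B1M B1x Mg; clear; lia.
  exists (Y :\: cn G B1), 11, 40; split => //; first exact: subsetDl.
    by rewrite setDDr setDv set0U.
  move=> B BY BM; rewrite ltnNge; apply/negP => le.
  have BY' : B \subset Y by apply: subset_trans BY (subsetDl _ _).
  have nBB : nadj G B1 B.
    rewrite nadj_cn disjoint_subset; apply/subsetP => x /(subsetP BY).
    by rewrite in_setD => /andP[].
  have BR := subset_trans BY' YR; have B1R := subset_trans B1Y YR.
  have /andP[MB1 _] := B1M; have /andP[MB _] := BM.
  have := P22 (subset_trans B1R RV) (subset_trans BR RV) nBB MB1 MB.
  have sub : cn G (B1 :|: B) :&: V1 \subset
      ([set x in Z] :|: F) :|: ((Y :&: cn G B1) :|: (B :|: ext G B (Y :\: cn G B1))).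
    apply/subsetP => x xc; have : x \in R :|: F.
      by apply: (subsetP (cn_reach _)) xc; rewrite subUset B1R.
    move: xc; rewrite /cn nbU /ext /Y !(in_setU, in_setI, in_setD).
    have [xF|xF] := boolP (x \in F); first by rewrite !orbT.
    have [xZ|xZ] := boolP (x \in [set x in Z]); first by [].
    rewrite !orbF => /andP[xc _] ->; move: xc; case: (x \in B1) => //=.
    by case: (x \in nb G B1); rewrite ?orbT //=; case: (x \in B) => //= ->.
  move/subset_leq_card: sub; have := cardUle ([set x in Z] :|: F) ((Y :&: cn G B1) :|: (B :|: ext G B (Y :\: cn G B1))).
  have := cardUle [set x in Z] F.
  have := cardUle (Y :&: cn G B1) (B :|: ext G B (Y :\: cn G B1)).
  have := cardUle B (ext G B (Y :\: cn G B1)).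
  rewrite cZs; move: cB1 le BM Zlt Fg Mg gn; clear.
  move: #|_ :|: (_ :|: _)| #|_ :|: (_ :|: _)| #|[set x in Z] :|: F| #|B :|: _| => a b c d.
  by lia.
case: lk => lk l11.
have [|Y3 [Y3Y2 cY3 exp3]] := @clean_set _ G 2 M Y2.
  by move=> B BY BM; apply: leq_ltn_trans (exp2 _ BY BM); move: BM lk Mg; clear; nia.
have Y3Y := subset_trans Y3Y2 Y2Y; have Y3R := subset_trans Y3Y YR.
have cYY3 : #|Y| <= #|Y3| + M + l * g.
  have : Y \subset Y3 :|: ((Y2 :\: Y3) :|: (Y :\: Y2)).
    by apply/subsetP => x xY; rewrite 2!in_setU [x \in Y2 :\: _]in_setD [x \in Y :\: _]in_setD xY; case: (x \in Y3) => //=; case: (x \in Y2).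
  move/subset_leq_card/leq_trans => /(_ _ (cardUle _ _)).
  by have := cardUle (Y2 :\: Y3) (Y :\: Y2); move: cY3 cY2; clear; lia.
have [y0 y0Y3] : exists y, y \in Y3.
  by apply/set0Pn; rewrite -card_gt0; move: cYY3 Ybig l11 gn Mg M0; clear; nia.
have [z [zZ zF /connectP[p0 pp0 y0p0]]] := reachP _ _ (subsetP Y3R _ y0Y3).
have [p [pp up y0p]] : exists p, [/\ path (Gr G (V1 :\: F)) z p, uniq (z :: p) & y0 = last z p].
  by move: y0p0; case/shortenP: pp0 => p pp up _ y0p; exists p.
have zK : z \in V1 :\: F by rewrite inE zF ZV.
have [|||u [a [ka [x0 [w [Es aZ x0Y3 nka]]]]]] := @trim_path _ (mem Z) (mem Y3) (z :: p).
- by rewrite /= take0 orbF.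
- by apply/hasP; exists y0 => //; rewrite y0p; apply: mem_last.
- move=> x xZ; apply/negP => /(subsetP Y3Y); rewrite in_setD inE => /andP[].
  by rewrite [x \in Z]xZ.
have kaK : {subset a :: rcons ka x0 <= V1}.
  move=> x xk; have : x \in z :: p.
    by rewrite Es mem_cat -cat_rcons -cat_cons mem_cat xk orbT.
  by move/(Gr_path zK pp); rewrite inE => /andP[].
have ska : sorted G (a :: rcons ka x0).
  have sp : sorted G (z :: p) by apply: (sub_path (@Gr_sub _ G _)) pp.
  have Es' : z :: p = u ++ (a :: rcons ka x0) ++ w by rewrite Es /= cat_rcons.
  by move: sp; rewrite Es' => /sorted_cat_r; apply: sorted_cat_l.
have uka : uniq ka.
  by move: up; rewrite Es cat_uniq => /and3P[_ _]; rewrite cons_uniq cat_uniq => /andP[_ /and3P[]].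
have kaN x : x \in ka -> (x \notin Z) && (x \notin Y3).
  by move/(hasPn nka) => /=; rewrite negb_or.
have [||m [q [sq uq qs qY ql]] mx] := @ex_max_nat (fun m => exists q, [/\ size q = m, uniq q, sorted G q, {subset q <= Y3} & last x0 q = x0]) #|V|.
- exists 1, [:: x0]; split => // x; by rewrite inE => /eqP->.
- by move=> i [q [<- uq _ _ _]]; rewrite -(card_uniqP uq); apply: max_card.
have q0 : q <> [::].
  move=> q0; have : 1 <= m; last by rewrite -sq q0.
  by apply: mx; exists [:: x0]; split => // x; rewrite inE => /eqP->.
have [|S [S0 Sq nbSq cS [Spath Scyc]]] := posa_main Gs Gi uq qs qY q0 ql.
  by move=> q' uq' sq' q'Y q'l; rewrite sq; apply: mx; exists q'.
have SY3 : S \subset Y3 by apply/subsetP => x /Sq/qY.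
(* Posa's bound contradicts [exp3] for sizes up to [M] and [exp2] for sizes up to [2 * M]. *)
have SM : 2 * M < #|S|.
  rewrite ltnNge; apply/negP => S2.
  have [SM|SM] := leqP #|S| M.
    by have := exp3 _ SY3 S0 SM; rewrite /ext ltnNge cS.
  have SY2 := subset_trans SY3 Y3Y2.
  have := exp2 _ SY2; rewrite S2 ltnW // => /(_ isT).
  have : ext G S Y2 \subset ((nb G S :&: Y3) :\: S) :|: (Y2 :\: Y3).
    apply/subsetP => x; rewrite /ext !in_setU !in_setD !in_setI => /andP[-> /andP[-> ->]].
    by rewrite !andbT orbN.
  move/subset_leq_card/leq_trans => /(_ _ (cardUle _ _)).
  by move: cS cY3 S2 lk Mg; clear; nia.
have qbig : kap * g < size q + M.
  have [A AS cA] := subset_card_eq (leq_trans (leq_pmull M (isT : 0 < 2)) (ltnW SM)).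
  have AY2 : A \subset Y2 by apply: subset_trans AS (subset_trans SY3 Y3Y2).
  have := exp2 _ AY2; rewrite cA leqnn leq_pmull // => /(_ isT).
  have : ext G A Y2 \subset (nb G S :&: Y3) :|: (Y2 :\: Y3).
    apply/subsetP => x; rewrite /ext !in_setU !in_setD !in_setI => /andP[_ /andP[/(subsetP (nbS G AS)) -> ->]].
    by rewrite !andbT orbN.
  move/subset_leq_card/leq_trans => /(_ _ (cardUle _ _)).
  have : #|nb G S :&: Y3| <= size q by rewrite -(card_uniqP uq); apply: subset_leq_card.
  by move: cY3; clear; lia.
set T := S :|: (nb G S :&: Y3).
set b := nb G S :&: [set x in Z].
have Tq : #|T| <= size q.
  rewrite -(card_uniqP uq); apply: subset_leq_card.
  by apply/subsetP => x; rewrite in_setU => /orP[/Sq|/(subsetP nbSq)].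
(* By [P2] the closed neighbourhood of [S] has almost [n] vertices; each is in [T], on [Z], in [F],
   or was deleted between [Y] and [Y3]. *)
have nT : n <= #|T| + M + l * g + #|b| + 2 * g.
  have SV : S \subset V1 by apply: subset_trans SY3 (subset_trans Y3R RV).
  have := P2 SV; rewrite (leq_trans (leq_pmull M (isT : 0 < 2)) (ltnW SM)) => /(_ isT).
  have : cn G S :&: V1 \subset T :|: ((Y2 :\: Y3) :|: ((Y :\: Y2) :|: (b :|: F))).
    apply/subsetP => x xc; have : x \in R :|: F.
      by apply: (subsetP (cn_reach _)) xc; apply: subset_trans SY3 Y3R.
    move: xc; rewrite /cn /T /b !(in_setU, in_setI, in_setD).
    have [xF|xF] := boolP (x \in F); first by rewrite !orbT.
    rewrite !orbF => /andP[/orP[->//|xn] _] xR; rewrite xn xR !andbT /= andbC.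
    by case: (x \in [set x in Z]); case: (x \in Y3); case: (x \in Y2); rewrite /= ?orbT.
  move/subset_leq_card.
  have := cardUle T ((Y2 :\: Y3) :|: ((Y :\: Y2) :|: (b :|: F))).
  have := cardUle (Y2 :\: Y3) ((Y :\: Y2) :|: (b :|: F)).
  have := cardUle (Y :\: Y2) (b :|: F).
  have := cardUle b F.
  by move: cY2 cY3 Fg; clear; lia.
have nbY : nb G S :&: Y3 != set0.
  have [A AS cA] := subset_card_eq (leq_trans (leq_pmull M (isT : 0 < 2)) (ltnW SM)).
  have := exp3 A (subset_trans AS SY3); rewrite -card_gt0 cA => /(_ M0 (leqnn _)) lt.
  rewrite -card_gt0; apply: leq_ltn_trans (leq0n _) (leq_trans lt _).
  apply: subset_leq_card; apply/subsetP => x; rewrite /ext !in_setD !in_setI => /andP[_ /andP[xn ->]].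
  by rewrite (subsetP (nbS G AS)).
have qR x : x \in q -> x \in R by move/qY/(subsetP Y3R).
have qZ x : x \in q -> x \notin Z by move/qY/(subsetP Y3Y); rewrite in_setD inE => /andP[].
(* With at most one neighbour on [Z], the cycle of [posa_main] avoids [Z] and is too long for
   [nocyc]. *)
have [b2|b1] := leqP 2 #|b|; last first.
  have [c [cc uc csub cT]] := Scyc nbY.
  have : size c + 20 * g < n.
    apply: nocyc => // x /csub xq; rewrite in_setD inE qZ //=; exact: qR.
  have : #|T| <= size c.
    by rewrite -(card_uniqP uc); apply: subset_leq_card; apply/subsetP => x; apply: cT.
  have lg : l * g <= 11 * g by rewrite leq_mul2r l11 orbT.
  by move: nT lg b1 Mg gn M0; clear; lia.
have [v [vb va vsz]] : exists v, [/\ v \in b, v != a & size Z + #|b| <= 2 * (maxn (index_gap Z a v) (size Z - index_gap Z a v)).+1].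
  apply: arc_choice => // x; rewrite in_setI inE => /andP[] //.
move: vb; rewrite in_setI inE => /andP[/nbP[s sS gsv] vZ].
have [qq [pq sqq lqq]] := Spath s sS.
have [qr Eqr Lqr] := rev_headE s qq.
rewrite lqq in Eqr Lqr.
have memr x : x \in rev (s :: qq) -> x \in q by rewrite mem_rev (perm_mem pq).
have [||||| k [a' [b' [kk [E1 S1 C1 U1 P1]]]]] := @ear_spec2 _ G Gs Z a v (ka ++ rev (s :: qq)) cZ uZ aZ vZ.
- by rewrite eq_sym.
- by rewrite Eqr; case: (ka).
- have -> : a :: rcons (ka ++ rev (s :: qq)) v = (a :: ka) ++ x0 :: rcons qr v.
    by rewrite Eqr rcons_cat.
  apply: sorted_glue; first exact: ska.
  have -> : x0 :: rcons qr v = rcons (rev (s :: qq)) v by rewrite Eqr.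
  rewrite rev_cons -cats1 cat_rcons; apply: sorted_glue => /=; last by rewrite gsv.
  by rewrite -rev_cons sorted_revG.
- rewrite cat_uniq uka rev_uniq -(perm_uniq pq) uq andbT /=.
  apply/hasPn => x /memr xq; apply/negP => /kaN/andP[_].
  by rewrite qY.
- move=> x; rewrite mem_cat => /orP[/kaN/andP[] //|/memr]; exact: qZ.
apply: nld; exists k, a', b', kk; split => //.
- move=> x; rewrite mem_cat => /orP[xa|].
    by apply: ZV; rewrite -(mem_rot k) E1 mem_cat xa.
  rewrite (perm_mem P1) mem_cat => /orP[xk|/memr/qR/(subsetP RV) //].
  by apply: kaK; rewrite inE mem_rcons inE xk !orbT.
- rewrite size_cat (perm_size P1) size_cat size_rev -(perm_size pq) S1; split.
    have [/andP[lk5 _] _] := (lk, l11).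
    have := detour_arith Zn Zlt nT Tq qbig lk5; move: vsz; clear; lia.
  by clear; lia.
Qed.

End NonJoined.

(** * Embedding paths of items *)

Section FriedmanPippenger.
Variables (V : finType) (G : rel V).
Hypothesis Gs : symmetric G.
Variable M : nat.
Hypothesis M0 : 0 < M.
Implicit Types (A B C R T : {set V}).

Definition children T (par : V -> V) A : {set V} := [set x in T | par x \in A].

(** Every vertex is entitled to two children: placed children and free neighbours together must
    allow this for all small sets. [e |: T] is the embedded tree and [R] the set of free
    vertices. *)
Definition Inv R T par e := forall A, A \subset R :|: (e |: T) -> #|A| <= 2 * M ->
  2 * #|A| <= #|nb G A :&: R| + #|children T par A|.

Definition setpar (par : V -> V) x v := fun y => if y == x then v else par y.

(** The set at which an embedding gets stuck is kept in the component of the current vertex, so that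
    a path through free vertices can reach it and close a cycle. *)
Definition component U v : {set V} := [set y | connect (Gr G U) v y].

Lemma childrenU T par A B : children T par (A :|: B) = children T par A :|: children T par B.
Proof. by apply/setP => x; rewrite !inE -andb_orr. Qed.

(** Submodularity: as long as [Inv] covers union and intersection, the union of two sets attaining
    equality in it, the tight sets, is tight again. *)
Lemma mu_submod R T par A B :
  #|nb G (A :|: B) :&: R| + #|children T par (A :|: B)| + (#|nb G (A :&: B) :&: R| + #|children T par (A :&: B)|)
  <= #|nb G A :&: R| + #|children T par A| + (#|nb G B :&: R| + #|children T par B|).
Proof.
have h1 := cardsUI (nb G A :&: R) (nb G B :&: R).
have h2 := cardsUI (children T par A) (children T par B).
have e1 : nb G (A :|: B) :&: R = (nb G A :&: R) :|: (nb G B :&: R) by rewrite nbU setIUl.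
have e2 : #|nb G (A :&: B) :&: R| <= #|(nb G A :&: R) :&: (nb G B :&: R)|.
  apply: subset_leq_card; apply/subsetP => x; rewrite !in_setI => /andP[xn ->].
  by rewrite (subsetP (nbS G (subsetIl A B))) ?(subsetP (nbS G (subsetIr A B))).
have e3 : children T par (A :&: B) = children T par A :&: children T par B.
  by apply/setP => x; rewrite !inE; case: (x \in T).
by rewrite e1 e3 childrenU; move: h1 h2 e2; lia.
Qed.

(* Either the tree can be extended at [v] keeping all demands satisfiable, or the union of
   the tight sets has become large. *)
Lemma fp_step R T par e v : [disjoint R & e |: T] -> v \in e |: T ->
  #|children T par [set v]| <= 1 -> Inv R T par e ->
  (exists x, [/\ G v x, x \in R & Inv (R :\ x) (x |: T) (setpar par x v) e]) \/
  (exists C, [/\ C \subset component (R :|: (e |: T)) v, M < #|C| <= 2 * M & #|nb G C :&: R| <= 2 * #|C|]).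
Proof.
move=> dRT vT ch1 inv; apply: contrapT => /not_orP[noext nostuck].
set U := R :|: (e |: T) in inv noext nostuck *.
have vU : v \in U by rewrite in_setU vT orbT.
pose mu A := #|nb G A :&: R| + #|children T par A|.
have sub A B : mu (A :|: B) + mu (A :&: B) <= mu A + mu B by apply: mu_submod.
(* Tight sets avoiding [v]. By [tightU] below, one of size at most [2 * M] has size at most [M],
   since otherwise it would be the large set of the second alternative. *)
pose Pt A := [/\ A \subset U, A \subset component U v, v \notin A, #|A| <= M & mu A = 2 * #|A|].
have [|T0 [T0U T0C vT0 T0M T0t] mx] := @ex_maxcard _ Pt.
  exists set0; split; rewrite ?sub0set ?inE ?cards0 //.
  rewrite /mu nb0 set0I cards0 /=; apply/eqP; rewrite cards_eq0; apply/eqP/setP => x.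
  by rewrite !inE andbF.
have tightU A : A \subset U -> A \subset component U v -> v \notin A -> #|A| <= 2 * M -> mu A = 2 * #|A| -> #|A| <= M.
  move=> AU AC vA A2 At; rewrite leqNgt; apply/negP => lt; apply: nostuck; exists A; split => //.
    by rewrite lt.
  by rewrite -At leq_addr.
have reachR a b : a \in component U v -> b \in U -> G a b -> b \in component U v.
  move=> aC bU gab; rewrite inE; rewrite inE in aC.
  apply: (connect_trans aC); apply: connect1.
  rewrite GrE gab bU andbT /=; case/connectP: aC => p pp ->.
  by apply: (Gr_path vU pp); apply: mem_last.
have vC : v \in component U v by rewrite inE.
(* If making [x] a child of [v] violates the invariant at [A], then [A] is tight, avoids [v] and has
   [x] as a neighbour. Its part in the component of [v] enlarges [T0]. *)
have cov x : G v x -> x \in R -> x \in nb G T0.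
  move=> gvx xR; apply/negPn/negP => xT0; apply: noext; exists x; split => //.
  have xT : x \notin e |: T by have := disjointFr dRT xR => ->.
  have UE : R :\ x :|: (e |: (x |: T)) = U.
    apply/setP => y; rewrite !inE; case: (eqVneq y x) => [->|_] //=.
    by rewrite xR orbT.
  move=> A; rewrite UE => AU A2; rewrite leqNgt; apply/negP => lt.
  have invA := inv A AU A2.
  have cE : #|children T par A| + (v \in A) <= #|children (x |: T) (setpar par x v) A|.
    have s1 : children T par A \subset children (x |: T) (setpar par x v) A :\ x.
      apply/subsetP => y; rewrite !inE /setpar => /andP[yT yA]; case: (eqVneq y x) => [yx|_] //=.
        by move: xT; rewrite !inE -yx yT orbT.
      by rewrite yT.
    rewrite (cardsD1 x (children (x |: T) _ A)) addnC.
    have -> : (x \in children (x |: T) (setpar par x v) A) = (v \in A).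
      by rewrite !inE eqxx /setpar eqxx.
    by rewrite leq_add2l subset_leq_card.
  have nE : #|nb G A :&: R| <= #|nb G A :&: (R :\ x)| + (x \in nb G A).
    rewrite (cardsD1 x (nb G A :&: R)) in_setI xR andbT addnC leq_add2r.
    by apply: subset_leq_card; apply/subsetP => y; rewrite !inE => /and3P[-> -> ->].
  have [vA|vA] := boolP (v \in A).
    by move: lt invA cE nE; rewrite vA; clear; case: (x \in nb G A); lia.
  have xA : x \in nb G A by apply: contraLR lt => xA; move: invA cE nE; rewrite (negbTE vA) (negbTE xA); clear; lia.
  have tA : mu A = 2 * #|A| by move: lt invA cE nE; rewrite /mu (negbTE vA) xA; clear; lia.
  (* Neither neighbours nor children are shared between [A'] and [A''], so tightness passes to
     [A']. *)
  pose A' := A :&: component U v; pose A'' := A :\: component U v.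
  have cA : #|A'| + #|A''| = #|A| by apply: cardsID.
  have A'U : A' \subset U by apply: subset_trans (subsetIl _ _) AU.
  have A''U : A'' \subset U by apply: subset_trans (subsetDl _ _) AU.
  have i1 := inv A' A'U; have i2 := inv A'' A''U.
  have muA : mu A' + mu A'' <= mu A.
    have AE : A = A' :|: A'' by rewrite setID.
    have d1 : (nb G A' :&: R) :&: (nb G A'' :&: R) = set0.
      apply/setP => y; rewrite !in_setI in_set0; apply/negP => /andP[/andP[/nbP[a aA' ga] yR] /andP[/nbP[b bA'' gb] _]].
      have yU : y \in U by rewrite in_setU yR.
      have yC : y \in component U v by apply: reachR ga => //; move: aA'; rewrite in_setI => /andP[].
      move: bA''; rewrite in_setD => /andP[/negP nbC bA]; apply: nbC.
      by apply: (reachR y) => //; [apply: (subsetP AU)|rewrite Gs].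
    have d2 : children T par A' :&: children T par A'' = set0.
      apply/setP => y; rewrite [in RHS]inE; apply/negP; rewrite in_setI !inE => /andP[/andP[_ /andP[_ a]] /andP[_ /andP[b _]]].
      by rewrite a in b.
    have := cardsUI (nb G A' :&: R) (nb G A'' :&: R); rewrite d1 cards0 -setIUl -nbU.
    have := cardsUI (children T par A') (children T par A''); rewrite d2 cards0 -childrenU.
    by rewrite /mu -AE; clear; lia.
  have tA' : mu A' = 2 * #|A'|.
    by move: muA tA i1 i2 cA A2; rewrite /mu; clear; lia.
  have A'M : #|A'| <= M.
    apply: tightU => //; [exact: subsetIr| |by move: cA A2; clear; lia].
    by apply: contra vA; rewrite in_setI => /andP[].
  have xA' : x \in nb G A'.
    case/nbP: xA => a aA gax; apply/nbP; exists a => //; rewrite in_setI aA /=.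
    apply: (reachR x); [|exact: (subsetP AU)|by rewrite Gs].
    by apply: (reachR v) => //; rewrite in_setU xR.
  have UU : T0 :|: A' \subset U by rewrite subUset T0U.
  have UC : T0 :|: A' \subset component U v by rewrite subUset T0C subsetIr.
  have vUU : v \notin T0 :|: A'.
    by rewrite in_setU negb_or vT0 /=; apply: contra vA; rewrite in_setI => /andP[].
  have U2 : #|T0 :|: A'| <= 2 * M by apply: leq_trans (cardUle _ _) _; move: T0M A'M; clear; lia.
  have Ut : mu (T0 :|: A') = 2 * #|T0 :|: A'|.
    have iU := inv _ UU U2.
    have iI : 2 * #|T0 :&: A'| <= mu (T0 :&: A').
      apply: inv; first by apply: subset_trans (subsetIl _ _) T0U.
      by apply: leq_trans (subset_leq_card (subsetIl _ _)) _; move: T0M; clear; lia.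
    have := sub T0 A'; have := cardsUI T0 A'; move: iU iI T0t tA'; rewrite -/(mu (T0 :|: A')); clear; lia.
  have UM : #|T0 :|: A'| <= M by apply: tightU.
  have /mx : Pt (T0 :|: A') by split.
  rewrite leqNgt => /negP[]; apply: proper_card; apply/properP; split; first exact: subsetUl.
  case/nbP: xA' => a aA' gax; exists a; first by rewrite in_setU aA' orbT.
  by apply: contra xT0 => aT0; apply/nbP; exists a.
(* By [cov], adding [v] to [T0] brings no new free neighbour and at most one child, but raises the
   demand by two. *)
have vT0U : v |: T0 \subset U by rewrite subUset sub1set vU.
have c1 : #|v |: T0| = #|T0|.+1 by rewrite cardsU1 vT0.
have := inv _ vT0U; rewrite c1 => H.
have {H} : 2 * #|T0|.+1 <= #|nb G (v |: T0) :&: R| + #|children T par (v |: T0)|.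
  by apply: H; move: T0M M0; clear; lia.
have nE : nb G (v |: T0) :&: R = nb G T0 :&: R.
  apply/setP => x; rewrite !in_setI nbU in_setU.
  have [xR|] := boolP (x \in R); last by rewrite !andbF.
  rewrite !andbT; apply/orP/idP => [[/nbP[a]|//]|]; last by right.
  by rewrite inE => /eqP-> gvx; apply: cov.
have := cardUle (children T par [set v]) (children T par T0).
by rewrite nE childrenU; move: T0t ch1; rewrite /mu; clear; lia.
Qed.

End FriedmanPippenger.

(** * Binary trees with adjacent leaves *)

Section BinaryTree.
Variables (V : finType) (G : rel V).
Hypothesis Gs : symmetric G.
Hypothesis Gi : irreflexive G.
Variables (M h : nat).
Hypothesis M0 : 0 < M.
Hypothesis h0 : 0 < h.
Hypothesis hM : M <= 2 ^ h.
Hypothesis h2M : 2 ^ h <= 2 * M.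
Hypothesis alpha : forall A : {set V}, indep G A -> #|A| < M.
Implicit Types (A B C R T : {set V}) (par : V -> V) (dp : V -> nat).

Definition Inv0 R e := forall A, A \subset e |: R -> #|A| <= 2 * M -> 2 * #|A| <= #|nb G A :&: R|.

Definition stuck e R c := exists C,
  [/\ C \subset component G (e |: R) e, M < #|C| <= 2 * M & #|nb G C :&: R| <= c].

Lemma Inv0E R par e : Inv0 R e <-> Inv G M R set0 par e.
Proof.
have c0 A : children set0 par A = set0 by apply/setP => x; rewrite !inE.
split=> H A AU A2; have := H A; rewrite ?c0 ?cards0 ?addn0; apply=> //.
  by apply: subset_trans AU _; rewrite setU0 setUC.
by rewrite setU0 setUC.
Qed.

Lemma children_card T par A : #|children T par A| = \sum_(v in A) #|children T par [set v]|.
Proof.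
rewrite -sum1_card (partition_big par (mem A)) => [|x]; last by rewrite inE => /andP[].
apply: eq_bigr => v vA; rewrite -sum1_card; apply: eq_bigl => x.
by rewrite !inE; case: eqP => [->|_]; rewrite ?andbT ?andbF //= [v \in A]vA andbT.
Qed.

Definition binary_tree e R0 T par dp := [/\ T \subset R0,
  (forall x, x \in T -> [/\ par x \in e |: T, G (par x) x, dp x = (dp (par x)).+1 & dp x <= h]),
  (forall v, #|children T par [set v]| <= 2), dp e = 0 & Inv G M (R0 :\: T) T par e].

Section Tree.
Variables (e : V) (R0 T : {set V}) (par : V -> V) (dp : V -> nat).
Hypothesis eR : e \notin R0.
Hypothesis bt : binary_tree e R0 T par dp.

Lemma bt_parP x : x \in T -> [/\ par x \in e |: T, G (par x) x, dp x = (dp (par x)).+1 & dp x <= h].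
Proof. by case: bt => _ H _ _ _; apply: H. Qed.

Lemma bt_root x : x \in e |: T -> dp x = 0 -> x = e.
Proof. by rewrite !inE => /orP[/eqP//|/bt_parP[_ _ -> _]]. Qed.

Lemma bt_conn x : x \in e |: T -> connect (Gr G (e |: R0)) e x.
Proof.
have TR : T \subset R0 by case: bt.
have sub : e |: T \subset e |: R0 by apply: setUS.
move: {2}(dp x) (leqnn (dp x)) => i; elim: i x => [|i IH] x.
  by rewrite leqn0 => /eqP d0 xT; rewrite (bt_root xT d0).
move=> dx xT; have [/eqP->|xe] := boolP (x == e); first exact: connect0.
have xT' : x \in T by move: xT; rewrite in_setU1 (negbTE xe).
have [pT g d _] := bt_parP xT'.
apply: (connect_trans (IH _ _ pT)); first by move: dx; rewrite d.
by apply: connect1; rewrite GrE g !(subsetP sub).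
Qed.

Definition level i : {set V} := [set x in e |: T | dp x == i].

Lemma children2 A : #|children T par A| <= 2 * #|A|.
Proof.
rewrite children_card; apply: (@leq_trans (\sum_(v in A) 2)).
  by apply: leq_sum => v _; case: bt => _ _ H _ _; apply: H.
by rewrite sum_nat_const mulnC.
Qed.

Lemma levelS i : level i.+1 = children T par (level i).
Proof.
have de : dp e = 0 by case: bt.
apply/setP => x; rewrite !in_set; have [xT|xT] := boolP (x \in T); last first.
  by rewrite orbF inE; case: eqP => // ->; rewrite de.
by have [pT _ -> _] := bt_parP xT; rewrite orbT /= eqSS; move: pT; rewrite in_setU => ->.
Qed.

Lemma level0 : level 0 = [set e].
Proof.
have de : dp e = 0 by case: bt.
apply/setP => x; rewrite !inE; case: (eqVneq x e) => [->|xe] /=; first by rewrite de.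
by apply/negP => /andP[xT]; have [_ _ -> _] := bt_parP xT.
Qed.

Lemma level_card i : #|level i| <= 2 ^ i.
Proof.
elim: i => [|i IH]; first by rewrite level0 cards1.
by rewrite levelS expnS; apply: leq_trans (children2 _) _; rewrite leq_mul2l IH orbT.
Qed.

Lemma bt_size : #|T| <= 4 * M.
Proof.
have H i : #|[set x in e |: T | dp x <= i]| < 2 ^ i.+1.
  elim: i => [|i IH].
    suff -> : [set x in e |: T | dp x <= 0] = level 0 by rewrite level0 cards1.
    by apply/setP => x; rewrite !inE leqn0.
  have sub : [set x in e |: T | dp x <= i.+1] \subset [set x in e |: T | dp x <= i] :|: level i.+1.
    by apply/subsetP => x; rewrite !inE => /andP[-> dx] /=; move: dx; rewrite leq_eqVlt ltnS orbC.
  move/subset_leq_card/leq_trans: sub => /(_ _ (cardUle _ _)).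
  by have := level_card i.+1; rewrite [2 ^ i.+2]expnS; move: IH; clear; lia.
have sub : T \subset [set x in e |: T | dp x <= h].
  by apply/subsetP => x xT; rewrite !inE xT orbT; have [] := bt_parP xT.
by move/subset_leq_card: sub; have := H h; rewrite expnS; move: h2M; clear; lia.
Qed.

(** The path from the root to [x] without the root, as [path] expects; [i] is the depth of [x]. *)
Fixpoint anc i x : seq V := if i is j.+1 then rcons (anc j (par x)) x else [::].

Lemma ancP i x : x \in e |: T -> dp x = i ->
  [/\ path G e (anc i x), last e (anc i x) = x, size (anc i x) = i, {subset anc i x <= T} &
   uniq (anc i x) /\ (forall y, y \in anc i x -> (y = x \/ dp y < i) /\ (par y \in e :: anc i x))].
Proof.
elim: i x => [|i IH] x xT dx.
  by rewrite /=; split => //; rewrite (bt_root xT dx).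
have xT' : x \in T.
  move: xT; rewrite in_setU1 => /orP[/eqP xe|//].
  by move: dx; rewrite xe; case: bt => _ _ _ -> _.
have [pT g d _] := bt_parP xT'.
have dpx : dp (par x) = i by move: d; rewrite dx => -[].
have [p1 l1 s1 t1 [u1 m1]] := IH _ pT dpx.
have xn : x \notin anc i (par x).
  apply/negP => /m1[[xp|lt] _]; last by move: lt; rewrite dx; clear; lia.
  by move: d; rewrite -xp; clear; lia.
split => /=.
- by rewrite rcons_path p1 l1 g.
- by rewrite last_rcons.
- by rewrite size_rcons s1.
- by move=> y; rewrite mem_rcons inE => /orP[/eqP-> //|/t1].
- split; first by rewrite rcons_uniq xn.
  move=> y; rewrite mem_rcons inE => /orP[/eqP->|ym]; split.
  + by left.
  + by rewrite inE mem_rcons inE; have := mem_last e (anc i (par x)); rewrite l1 inE => /orP[->|->]; rewrite ?orbT.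
  + by right; case: (m1 y ym) => -[->|lt] _; rewrite ?dpx // ltnW.
  + have [_] := m1 y ym; rewrite !inE mem_rcons inE => /orP[->|->]; by rewrite ?orbT.
Qed.

Lemma bt_full : (forall v, v \in e |: T -> dp v < h -> #|children T par [set v]| = 2) ->
  2 ^ h <= #|level h|.
Proof.
move=> full; have H i : i <= h -> 2 ^ i <= #|level i|.
  elim: i => [|i IH] ih; first by rewrite level0 cards1.
  rewrite levelS children_card expnS mulnC; apply: (@leq_trans (\sum_(v in level i) 2)).
    by rewrite sum_nat_const leq_mul2r IH ?orbT // ltnW.
  by apply: leq_sum => v; rewrite inE => /andP[vT /eqP dv]; rewrite full // dv.
exact: H.
Qed.

End Tree.

Lemma bt_grow e R0 T par dp : e \notin R0 -> binary_tree e R0 T par dp ->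
  (exists T' par' dp', binary_tree e R0 T' par' dp' /\
     forall v, v \in e |: T' -> dp' v < h -> #|children T' par' [set v]| = 2) \/ stuck e R0 (8 * M).
Proof.
move=> eR; have [N] := ubnP #|R0 :\: T|; elim: N T par dp => // N IH T par dp ltN bt.
have [full|/existsNP[v /not_implyP[vT /not_implyP[dv /eqP c2]]]] := 
  pselect (forall v, v \in e |: T -> dp v < h -> #|children T par [set v]| = 2).
  by left; exists T, par, dp.
have [TR hT ch2 de inv] := bt.
have UE : (R0 :\: T) :|: (e |: T) = e |: R0.
  apply/setP => x; rewrite !inE; case: (boolP (x \in T)) => xT /=; last by rewrite orbF orbC.
  by rewrite (subsetP TR) // !orbT.
have dis : [disjoint R0 :\: T & e |: T].
  rewrite disjoint_subset; apply/subsetP => x; rewrite !inE => /andP[xT xR].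
  by rewrite negb_or xT andbT; apply: contraNneq eR => <-.
have c1 : #|children T par [set v]| <= 1 by have := ch2 v; move: c2; clear; lia.
case: (fp_step Gs M0 dis vT c1 inv) => [[x [gvx xR inv']]|[C [CU CM nC]]].
  move: (xR); rewrite in_setD => /andP[xT xR0].
  pose dp' y := if y == x then (dp v).+1 else dp y.
  have xe : x != e by apply: contraNneq eR => <-.
  have vx : v != x.
    by apply: contraTneq vT => ->; rewrite in_setU1 negb_or xe xT.
  have DE : R0 :\: (x |: T) = (R0 :\: T) :\ x by rewrite setUC setDDl.
  apply: (IH (x |: T) (setpar par x v) dp').
    by rewrite DE -ltnS; apply: leq_trans ltN; rewrite ltnS; apply: proper_card; apply: properD1.
  split.
  - by rewrite subUset sub1set xR0.
  - move=> y; rewrite in_setU1 /setpar /dp'; case: (eqVneq y x) => [->|yx] /=.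
      by rewrite (negbTE vx) => _; split => //; move: vT; rewrite !inE => /orP[->|->]; rewrite ?orbT.
    move=> yT; have [pT g d dh] := hT y yT.
    have -> : (par y == x) = false.
      by apply/negP => /eqP pE; move: pT; rewrite pE in_setU1 (negbTE xe) (negbTE xT).
    by split => //; move: pT; rewrite !inE => /orP[->|->]; rewrite ?orbT.
  - move=> w; have sub : children (x |: T) (setpar par x v) [set w] \subset
        children T par [set w] :|: (if w == v then [set x] else set0).
      apply/subsetP => y; rewrite !inE /setpar; case: (eqVneq y x) => [->|yx] /=.
        by rewrite eq_sym => ->; rewrite inE eqxx orbT.
      by move=> ->.
    move/subset_leq_card/leq_trans: sub => /(_ _ (cardUle _ _)).
    case: (eqVneq w v) => [->|_]; rewrite ?cards1 ?cards0; first by move: c1; clear; lia.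
    by have := ch2 w; clear; lia.
  - by rewrite /dp' eq_sym (negbTE xe).
  - by rewrite DE.
right; exists C; split => //.
  apply: subset_trans CU _; rewrite UE; apply/subsetP => y; rewrite !inE => c.
  exact: connect_trans (bt_conn bt vT) c.
(* Counting neighbours in the whole pool adds at most the tree: [2 * #|C| <= 4 * M] and [bt_size]
   give [8 * M]. *)
have sub : nb G C :&: R0 \subset (nb G C :&: (R0 :\: T)) :|: T.
  by apply/subsetP => y; rewrite !in_setU !in_setI in_setD => /andP[-> ->]; rewrite andbT orNb.
move/subset_leq_card/leq_trans: sub => /(_ _ (cardUle _ _)).
by have := bt_size bt; move: nC CM; clear; lia.
Qed.

Definition unit_spec e R (r al : seq V) := [/\ path G e r, path G e al, last e r = last e al,
  uniq r /\ uniq al & {subset r ++ al <= R}].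

(** A full tree has at least [2 ^ h >= M] leaves at depth [h], so two of them, [u] and [u'], are
    adjacent: [u] is reached directly in [h] steps and through [u'] in [h.+1]. The other tree
    vertices return to the pool. *)
Lemma find_unit e R0 : e \notin R0 -> Inv0 R0 e ->
  (exists r al, [/\ unit_spec e R0 r al, size r = h.+1, size al = h &
     Inv0 (R0 :\: [set x in r ++ al]) (last e r)]) \/ stuck e R0 (8 * M).
Proof.
move=> eR inv0; pose par0 := id : V -> V.
have bt0 : binary_tree e R0 set0 par0 (fun _ => 0).
  split => //.
  - exact: sub0set.
  - by move=> x; rewrite inE.
  - move=> v; rewrite (_ : children _ _ _ = set0) ?cards0 //; by apply/setP => x; rewrite !inE.
  - by rewrite setD0; apply/Inv0E.
case: (bt_grow eR bt0) => [[T [par [dp [bt full]]]]|st]; last by right.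
left; have := bt_full bt full; have [TR hT ch2 de inv] := bt.
move=> big; have [u [u' [uL uL' g]]] : exists u u', [/\ u \in level e T dp h, u' \in level e T dp h & G u u'].
  apply: contrapT => no; have : indep G (level e T dp h).
    by move=> x y xL yL; apply/negP => g; apply: no; exists x, y.
  by move/alpha; move: big hM; clear; lia.
move: uL uL'; rewrite !inE => /andP[uT /eqP du] /andP[uT' /eqP du'].
have uT1 : u \in e |: T by rewrite in_setU1.
have uT1' : u' \in e |: T by rewrite in_setU1.
have [p1 l1 s1 t1 [u1 m1]] := ancP bt uT1 du.
have [p2 l2 s2 t2 [u2 m2]] := ancP bt uT1' du'.
have uu : u != u' by apply: contraTneq g => ->; rewrite Gi.
have uan : u \in anc par h u by have := mem_last e (anc par h u); rewrite l1 inE => /orP[/eqP ue|//];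
  move: du h0; rewrite ue de => <-.
have uTT := t1 u uan; have uR := subsetP TR _ uTT.
have keepT x : x \in rcons (anc par h u') u ++ anc par h u -> x \in T.
  by rewrite mem_cat mem_rcons inE => /orP[/orP[/eqP->//|/t2//]|/t1].
have keepE x : x \in T -> x \in rcons (anc par h u') u ++ anc par h u ->
    par x \in e :: rcons (anc par h u') u ++ anc par h u.
  move=> xT; rewrite mem_cat mem_rcons inE => /orP[/orP[/eqP->|xa]|xa].
  - by have [_] := m1 u uan; rewrite !inE mem_cat mem_rcons inE => /orP[->|->]; rewrite ?orbT.
  - by have [_] := m2 x xa; rewrite !inE mem_cat mem_rcons inE => /orP[->|->]; rewrite ?orbT.
  - by have [_] := m1 x xa; rewrite !inE mem_cat mem_rcons inE => /orP[->|->]; rewrite ?orbT.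
exists (rcons (anc par h u') u), (anc par h u); split => //.
- split => //.
  + by rewrite rcons_path p2 l2 Gs g.
  + by rewrite last_rcons l1.
  + split => //; rewrite rcons_uniq u2 andbT; apply/negP => /m2[[/eqP|]]; first by rewrite (negbTE uu).
    by rewrite du ltnn.
  + by move=> x /keepT/(subsetP TR).
- by rewrite size_rcons s2.
(* Children of vertices of [A] become free neighbours again. None of them is kept: a kept vertex has
   a kept parent or the root as parent, so its parent in [A] would be [u], which is at full depth
   and has no child. *)
rewrite last_rcons; set keep := [set x in _ ++ _] => A AU A2.
have keepR : keep \subset T by apply/subsetP => x; rewrite inE; apply: keepT.
have AR x : x \in A -> x \in R0 /\ (x \in keep -> x = u).
  move/(subsetP AU); rewrite in_setU1 in_setD => /orP[/eqP->//|/andP[/negP nk ->]].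
  by split => // /nk.
have := inv A; have -> : A \subset R0 :\: T :|: (e |: T).
  apply/subsetP => x /AR[xR _]; rewrite !inE xR andbT.
  by case: (x \in T); rewrite ?orbT.
move=> /(_ isT A2) le; apply: (leq_trans le).
have dj : [disjoint nb G A :&: (R0 :\: T) & children T par A].
  by rewrite disjoint_subset; apply/subsetP => x; rewrite !inE => /andP[_ /andP[/negbTE-> _]].
have E : #|nb G A :&: (R0 :\: T)| + #|children T par A| = #|(nb G A :&: (R0 :\: T)) :|: children T par A|.
  by have := cardsUI (nb G A :&: (R0 :\: T)) (children T par A); move: dj; rewrite -setI_eq0 => /eqP ->; rewrite cards0 addn0.
rewrite E.
apply: subset_leq_card; apply/subsetP => x; rewrite in_setU => /orP[].
  rewrite !in_setI !in_setD => /andP[-> /andP[xT ->]]; rewrite andbT /=.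
  by apply: contra xT; apply: (subsetP keepR).
rewrite inE => /andP[xT pA]; have [pT gp dx dh] := hT x xT.
rewrite in_setI in_setD (subsetP TR _ xT) andbT; apply/andP; split.
  by apply/nbP; exists (par x).
apply/negP; rewrite inE => /(keepE x xT); rewrite inE => /orP[/eqP pe|pk].
  by have [] := AR _ pA; rewrite pe (negbTE eR).
have [_ /(_ _)] := AR _ pA; rewrite inE => /(_ pk) pu.
by move: dx dh; rewrite pu du => ->; rewrite ltnn.
Qed.

End BinaryTree.

Lemma last_in (T : eqType) (e : T) (s : seq T) : 0 < size s -> last e s \in s.
Proof. by case: s => //= y s _; apply: mem_last. Qed.

Lemma cardU_le (T : finType) (A B : {set T}) a b : #|A| <= a -> #|B| <= b -> #|A :|: B| <= a + b.
Proof. by move=> Aa Bb; apply: leq_trans (cardUle _ _) (leq_add Aa Bb). Qed.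

(** * Chains of items and the cycle closing them *)

Section Items.
Variables (V : finType) (G : rel V).
Hypothesis Gs : symmetric G.
Hypothesis Gi : irreflexive G.
Variables (M h L : nat).
Hypothesis M0 : 0 < M.
Hypothesis h0 : 0 < h.
Hypothesis hM : M <= 2 ^ h.
Hypothesis h2M : 2 ^ h <= 2 * M.
Hypothesis hL : h < L.
Hypothesis alpha : forall A : {set V}, indep G A -> #|A| < M.
Implicit Types (A B C D R T : {set V}) (its : seq (seq V * seq V)) (it : seq V * seq V).

(** One child suffices here: once the path moves to [x], the vertex [e] leaves the range of [Inv0]
    and its demand lapses. *)
Lemma extend_vertex e R : e \notin R -> Inv0 G M R e ->
  (exists x, [/\ G e x, x \in R & Inv0 G M (R :\ x) x]) \/ stuck G M e R (8 * M).
Proof.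
move=> eR /(@Inv0E _ G M R id) inv.
have c0 : children (set0 : {set V}) id [set e] = set0 by apply/setP => x; rewrite !inE.
have d : [disjoint R & e |: set0].
  by rewrite setU0 disjoint_sym disjoints1.
have ee : e \in e |: set0 by rewrite setU11.
have c1 : #|children (set0 : {set V}) id [set e]| <= 1 by rewrite c0 cards0.
case: (fp_step Gs M0 d ee c1 inv) => [[x [g xR inv']]|[C [CU CM nC]]]; [left|right].
  exists x; split => // A AU A2; have := inv' A; rewrite setU0.
  have AR : A \subset R.
    by apply: subset_trans AU _; rewrite subUset sub1set xR subD1set.
  have -> : children [set x] (setpar id x e) A = set0.
    apply/setP => y; rewrite !inE /setpar; case: eqP => //= _.
    by apply: contraNF eR; apply: (subsetP AR).
  rewrite cards0 addn0; apply => //.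
  by apply: subset_trans AU _; rewrite setUC setUS // subsetUr.
exists C; split => //; first by move: CU; rewrite setU0 setUC.
by move: CM nC; clear; lia.
Qed.

Lemma extend_path m e R : e \notin R -> Inv0 G M R e ->
  exists p : seq V, [/\ path G e p, uniq p, {subset p <= R}, size p <= m &
   (size p = m /\ Inv0 G M (R :\: [set x in p]) (last e p)) \/ stuck G M (last e p) (R :\: [set x in p]) (8 * M)].
Proof.
elim: m e R => [|m IH] e R eR inv.
  exists [::]; split => //=; left; split => //.
  by rewrite (_ : R :\: _ = R) //; apply/setP => x; rewrite !inE.
case: (extend_vertex eR inv) => [[x [g xR inv']]|st]; last first.
  exists [::]; split => //=; right.
  by rewrite (_ : R :\: _ = R) //; apply/setP => x; rewrite !inE.
have xn : x \notin R :\ x by rewrite !inE eqxx.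
have [p [pp up pR sp H]] := IH x (R :\ x) xn inv'.
have E : R :\: [set y in x :: p] = (R :\ x) :\: [set y in p].
  by apply/setP => y; rewrite !inE negb_or; case: (y == x); rewrite ?andbT ?andbF.
exists (x :: p); split => /=.
- by rewrite g.
- by rewrite up andbT; apply: contra xn => /pR.
- by move=> y; rewrite inE => /orP[/eqP->//|/pR]; rewrite !inE => /andP[].
- by [].
rewrite E; case: H => [[s i]|]; [by left; split; [rewrite s|]|by right].
Qed.

Definition item_set it : {set V} := [set x in it.1 ++ it.2].

(* The two components are routes with the same ends; choosing the second one shortens a
   path through the item by one vertex. *)
Definition is_item e R it := [/\ path G e it.1 /\ path G e it.2, last e it.1 = last e it.2,
  uniq it.1 /\ uniq it.2, size it.1 = L /\ (size it.2).+1 = L & 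
  #|[set x in it.2] :\: [set x in it.1]| <= h /\ item_set it \subset R].

Fixpoint chain e R its : Prop := if its is it :: its' then
  is_item e R it /\ chain (last e it.1) (R :\: item_set it) its' else True.

Definition route its : seq V := flatten [seq it.1 | it <- its].
Definition verts its : {set V} := [set x | has (fun it => x \in item_set it) its].

(** An unfinished item at which the construction got stuck; [D] may also contain vertices of its
    second route. *)
Definition partial e R r D c := [/\ path G e r /\ uniq r, {subset r <= D}, D \subset R,
  #|D| <= size r + h /\ size r <= L & stuck G M (last e r) (R :\: D) c].

Lemma next_item e R : e \notin R -> Inv0 G M R e ->
  (exists it, is_item e R it /\ Inv0 G M (R :\: item_set it) (last e it.1)) \/
  exists r D, partial e R r D (8 * M).
Proof.
move=> eR inv; case: (find_unit Gs Gi M0 h0 hM h2M alpha eR inv); last first.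
  move=> st; right; exists [::], set0; split => //=; rewrite ?cards0 ?setD0 ?sub0set //.
move=> [r [al [[pr pa la [ur ua] ss] sr sa inv1]]].
set R1 := R :\: _ in inv1.
have lr : last e r \in r by apply: last_in; rewrite sr.
have eR1 : last e r \notin R1 by rewrite in_setD negb_and negbK inE mem_cat lr.
(* A tail common to both routes brings the item to the uniform length [L]. *)
have [p [pp up pR sp H]] := extend_path (L - h.+1) eR1 inv1.
have pd x : x \in p -> [/\ x \in R, x \notin r & x \notin al].
  by move/pR; rewrite in_setD inE mem_cat negb_or => /andP[/andP[-> ->] ->].
have uc s : uniq s -> {subset s <= r ++ al} -> uniq (s ++ p).
  move=> us sub; rewrite cat_uniq us up andbT; apply/hasPn => x /pd[_ xr xa].
  by apply/negP => /sub; rewrite mem_cat (negbTE xr) (negbTE xa).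
have s1 : {subset r <= r ++ al} by move=> x xr; rewrite mem_cat xr.
have s2 : {subset al <= r ++ al} by move=> x xr; rewrite mem_cat xr orbT.
have c1 : #|[set x in al ++ p] :\: [set x in r ++ p]| <= h.
  rewrite -sa -(card_uniqP ua) -[#|al|]cardsE; apply: subset_leq_card; apply/subsetP => x.
  by rewrite !inE !mem_cat negb_or => /andP[/andP[_ /negbTE->]]; rewrite orbF.
have vR : [set x in (r ++ p) ++ al ++ p] \subset R.
  apply/subsetP => x; rewrite inE !mem_cat => xx; have [xp|xp] := boolP (x \in p).
    by case: (pd x xp).
  by apply: ss; rewrite mem_cat; move: xx; rewrite (negbTE xp) !orbF.
have DE : R1 :\: [set x in p] = R :\: [set x in (r ++ p) ++ al ++ p].
  by apply/setP => x; rewrite !inE !mem_cat; case: (x \in r); case: (x \in p); case: (x \in al).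
case: H => [[sp' inv2]|st]; [left|right].
  exists (r ++ p, al ++ p); rewrite /is_item /item_set /= -DE last_cat; split => //; split => //.
  - by rewrite !cat_path pr pa -la pp.
  - by rewrite last_cat -la.
  - by split; apply: uc.
  - by rewrite !size_cat sr sa sp'; move: hL; clear; lia.
exists (r ++ p), [set x in (r ++ p) ++ al ++ p]; split => //.
- by rewrite cat_path pr pp; split => //; apply: uc.
- by move=> x xx; rewrite inE mem_cat xx.
- split; last by rewrite size_cat sr; move: sp hL; clear; lia.
  have sub : [set x in (r ++ p) ++ al ++ p] \subset [set x in r ++ p] :|: ([set x in al ++ p] :\: [set x in r ++ p]).
    by apply/subsetP => x; rewrite !inE mem_cat orbC; case: (x \in r ++ p); rewrite ?orbT ?orbF.
  apply: (leq_trans (subset_leq_card sub)); apply: (leq_trans (cardUle _ _)).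
  by rewrite leq_add // cardsE card_size.
by rewrite last_cat -DE.
Qed.

Lemma item_chain e R : e \notin R -> Inv0 G M R e ->
  exists its r D, chain e R its /\ partial (last e (route its)) (R :\: verts its) r D (8 * M).
Proof.
have [N] := ubnP #|R|; elim: N e R => // N IH e R ltN eR inv.
case: (next_item eR inv) => [[it [ok inv']]|[r [D st]]]; last first.
  exists [::], r, D; split => //=; rewrite (_ : R :\: verts [::] = R) //.
  by apply/setP => x; rewrite !inE.
have [_ _ _ [s1 _] [_ vR]] := ok.
have l1 : last e it.1 \in it.1 by apply: last_in; rewrite s1; apply: leq_trans hL.
have lv : last e it.1 \in item_set it by rewrite inE mem_cat l1.
have ln : last e it.1 \notin R :\: item_set it by rewrite in_setD lv.
have [|its [r [D [ch pa]]]] := IH _ _ _ ln inv'.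
  rewrite -ltnS; apply: leq_trans ltN; rewrite ltnS; apply: proper_card; apply/properP; split; first exact: subsetDl.
  by exists (last e it.1) => //; apply: (subsetP vR).
exists (it :: its), r, D; split; first by split.
rewrite /route /= last_cat; rewrite -/(route its).
rewrite (_ : R :\: verts (it :: its) = (R :\: item_set it) :\: verts its) //.
by apply/setP => x; rewrite !in_setD andbA -negb_or [in LHS]inE /= orbC [x \in verts its]inE.
Qed.

Lemma route_cat i1 i2 : route (i1 ++ i2) = route i1 ++ route i2.
Proof. by rewrite /route map_cat flatten_cat. Qed.

Lemma verts_cat i1 i2 : verts (i1 ++ i2) = verts i1 :|: verts i2.
Proof. by apply/setP => x; rewrite !inE has_cat. Qed.

Lemma verts_cons it i2 : verts (it :: i2) = item_set it :|: verts i2.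
Proof. by apply/setP => x; rewrite in_setU [in LHS]inE /= [x \in verts i2]inE. Qed.

Lemma route_verts its x : x \in route its -> x \in verts its.
Proof.
move/flatten_mapP => [it iti xi]; rewrite inE; apply/hasP; exists it => //.
by rewrite inE mem_cat xi.
Qed.

Lemma chain_cat e R i1 i2 : chain e R (i1 ++ i2) <->
  chain e R i1 /\ chain (last e (route i1)) (R :\: verts i1) i2.
Proof.
elim: i1 e R => [|it i1 IH] e R /=.
  by rewrite (_ : R :\: verts [::] = R) //; [tauto|apply/setP => x; rewrite !inE].
rewrite IH (_ : route (it :: i1) = it.1 ++ route i1) // last_cat.
have -> : R :\: item_set it :\: verts i1 = R :\: verts (it :: i1).
  by apply/setP => x; rewrite verts_cons !in_setD in_setU negb_or andbA [(_ \notin item_set it) && _]andbC.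
tauto.
Qed.

Lemma chain_route e R its : chain e R its ->
  [/\ path G e (route its), uniq (route its), verts its \subset R,
      size (route its) = L * size its & #|verts its :\: [set x in route its]| <= h * size its].
Proof.
elim: its e R => [|it its IH] e R /=.
  rewrite muln0; split => //; first by apply/subsetP => x; rewrite !inE.
  rewrite muln0 leqn0 cards_eq0; apply/eqP/setP => x; by rewrite !inE.
move=> [[[p1 _] _ [u1 _] [s1 _] [cd vR]] /IH [pp up vv ss cc]].
have E : route (it :: its) = it.1 ++ route its by [].
rewrite E verts_cons; split.
- by rewrite cat_path p1.
- rewrite cat_uniq u1 up andbT; apply/hasPn => x /route_verts/(subsetP vv).
  by rewrite in_setD inE mem_cat negb_or => /andP[/andP[]].
- by rewrite subUset vR; apply: subset_trans vv (subsetDl _ _).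
- by rewrite size_cat s1 ss mulnS.
rewrite mulnS; apply: leq_trans (leq_add cd cc).
apply: leq_trans (cardUle _ _); apply: subset_leq_card; apply/subsetP => x.
rewrite !inE !mem_cat negb_or => /andP[/andP[/negbTE-> ->] /orP[/orP[//|->//]|->]].
by rewrite orbT.
Qed.

Variable n : nat.
Hypothesis nP : forall A, M <= #|A| -> n <= #|cn G A|.
Hypothesis nV : n <= #|V|.
Hypothesis nL : L + 2 * h + 20 * M < n.

(** By [nP], sets of [2 * M] to [4 * M] vertices expand, so [clean_set] applies with parameter
    [2 * M]. The strict inequality there pays for removing [e] from the pool. *)
Lemma expanding_start : exists e R, [/\ e \notin R, Inv0 G M R e & #|~: (e |: R)| <= 2 * M].
Proof.
have [|W [_ cW hW]] := @clean_set _ G 2 (2 * M) [set: V].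
  move=> B _ /andP[B1 B2]; have MB : M <= #|B| by move: B1; clear; lia.
  have := nP MB; rewrite /cn => le.
  have E : ext G B [set: V] = nb G B :\: B by rewrite /ext setIT.
  have := leq_trans le (cardUle _ _); rewrite -(cardsID B (nb G B)) -E.
  have := subset_leq_card (subsetIr (nb G B) B); move: B2 nL; clear; lia.
have [e eW] : exists e, e \in W.
  apply/set0Pn; apply: contraTneq nV => W0.
  by move: cW; rewrite W0 setD0 cardsT; move: nL; clear; lia.
exists e, (W :\ e); split; first by rewrite !inE eqxx.
  move=> A; rewrite setD1K // => AW A2.
  have [->|A0] := eqVneq A set0; first by rewrite cards0.
  have := hW A AW A0 A2; rewrite ltnNge => /negP lt; rewrite leqNgt; apply/negP => lt'; apply: lt.
  have sub : ext G A W \subset e |: (nb G A :&: (W :\ e)).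
    by apply/subsetP => x; rewrite !inE; case: (x == e) => //= /andP[_].
  apply: (leq_trans (subset_leq_card sub)); rewrite cardsU1; move: lt'; clear.
  by case: (e \notin _); lia.
by move: cW; rewrite setD1K // setTD ltnS.
Qed.

(** The path starts at the first hit on the first route, if there is one; at most [h] hits then lie
    off this route. Otherwise all hits are on the second route, which is used instead. *)
Lemma suffix_hit e R it (N : {set V}) : is_item e R it -> has (mem N) (it.1 ++ it.2) ->
  exists p w, [/\ p \in N, path G p w /\ uniq (p :: w), last p w = last e it.1,
    {subset p :: w <= item_set it} /\ size w < L & #|(N :&: item_set it) :\: [set x in p :: w]| <= h].
Proof.
move=> [[p1 p2] ll [u1 u2] [s1 s2] [cd vR]].
have gen s : path G e s -> uniq s -> last e s = last e it.1 -> {subset s <= item_set it} -> size s <= L ->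
    has (mem N) s -> #|(N :&: item_set it) :\: [set x in s]| <= h -> 
    exists p w, [/\ p \in N, path G p w /\ uniq (p :: w), last p w = last e it.1,
    {subset p :: w <= item_set it} /\ size w < L & #|(N :&: item_set it) :\: [set x in p :: w]| <= h].
  move=> ps us ls ss sz /split_first[A [p [w [E pN nA]]]] cc.
  exists p, w; move: ps us ls ss sz cc; rewrite {}E cat_path cat_uniq last_cat size_cat /=.
  move=> /and3P[_ _ pw] /and3P[_ _ upw] lw ss sz cc; split => //.
    split; last by move: sz; clear; lia.
    by move=> x xw; apply: ss; rewrite mem_cat xw orbT.
  apply: leq_trans cc; apply: subset_leq_card; apply/subsetP => x.
  rewrite !in_setD !in_setI inE => /andP[nx /andP[xN ->]]; rewrite [x \in [set _ in _]]inE mem_cat negb_or xN nx !andbT.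
  by apply: contra nA => xA; apply/hasP; exists x.
have [h1|h1] := boolP (has (mem N) it.1) => hh.
  apply: (gen it.1) => //; first by move=> x xi; rewrite inE mem_cat xi.
    by rewrite s1.
  apply: leq_trans cd; apply: subset_leq_card; apply/subsetP => x.
  by rewrite !inE mem_cat => /andP[/negbTE-> /andP[_]].
apply: (gen it.2) => //; first by move=> x xi; rewrite inE mem_cat xi orbT.
- by move: s2; clear; lia.
- by move: hh; rewrite has_cat (negbTE h1).
rewrite (_ : _ :\: _ = set0) ?cards0 //; apply/setP => x; rewrite !inE mem_cat.
case xN: (x \in N); rewrite ?andbF //=; case x1: (x \in it.1); last by case: (x \in it.2).
by case/hasP: h1; exists x.
Qed.

(** At the end of the chain, [C] has a closed neighbourhood of at least [n] vertices, few of them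
    off the chain. Entering the first item that meets it, following the chain to its end and
    returning through free vertices to [C] gives a cycle through nearly all of them. *)
Lemma item_cycle : exists (e : V) R its (s t : seq V),
  [/\ cycle G (s ++ route its ++ t), uniq (s ++ route its ++ t), chain (last e s) R its,
     (forall x, x \in verts its -> x \notin s /\ x \notin t) &
     [/\ 0 < size s, size s <= L, 
       n <= size (s ++ route its ++ t) + 14 * M + h * (size its + 2) &
       n <= 2 * L + size (route its) + 14 * M + h * (size its + 2)]].
Proof.
have [e0 [R0 [eR inv cW]]] := expanding_start.
have [its [r [D [ch [[pr ur] rD DR [cD sr] [C [CU CM nC]]]]]]] := item_chain eR inv.
set e' := last e0 _ in pr CU; set e'' := last e' r in CU; set R' := _ :\: verts _ in DR CU nC.
pose H := nb G C :&: (verts its :|: D).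
have Hn : n <= 12 * M + 1 + #|H|.
  have MC : M <= #|C| by move: CM; clear; lia.
  have sub : cn G C \subset C :|: (~: (e0 |: R0) :|: ([set e0] :|: (H :|: (nb G C :&: (R' :\: D))))).
    apply/subsetP => x; rewrite /cn /H /R' !in_setU !in_setI !in_setD !in_setU in_setC in_setU1 in_set1.
    move=> /orP[->//|->] /=; case: (x \in C) => //=; case: (x == e0); rewrite ?orbT //=.
    by case: (x \in R0) => //=; case: (x \in D); rewrite ?orbT //= orbF; case: (x \in verts its).
  have := leq_trans (nP MC) (subset_leq_card sub).
  have := cardUle C (~: (e0 |: R0) :|: ([set e0] :|: (H :|: (nb G C :&: (R' :\: D))))).
  have := cardUle (~: (e0 |: R0)) ([set e0] :|: (H :|: (nb G C :&: (R' :\: D)))).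
  have := cardUle ([set e0]) (H :|: (nb G C :&: (R' :\: D))).
  have := cardUle H (nb G C :&: (R' :\: D)).
  by rewrite cards1; move: CM nC cW; clear; lia.
have hasH : has (fun it => has (mem (nb G C)) (it.1 ++ it.2)) its.
  apply: contraT => no; have sub : H \subset D.
    apply/subsetP => x; rewrite in_setI in_setU => /andP[xN /orP[xv|//]]; case/negP: no.
    move: xv; rewrite inE => /hasP[it iti xi]; apply/hasP; exists it => //.
    by apply/hasP; exists x => //; move: xi; rewrite inE.
  by have := subset_leq_card sub; move: Hn nL cD sr M0; clear; lia.
have [i1 [it0 [i2 [E hit nohit]]]] := split_first hasH.
move: (ch); rewrite E => /chain_cat[ch1 [ok0 ch2]].
set e1 := last e0 _ in ok0 ch2; set R1 := R0 :\: _ in ok0 ch2.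
have [p [w [pN [pw uw] lw [sw zw] cw]]] := suffix_hit ok0 hit.
have [c0 c0C gp] : exists2 x, x \in C & G x p by apply/nbP.
have := subsetP CU _ c0C; rewrite inE => /connectP[q0 pq0 lq0].
have e'E : e' = last (last p w) (route i2).
  rewrite /e' E route_cat -cat1s route_cat !last_cat lw /route /= ?cats0 //.
have [q [pq uq qR lq]] : exists q, [/\ path G e'' q, uniq q, {subset q <= R' :\: D} & last e'' q = c0].
  have eU : e'' \in e'' |: (R' :\: D) by apply: setU11.
  case/shortenP: pq0 lq0 => q pq /= /andP[eq uq] _ lq.
  exists q; split => //; first by apply: sub_path pq; apply: Gr_sub.
  move=> x xq; have : x \in e'' :: q by rewrite inE xq orbT.
  move/(Gr_path eU pq).
  by rewrite in_setU1 => /orP[/eqP xe|//]; move: eq; rewrite -xe xq.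
have [pi ui vi zi ci] := chain_route ch2.
have vE : verts its = verts i1 :|: (item_set it0 :|: verts i2) by rewrite E verts_cat verts_cons.
have dv x : x \in R' -> [/\ x \notin verts i1, x \notin item_set it0 & x \notin verts i2].
  by rewrite /R' vE in_setD !in_setU !negb_or => /andP[/and3P[-> -> ->]].
have rR x : x \in r -> x \in R' by move/rD/(subsetP DR).
have qR' x : x \in q -> x \in R' /\ x \notin D by move/qR; rewrite in_setD => /andP[-> ->].
have swv x : x \in verts i2 -> x \notin p :: w.
  by move/(subsetP vi); rewrite in_setD => /andP[nv _]; apply: contra nv; apply: sw.
exists p, (R1 :\: item_set it0), i2, (p :: w), (r ++ q).
(* Up to [h] hits are missed in each later item, in the item where the cycle enters and in the
   unfinished one, whence [size i2 + 2]. *)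
have HS : #|H| <= size (p :: w) + size (route i2) + size r + h * (size i2 + 2).
  have sub : H \subset [set x in p :: w] :|: ([set x in route i2] :|: ([set x in r] :|:
     ((nb G C :&: item_set it0) :\: [set x in p :: w] :|: (verts i2 :\: [set x in route i2] :|: (D :\: [set x in r]))))).
    apply/subsetP => x; rewrite /H in_setI vE !in_setU !in_setD !in_setI.
    rewrite [x \in [set _ in p :: w]]inE [x \in [set _ in route i2]]inE [x \in [set _ in r]]inE.
    move=> /andP[xN]; rewrite xN /=; have -> : x \in verts i1 = false.
      apply: contraNF nohit; rewrite inE => /hasP[it iti xi]; apply/hasP; exists it => //.
      by apply/hasP; exists x => //; move: xi; rewrite inE.
    by case: (x \in p :: w) => //=; case: (x \in route i2); rewrite ?orbT //=; case: (x \in r);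
       rewrite ?orbT //= => /orP[/orP[->|->]|->]; rewrite ?orbT.
  have c1 : #|D :\: [set x in r]| <= h.
    rewrite cardsD (setIidPr _); last by apply/subsetP => x; rewrite inE; apply: rD.
    by rewrite [#|[set _ in r]|]cardsE (card_uniqP ur); move: cD; clear; lia.
  have cs (s : seq V) : #|[set x in s]| <= size s by rewrite cardsE card_size.
  apply: leq_trans (subset_leq_card sub) _.
  apply: leq_trans (cardU_le (cs (p :: w)) (cardU_le (cs (route i2)) (cardU_le (cs r) (cardU_le cw (cardU_le ci c1))))) _.
  by move: (size (p :: w)) (size (route i2)) (size r) (size i2); clear; nia.
split.
- rewrite cat_cons cycle_consG !cat_path !last_cat pw lw pi -lw -e'E pr pq /= -/e'' lq gp.
  by [].
- rewrite !cat_uniq uw ui ur uq /= !andbT; apply/and3P; split.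
  + rewrite has_cat negb_or; apply/andP; split.
      by apply/hasPn => x /route_verts/swv.
    apply/hasPn => x; rewrite mem_cat => xx.
    have xR : x \in R' by case/orP: xx => [/rR//|/qR'[]].
    by have [_ nv _] := dv x xR; apply: contra nv; apply: sw.
  + apply/hasPn => x; rewrite mem_cat => xx.
    have xR : x \in R' by case/orP: xx => [/rR//|/qR'[]].
    by have [_ _ nv] := dv x xR; apply: contra nv; apply: route_verts.
  + by apply/hasPn => x /qR'[_ nD]; apply: contra nD; apply: rD.
- by rewrite /= lw.
- move=> x xv; split; first exact: swv.
  rewrite mem_cat negb_or; apply/andP; split.
    by apply/negP => /rR/dv[_ _]; rewrite xv.
  by apply/negP => /qR'[/dv[_ _]]; rewrite xv.
rewrite !size_cat; move: HS Hn sr zw M0; clear; rewrite /=; split; lia.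
Qed.

End Items.

(** * Cycles of exact length *)

Lemma last_takeE (T : Type) (f : T) p a : a <= size p -> last f (take a p) = nth f (f :: p) a.
Proof.
move=> ap; rewrite (last_nth f) (_ : f :: take a p = take a.+1 (f :: p)) // size_take.
by case: ltngtP ap => // [lt _|-> _]; rewrite nth_take.
Qed.

Lemma cycle_catC (T : Type) (E : rel T) x y : cycle E (x ++ y) = cycle E (y ++ x).
Proof. by rewrite -(rot_cycle (size x)) rot_size_cat. Qed.

(** An arc may wrap around the end of the list; the longer of its two pieces is contiguous in
    [Z]. *)
Lemma rot_piece (T : Type) (Z a b : seq T) k : rot k Z = a ++ b ->
  exists x u y a1 a2, [/\ Z = x ++ u ++ y, a = a1 ++ u ++ a2 & size a <= 2 * size u].
Proof.
move=> E; have Es : a = take (size a) (rot k Z) by rewrite E take_size_cat.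
have DT : rot k Z = drop k Z ++ take k Z by [].
have [le|lt] := leqP (size a) (size (drop k Z)).
  exists (take k Z), a, (drop (size a) (drop k Z)), [::], [::]; split => //.
  - by rewrite {1}Es DT takel_cat // cat_take_drop cat_take_drop.
  - by rewrite cats0.
  - by clear; lia.
have Ea : a = drop k Z ++ take (size a - size (drop k Z)) (take k Z).
  by rewrite {1}Es DT take_cat ltnNge ltnW.
set a' := take _ (take k Z) in Ea.
have [le'|lt'] := leqP (size a') (size (drop k Z)).
  exists (take k Z), (drop k Z), [::], [::], a'; split => //.
  - by rewrite cats0 cat_take_drop.
  - by rewrite Ea size_cat; move: le'; clear; lia.
exists [::], a', (drop (size a - size (drop k Z)) (take k Z) ++ drop k Z), (drop k Z), [::]; split => //.
- by rewrite /= catA cat_take_drop cat_take_drop.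
- by rewrite cats0.
- by rewrite Ea size_cat; move: lt'; clear; lia.
Qed.

Lemma infix_mid (T : Type) (A B C x u y : seq T) : A ++ B ++ C = x ++ u ++ y ->
  size x <= size A -> size A + size B <= size x + size u ->
  exists u2, u = drop (size x) A ++ B ++ u2.
Proof.
move=> E xA le; have Ex : x = take (size x) A.
  by have := congr1 (take (size x)) E; rewrite takel_cat // take_size_cat.
have E2 : drop (size x) A ++ B ++ C = u ++ y.
  have AE : A = x ++ drop (size x) A by rewrite [X in X ++ _]Ex cat_take_drop.
  set A' := drop _ A in AE *; move: E; rewrite AE -catA => /(congr1 (drop (size x))).
  by rewrite !drop_size_cat.
exists (drop (size (drop (size x) A ++ B)) u).
have := congr1 (take (size (drop (size x) A ++ B))) E2.
rewrite catA take_size_cat // takel_cat; last by rewrite size_cat size_drop; move: le xA; clear; lia.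
by rewrite catA => {1}->; rewrite cat_take_drop.
Qed.

Section Exact.
Variables (V : finType) (G : rel V).
Hypothesis Gs : symmetric G.
Hypothesis Gi : irreflexive G.
Variables (M h L : nat).
Hypothesis M0 : 0 < M.
Hypothesis hL : h < L.
Hypothesis alpha : forall A : {set V}, indep G A -> #|A| < M.
Implicit Types (A B C D R T : {set V}) (its : seq (seq V * seq V)).

(** Two of the first [M] vertices at even positions are adjacent. Even positions make the chord skip
    at least one vertex, and it skips fewer than [2 * M]. *)
Lemma shorten_step f p : path G f p -> uniq (f :: p) -> 2 * M <= size p ->
  exists p', [/\ path G f p', uniq (f :: p'), {subset p' <= p}, last f p' = last f p &
    size p' < size p /\ size p < size p' + 2 * M].
Proof.
move=> pp up sp; pose x i := nth f (f :: p) i.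
pose A := [set x (2 * i) | i : 'I_M].
have inj : injective (fun i : 'I_M => x (2 * i)).
  move=> i j /eqP; rewrite /x nth_uniq //=; last 2 first.
  - by have := ltn_ord i; move: sp; clear; lia.
  - by have := ltn_ord j; move: sp; clear; lia.
  by move=> /eqP E; apply: val_inj; move: E => /=; clear; lia.
have cA : #|A| = M by rewrite card_imset // card_ord.
have [i [j [ij jM g]]] : exists i j, [/\ i < j, j < M & G (x (2 * i)) (x (2 * j))].
  apply: contrapT => no; have /alpha : indep G A; last by rewrite cA ltnn.
  move=> y z /imsetP[i _ ->] /imsetP[j _ ->]; apply/negP => g; apply: no.
  case: (ltngtP (i : nat) j) => [lt|lt|eq].
  - by exists i, j.
  - by exists j, i; rewrite Gs.
  - by move: g; rewrite eq Gi.
have js : 2 * j <= size p by move: jM sp; clear; lia.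
have Ep : p = take (2 * j).-1 p ++ drop (2 * j).-1 p by rewrite cat_take_drop.
have lt1 : (2 * j).-1 < size p by move: js ij; clear; lia.
have Ed : drop (2 * j).-1 p = x (2 * j) :: drop (2 * j) p.
  rewrite (drop_nth f lt1) (_ : (2 * j).-1.+1 = 2 * j); last by move: ij; clear; lia.
  by congr (_ :: _); rewrite /x -[in RHS](_ : (2 * j).-1.+1 = 2 * j) //; move: ij; clear; lia.
have pd : path G (x (2 * j)) (drop (2 * j) p).
  by move: pp; rewrite {1}Ep cat_path Ed /= => /and3P[].
have ai : last f (take (2 * i) p) = x (2 * i) by apply: last_takeE; move: js ij; clear; lia.
have ss : subseq (take (2 * i) p ++ drop (2 * j).-1 p) p.
  rewrite -{3}(cat_take_drop (2 * i) p); apply: cat_subseq => //.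
  rewrite (_ : (2 * j).-1 = (2 * j).-1 - 2 * i + 2 * i); last by move: ij; clear; lia.
  by rewrite -drop_drop drop_subseq.
exists (take (2 * i) p ++ drop (2 * j).-1 p); split.
- rewrite cat_path ai Ed /= g pd !andbT.
  by move: pp; rewrite -{1}(cat_take_drop (2 * i) p) cat_path => /andP[].
- apply: subseq_uniq up; by rewrite /= eqxx.
- exact: mem_subseq ss.
- by rewrite last_cat Ed /= [in RHS]Ep last_cat Ed.
- rewrite size_cat size_takel ?size_drop; move: ij js jM; clear; lia.
Qed.

Lemma shorten_to tau f p : path G f p -> uniq (f :: p) -> tau <= size p ->
  exists p', [/\ path G f p', uniq (f :: p'), {subset p' <= p}, last f p' = last f p &
    tau <= size p' < tau + 2 * M].
Proof.
have [N] := ubnP (size p); elim: N p => // N IH p lt pp up tp.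
have [big|small] := leqP (tau + 2 * M) (size p); last by exists p; split => //; rewrite tp.
have [|p1 [pp1 up1 s1 l1 [z1 z2]]] := shorten_step pp up; first by move: big; clear; lia.
have [||p2 [pp2 up2 s2 l2 z]] := IH p1 _ pp1 up1 _.
- by move: lt z1; clear; lia.
- by move: z2 big; clear; lia.
exists p2; split => //; last by rewrite l2.
by move=> y /s2/s1.
Qed.

Definition aroute its : seq V := flatten [seq it.2 | it <- its].

Lemma chain_aroute e R its : chain G h L e R its ->
  [/\ path G e (aroute its), uniq (aroute its), {subset aroute its <= verts its},
      size (aroute its) + size its = L * size its & last e (aroute its) = last e (route its)].
Proof.
elim: its e R => [|it its IH] e R /=.
  by rewrite muln0; split.
move=> [[[_ p1] ll [_ u1] [_ s1] [_ vR]] ch]; have [_ _ vv _ _] := chain_route ch.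
have [pp up ss sz la] := IH _ _ ch.
have E1 : aroute (it :: its) = it.2 ++ aroute its by [].
have E2 : route (it :: its) = it.1 ++ route its by [].
rewrite E1 E2 verts_cons; split.
- by rewrite cat_path p1 -ll.
- rewrite cat_uniq u1 up andbT; apply/hasPn => x /ss/(subsetP vv).
  by rewrite in_setD inE mem_cat negb_or => /andP[/andP[]].
- move=> x; rewrite in_setU mem_cat => /orP[xi|/ss->]; last by rewrite orbT.
  by rewrite [x \in item_set it]inE mem_cat xi orbT.
- by rewrite size_cat mulnS -sz -s1; clear; lia.
- by rewrite !last_cat -ll.
Qed.

Lemma chain_disj e R i1 i2 x : chain G h L e R (i1 ++ i2) -> x \in verts i1 -> x \notin verts i2.
Proof.
case/chain_cat=> _ /chain_route[_ _ vv _ _] x1; apply/negP => /(subsetP vv).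
by rewrite in_setD x1.
Qed.

(** Chords shorten [t] to less than [2 * M] above its target; the excess [j] is removed by switching
    the first [j] items to their shorter route. *)
Lemma exact_length n e R its t : chain G h L e R its -> cycle G (route its ++ t) ->
  uniq (route its ++ t) -> 0 < size t -> last e t = e -> (forall x, x \in verts its -> x \notin t) ->
  2 * M <= size its -> L * size its < n -> n <= size (route its ++ t) ->
  exists c, [/\ cycle G c, uniq c & size c = n].
Proof.
move=> ch cc uc t0 lt dt bM lt1 le1.
have [pr ur vr sr _] := chain_route ch.
move: (cc); rewrite (cycle_path e) last_cat (_ : last _ t = e); last by case: (t) t0 lt.
rewrite cat_path => /andP[_ pt]; set f := last e (route its) in pt.
have fr : f \in route its.
  by apply: last_in; rewrite sr muln_gt0; move: bM M0 hL; clear; lia.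
have uft : uniq (f :: t).
  move: uc; rewrite cat_uniq => /and3P[_ /hasPn H ut] /=; rewrite ut andbT.
  by apply/negP => /H /=; rewrite fr.
have lf : last f t = e by case: (t) t0 lt.
have [|t' [pt' ut' st' lt' /andP[z1 z2]]] := @shorten_to (n - L * size its) f t pt uft.
  by move: le1; rewrite size_cat sr; clear; lia.
pose j := size t' - (n - L * size its).
have jI : j <= size its by move: z1 z2 bM; rewrite /j; clear; lia.
have E : its = take j its ++ drop j its by rewrite cat_take_drop.
move: (ch); rewrite {1}E => /chain_cat[ch1 ch2].
have [pa ua va sa la] := chain_aroute ch1.
have [pr2 ur2 vr2 sr2 _] := chain_route ch2.
have t'0 : 0 < size t' by move: z1 lt1; clear; lia.
have le' : last e (aroute (take j its) ++ route (drop j its) ++ t') = e.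
  by rewrite !last_cat; have := lt'; rewrite lf; case: (t') t'0.
have f' : last (last e (route (take j its))) (route (drop j its)) = f.
  by rewrite -last_cat -route_cat -E.
exists (aroute (take j its) ++ route (drop j its) ++ t'); split.
- by rewrite (cycle_path e) le' !cat_path pa la pr2 f'.
- rewrite !cat_uniq ua ur2; move: ut' => /= /andP[_ ->]; rewrite /= andbT; apply/andP; split.
    rewrite has_cat negb_or; apply/andP; split; apply/hasPn => x xx.
      apply/negP => /va xv; have := subsetP vr2 x (route_verts xx).
      by rewrite in_setD xv.
    apply/negP => /va xv; have := st' _ xx; apply/negP; apply: dt.
    by rewrite E verts_cat in_setU xv.
  apply/hasPn => x xx; apply/negP => xr; have := st' _ xx; apply/negP; apply: dt.
  by rewrite E verts_cat in_setU (route_verts xr) orbT.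
- rewrite !size_cat sr2 size_drop; move: sa; rewrite size_takel // => sa.
  have : L * size its = L * j + L * (size its - j) by rewrite -mulnDr subnKC.
  by move: sa z1 lt1; rewrite /j; clear; lia.
Qed.

(** Half of the retained arc is contiguous in [Z] and contains [2 * M] consecutive whole items;
    [exact_length] applies to these, with the rest of the detour in the role of [t]. *)
Lemma window_exact n e R its s t k a b c :
  chain G h L (last e s) R its -> 0 < size s ->
  rot k (s ++ route its ++ t) = a ++ b -> cycle G (a ++ c) -> uniq (a ++ c) ->
  (forall x, x \in verts its -> x \notin s /\ x \notin t) ->
  (forall x, x \in a ++ c -> x \in verts its -> x \in route its) ->
  2 * (size s + size t + L * (2 * M + 2)) <= size a -> L * (2 * M) < n -> n <= size (a ++ c) ->
  exists c, [/\ cycle G c, uniq c & size c = n].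
Proof.
move=> ch s0 rE ca ua dv V1 big lt le.
have [_ _ _ sr _] := chain_route ch.
have [x [u [y [a1 [a2 [EZ Ea sau]]]]]] := rot_piece rE.
have sZ := congr1 size EZ; rewrite !size_cat sr in sZ.
(* The window begins with an item starting strictly beyond position [size x], so that [u1] is
   nonempty and ends in the vertex from which the window is entered. *)
pose j := ((size x - size s) %/ L).+1.
have L0 : 0 < L by move: hL; clear; lia.
have j1 : size x < size s + L * j.
  by have := ltn_ceil (size x - size s) L0; rewrite mulnC -/j; clear; lia.
have j2 : L * j <= (size x - size s) + L.
  by have := leq_trunc_div (size x - size s) L; rewrite /j mulnS mulnC; clear; lia.
have ub : size s + size t + L * (2 * M + 2) <= size u by move: sau big; move: (L * _) => Q; clear; lia.
have jits : j + 2 * M <= size its.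
  rewrite -(leq_pmul2l L0) mulnDr; move: j2 sZ ub; rewrite mulnDr.
  by move: (L * j) (L * (2 * M)) (L * size its) => P Q S; clear; lia.
pose i1 := take j its; pose w := take (2 * M) (drop j its); pose i3 := drop (2 * M) (drop j its).
have Ei : its = i1 ++ w ++ i3 by rewrite !cat_take_drop.
have si1 : size i1 = j by rewrite size_takel //; move: jits; clear; lia.
have sw : size w = 2 * M by rewrite size_takel // size_drop; move: jits; clear; lia.
move: (ch); rewrite {1}Ei => /chain_cat[ch1 /chain_cat[chw ch3]].
have [_ _ _ sr1 _] := chain_route ch1; have [_ urw vw srw _] := chain_route chw.
rewrite si1 in sr1; rewrite sw in srw.
have [|||u2 Eu] := @infix_mid _ (s ++ route i1) (route w) (route i3 ++ t) x u y.
- by rewrite -EZ Ei !route_cat -!catA.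
- by rewrite size_cat sr1; move: j1; clear; lia.
- rewrite size_cat sr1 srw; move: j2 ub; rewrite mulnDr; clear; lia.
set u1 := drop (size x) _ in Eu.
have u10 : 0 < size u1 by rewrite size_drop size_cat sr1; move: j1; clear; lia.
have lu1 d : last d u1 = last (last e s) (route i1).
  rewrite -last_cat; have := cat_take_drop (size x) (s ++ route i1); rewrite -/u1 => <-.
  by rewrite last_cat; case: (u1) u10.
pose tt := u2 ++ a2 ++ c ++ a1 ++ u1.
have P0 : perm_eq (a ++ c) (route w ++ tt).
  by rewrite Ea Eu /tt; apply/permP => P; rewrite !count_cat; clear; lia.
have C0 : cycle G (route w ++ tt).
  move: ca; rewrite Ea Eu (_ : _ ++ c = (a1 ++ u1) ++ (route w ++ u2 ++ a2 ++ c)); last by rewrite -!catA.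
  by rewrite cycle_catC -!catA.
have ltt d : last d tt = last (last e s) (route i1) by rewrite /tt !last_cat lu1.
apply: (@exact_length n (last (last e s) (route i1)) (R :\: verts i1) w tt) => //.
- by rewrite -(perm_uniq P0).
- by rewrite /tt !size_cat; move: u10; clear; lia.
- move=> z zw; apply/negP => zt; have za : z \in a ++ c by rewrite (perm_mem P0) mem_cat zt orbT.
  have zr : z \in route its by apply: V1 => //; rewrite Ei !verts_cat !in_setU zw orbT.
  move: zr; rewrite Ei !route_cat !mem_cat => /or3P[z1|z2|z3].
  + have := subsetP vw _ zw; by rewrite in_setD (route_verts z1).
  + have := ua; rewrite (perm_uniq P0) cat_uniq => /and3P[_ /hasPn/(_ _ zt)].
    by rewrite /= z2.
  + have [_ _ v3 _ _] := chain_route ch3; have := subsetP v3 _ (route_verts z3).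
    by rewrite in_setD zw.
- by rewrite sw.
- by rewrite sw.
- by rewrite -(perm_size P0).
Qed.

End Exact.

(** * A cycle of length [n] or a large joined set *)

Section Dichotomy.
Variables (V : finType) (G : rel V).
Hypothesis Gs : symmetric G.
Hypothesis Gi : irreflexive G.
Variables (n M h : nat).
Let g := 300 * M * h.+1.
Hypothesis M0 : 0 < M.
Hypothesis h0 : 0 < h.
Hypothesis hM : M <= 2 ^ h.
Hypothesis h2M : 2 ^ h <= 2 * M.
Hypothesis gn : 200 * g <= n.
Hypothesis nV : n <= #|V|.
Hypothesis alpha : forall A : {set V}, indep G A -> #|A| < M.
Hypothesis P2 : forall A : {set V}, M <= #|A| -> n <= #|cn G A|.
Hypothesis P22 : forall A B : {set V}, nadj G A B ->
  M <= #|A| -> M <= #|B| -> 2 * n <= #|cn G (A :|: B)| + 2.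

Lemma cycle_or_joined : (exists c, [/\ cycle G c, uniq c & size c = n]) \/
  exists X : {set V}, [/\ n <= #|X| + 2 * g, #|X| < n &
    forall A B : {set V}, A \subset X -> B \subset X -> nadj G A B -> M <= #|A| -> M <= #|B| -> False].
Proof.
(* About [100 * M] items fit into length [n]: enough for [2 * M] in a row on a long arc, and few
   enough for the [100 * M * h] vertices off their main routes to stay below [g]. *)
pose L := (n %/ (100 * M)).+1.
have l1 : n < 100 * M * L.
  by rewrite mulnC; apply: ltn_ceil; move: M0; clear; lia.
have l2 : 100 * M * L <= n + 100 * M.
  by have := leq_trunc_div n (100 * M); rewrite /L mulnS [n %/ _ * _]mulnC; clear; lia.
have g1 : 300 * M <= g by rewrite /g mulnS; clear; lia.
have g2 : g = 300 * M + 300 * (M * h) by rewrite /g mulnS -mulnA.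
have hMh : h <= M * h by rewrite leq_pmull.
have LM : L <= M * L by rewrite leq_pmull.
have hL : h < L.
  rewrite ltnNge; apply/negP => Lh; have : M * L <= M * h by rewrite leq_mul2l Lh orbT.
  by move: l1 gn g2; rewrite -mulnA; clear; lia.
have nL : L + 2 * h + 20 * M < n.
  by move: l2 gn g2 hMh LM M0; rewrite -mulnA; clear; lia.
have [e [R [its [s [t [cZ uZ ch dv [s0 sL n1 n2]]]]]]] := item_cycle Gs Gi M0 h0 hM h2M hL alpha P2 nV nL.
have [pr ur vr sr cr] := chain_route ch.
set Z := s ++ _ in cZ uZ n1.
have sZ : size Z = size s + L * size its + size t by rewrite /Z !size_cat sr addnA.
(* A cycle that is already long enough has at least [2 * M] items, and the first [2 * M] suffice for
   [exact_length]. *)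
have [nZ|Zn] := leqP n (size Z).
  left; have big : 2 * M <= size its.
    rewrite leqNgt; apply/negP => lt; have lt' : (size its).+2 <= 4 * M by move: lt M0; clear; lia.
    have a1 : L * size its <= L * (4 * M) by rewrite leq_mul2l; apply/orP; right; move: lt'; clear; lia.
    have a2 : h * (size its + 2) <= h * (4 * M) by rewrite leq_mul2l addn2 lt' orbT.
    move: n2 a1 a2; rewrite sr; move: l2 gn g2 M0 LM; rewrite -mulnA [h * (4 * M)]mulnCA [L * (4 * M)]mulnCA [h * M]mulnC [L * M]mulnC.
    by move: (M * L) (L * size its) (M * h) (h * (size its + 2)) => P Q S T; clear; lia.
  pose w := take (2 * M) its; pose i3 := drop (2 * M) its.
  have Ei : its = w ++ i3 by rewrite cat_take_drop.
  have sw : size w = 2 * M by rewrite size_takel.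
  move: (ch); rewrite Ei => ch'; have [chw _] := proj1 (@chain_cat _ _ _ _ _ _ _ _) ch'.
  have ZE : Z = s ++ (route w ++ (route i3 ++ t)) by rewrite /Z Ei route_cat -catA.
  apply: (@exact_length _ _ Gs Gi M h L M0 hL alpha n (last e s) R w ((route i3 ++ t) ++ s)) => //.
  - by move: cZ; rewrite ZE cycle_catC -!catA.
  - move: uZ; rewrite ZE uniq_catC -!catA //.
  - by rewrite size_cat; move: s0; clear; lia.
  - by rewrite last_cat; case: (s) s0.
  - move=> x xw; have xv : x \in verts its by rewrite Ei verts_cat in_setU xw.
    have [xs xt] := dv x xv; rewrite !mem_cat (negbTE xs) (negbTE xt) !orbF.
    by apply: contra (chain_disj ch' xw); apply: route_verts.
  - by rewrite sw.
  - by rewrite sw mulnCA [L * M]mulnC; move: l2 gn g2 M0; rewrite -mulnA; clear; lia.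
  - by move: nZ; rewrite ZE !size_cat; clear; lia.
have its100 : size its < 100 * M.
  rewrite ltnNge; apply/negP => le; have : 100 * M * L <= L * size its by rewrite mulnC leq_mul2l le orbT.
  by move: l1 Zn sZ; clear; lia.
have hits : h * size its <= 100 * (M * h).
  by rewrite mulnA mulnC leq_mul2r ltnW ?orbT.
(* Vertices lying only on second routes are withheld, so that a detour cannot block a later
   switch. *)
pose V1 := ~: (verts its :\: [set x in route its]).
have cV1 : #|~: V1| <= 100 * (M * h) by rewrite setCK (leq_trans cr).
have inV1 x : x \in V1 -> x \in verts its -> x \in route its.
  by rewrite in_setC in_setD negb_and negbK [x \in [set _ in _]]inE => /orP[//|/negP].
have ZV : {subset Z <= V1}.
  move=> x xZ; rewrite in_setC in_setD negb_and negbK [x \in [set _ in _]]inE.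
  have [xv|] := boolP (x \in verts its); last by rewrite orbT.
  have [xs xt] := dv x xv; move: xZ; rewrite /Z !mem_cat (negbTE xs) (negbTE xt).
  by rewrite orbF /= => ->.
have gn' : n <= size Z + g.
  by move: n1 hits g2 M0 hMh; rewrite mulnDr; clear; lia.
have cutV (A : {set V}) : #|A| <= #|A :&: V1| + 100 * (M * h).
  rewrite -(cardsID V1 A) leq_add2l; apply: leq_trans cV1; apply: subset_leq_card.
  by rewrite setDE subsetIr.
have [ld|nld] := pselect (long_detour G n V1 Z).
  left; case: ld => k [a [b [c [rE ca ua sV [le la]]]]].
  apply: (@window_exact _ _ Gs Gi M h L M0 hL alpha n e R its s t k a b c) => //.
  - by move=> x /sV; apply: inV1.
  - have -> : L * (2 * M + 2) = 2 * (M * L) + 2 * L by clear; nia.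
    move: n2 hits sZ Zn la gn' gn g2 l2 LM hMh M0; rewrite sr [h * (_ + _)]mulnDr -[100 * M * L]mulnA.
    by move: (M * L) (M * h) (L * size its) (h * size its) => P Q S T; clear; lia.
  - by rewrite mulnCA [L * M]mulnC; move: l2 gn g2 M0; rewrite -mulnA; clear; lia.
right; have [|||X [XZ cX jX]] := @joined_or_detour _ G Gs Gi n M g V1 M0 _ gn alpha _ _ Z cZ uZ ZV gn' Zn nld.
- by move: g1; clear; lia.
- move=> A _ AM; have := P2 AM; have := cutV (cn G A); move: g2; clear; lia.
- move=> A B _ _ nAB AM BM; have := P22 nAB AM BM; have := cutV (cn G (A :|: B)); move: g2 M0; clear; lia.
exists X; split => //; apply: leq_ltn_trans Zn.
rewrite -(card_uniqP uZ); apply: subset_leq_card; apply/subsetP => x; exact: XZ.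
Qed.

End Dichotomy.

(** * Hamiltonicity of joined expanding sets *)

(** An infix across the cut would contain [y], the last vertex before it. *)
Lemma infix_split (T : eqType) (J u w : seq T) y : infix J (rcons u y ++ w) -> y \notin J ->
  infix J (rcons u y) \/ infix J w.
Proof.
move=> /infixP[s [s' E]] yJ.
have [le|lt] := leqP (size (rcons u y)) (size s).
  right; have := congr1 (drop (size (rcons u y))) E; rewrite drop_size_cat // drop_cat.
  case: ltngtP le => // [_ _ ->|eq _ ->].
    by rewrite infix_infix.
  by rewrite eq subnn drop0 prefix_infix.
have [le|lt'] := leqP (size s + size J) (size (rcons u y)).
  left; have := congr1 (take (size (rcons u y))) E; rewrite take_size_cat // catA take_cat.
  rewrite size_cat; case: ltngtP le => // [_ _ ->|eq _ ->].
    by rewrite -catA infix_infix.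
  by rewrite -eq subnn take0 cats0 suffix_infix.
case/negP: yJ; have := congr1 (take (size (rcons u y))) E; rewrite take_size_cat // take_cat ltnNge ltnW //=.
rewrite takel_cat; last by move: lt lt'; clear; lia.
set k := _ - _ => Er; have : last y (take k J) = y.
  have := last_rcons y u y; rewrite Er last_cat.
  have : 0 < size (take k J) by rewrite size_take; case: ifP => _; move: lt lt'; rewrite /k; clear; lia.
  by case: (take k J).
move=> ly; apply: (@mem_take k); rewrite -{1}ly; apply: last_in.
rewrite size_take; case: ifP => _; move: lt lt'; rewrite /k; clear; lia.
Qed.

Lemma pigeon_card (T I : finType) (S : {set T}) (F : I -> {set T}) c :
  (forall x, x \in S -> exists i, x \in F i) -> (forall i, #|F i| <= c) -> #|S| <= #|I| * c.
Proof.
move=> cov bd; apply: (@leq_trans #|\bigcup_i F i|).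
  by apply: subset_leq_card; apply/subsetP => x /cov[i xi]; apply/bigcupP; exists i.
apply: (@leq_trans (\sum_i #|F i|)).
  elim/big_ind2: _ => [|A a B b h1 h2|i _] //; first by rewrite cards0.
  exact: cardU_le.
by apply: (@leq_trans (\sum_(i : I) c)); [exact: leq_sum|rewrite sum_nat_const].
Qed.

Lemma avoid_nat (s : seq nat) r : size s < r -> exists2 j, j < r & j \notin s.
Proof.
move=> lt; apply: contrapT => no.
have : {subset iota 0 r <= s}.
  move=> j; rewrite mem_iota add0n /= => jr; apply/negPn/negP => js; apply: no; by exists j.
by move/(uniq_leq_size (iota_uniq 0 r)); rewrite size_iota leqNgt lt.
Qed.

Section Intact.
Variables (V : finType) (G : rel V) (K : V -> V -> Prop).

Definition intact (J p : seq V) := infix J p || infix (rev J) p.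

Lemma intact_rev J p : intact J (rev p) = intact J p.
Proof. by rewrite /intact infix_rev -infix_revLR orbC. Qed.

Lemma rot1_intact p q : rot1 G K p q ->
  exists y, forall J, y \notin J -> intact J p -> intact J q.
Proof.
move=> /rot1E[u [y [x [w [-> -> _ _]]]]]; exists y.
have half J : y \notin J -> infix J (rcons u y ++ x :: w) -> intact J (rev (rcons u y) ++ x :: w).
  move=> yJ /infix_split -/(_ yJ)[h|h]; rewrite /intact; last by rewrite infix_catl.
  by rewrite [infix (rev J) _]infix_catr ?orbT // infix_rev.
move=> J yJ /orP[/(half _ yJ)//|/half]; rewrite mem_rev => /(_ yJ).
by rewrite /intact revK orbC.
Qed.

(** A rotation cuts the path right after its new head, so only segments containing one of the at
    most [i] new heads can be damaged. *)
Lemma rotn_intact p i q : rotn G K p i q ->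
  exists2 ys, size ys <= i & forall J, {in ys, forall y, y \notin J} -> intact J p -> intact J q.
Proof.
elim=> [j|j q1 q2 _ [ys sy IH] /rot1_intact[y H]]; first by exists [::].
exists (y :: ys) => // J ny ip; apply: H; first by apply: ny; rewrite inE eqxx.
by apply: IH => // z zy; apply: ny; rewrite inE zy orbT.
Qed.

End Intact.

Section Token.
Variables (V : finType) (G : rel V).
Hypothesis Gs : symmetric G.
Variables (K : V -> V -> Prop) (b : V) (J : seq V).
Hypothesis ub : uniq (b :: J).
Hypothesis Kb : forall y x, K y x -> y != b /\ x != b.

Definition tok (o : bool) (X : seq V) := if o then rev (b :: X) else b :: X.

(* A rotation of [b :: J] that never pivots at [b] lifts to every path in which [b] is
   stretched to a segment [b :: X]. *)
Lemma token_realize i q : rotn G K (b :: J) i q -> exists q1 q2 o, [/\ q = q1 ++ b :: q2, (q1 = [::] -> o = false) &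
  forall X Y, sorted G ((b :: X) ++ J ++ Y) ->
    [/\ sorted G (q1 ++ tok o X ++ q2 ++ Y), perm_eq (q1 ++ tok o X ++ q2 ++ Y) ((b :: X) ++ J ++ Y) &
        forall d, last d (q1 ++ tok o X ++ q2 ++ Y) = last d ((b :: X) ++ J ++ Y)]].
Proof.
elim=> [j|j q' q'' r [q1 [q2 [o [Eq ho H]]]] /rot1E[u [y [x [w [E1 E2 g k]]]]]].
  by exists [::], J, false; split => // X Y sr; split.
have [yb xb] := Kb k.
have uq : uniq q' by rewrite -(perm_uniq (rotn_perm r)).
have hq d : head d q' = head d (rcons u y) by rewrite E1; case: (u).
(* By [ho] the stretched segment is unreversed when it comes first, so it still starts with [b];
   formal and actual paths share their head, and the same edge of [G] serves both rotations. *)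
have hreal d X Z : head d (q1 ++ tok o X ++ Z) = head d q'.
  by rewrite Eq; case: (q1) ho => [/(_ erefl)->|].
have step A X Y : sorted G ((b :: X) ++ J ++ Y) -> forall B,
    q1 ++ tok o X ++ q2 ++ Y = rcons A y ++ x :: B -> [/\ sorted G (rev (rcons A y) ++ x :: B),
    perm_eq (rev (rcons A y) ++ x :: B) ((b :: X) ++ J ++ Y) &
    forall d, last d (rev (rcons A y) ++ x :: B) = last d ((b :: X) ++ J ++ Y)].
  move=> sr B EB; have [s1 p1 l1] := H X Y sr.
  have g' : G (head y (rcons A y)) x.
    have -> : head y (rcons A y) = head y (rcons A y ++ x :: B) by case: (A).
    by rewrite -EB hreal hq.
  have r1 : rot1 G (fun _ _ => True) (rcons A y ++ x :: B) (rev (rcons A y) ++ x :: B).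
    by rewrite rev_rcons; apply: Rot1.
  split; first by apply: (rot1_sorted Gs r1); rewrite -EB.
    by apply: perm_trans p1; rewrite EB perm_sym; apply: rot1_perm r1.
  by move=> d; rewrite (rot1_last d r1) -EB.
(* If [b] lies in the part being reversed, its whole segment is reversed with it and [o] flips. *)
have [bu|bu] := boolP (b \in rcons u y).
  have bu' : b \in u by move: bu; rewrite mem_rcons inE eq_sym (negbTE yb).
  case/splitPr: bu' E1 E2 => u1 u2 E1 E2.
  have [e1 e2] : q1 = u1 /\ q2 = rcons u2 y ++ x :: w.
    apply: (@cat_cons_inj _ b); first by rewrite -Eq.
    by rewrite -Eq E1 rcons_cat /= -catA.
  exists (rev (rcons u2 y)), (rev u1 ++ x :: w), (~~ o); split.
  - by rewrite E2 rcons_cat rev_cat rcons_cons rev_cons cat_rcons -!catA.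
  - by rewrite rev_rcons.
  move=> X Y sr; have tE : tok (~~ o) X = rev (tok o X) by rewrite /tok; case: (o); rewrite ?revK.
  have := step (q1 ++ tok o X ++ u2) X Y sr (w ++ Y).
  rewrite e2 !rcons_cat -!catA cat_cons; move/(_ erefl); rewrite e1 !rev_cat tE -!catA.
  by rewrite cat_cons.
have bw : b \in w.
  have : b \in q' by rewrite Eq mem_cat inE eqxx orbT.
  by rewrite E1 mem_cat (negbTE bu) inE eq_sym (negbTE xb).
case/splitPr: bw E1 E2 => w1 w2 E1 E2.
have [e1 e2] : q1 = rcons u y ++ x :: w1 /\ q2 = w2.
  apply: (@cat_cons_inj _ b); first by rewrite -Eq.
  by rewrite -Eq E1 -catA.
exists (rev (rcons u y) ++ x :: w1), w2, o; split.
- by rewrite E2 -catA.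
- by rewrite rev_rcons.
move=> X Y sr; have := step u X Y sr (w1 ++ tok o X ++ w2 ++ Y).
by rewrite e1 e2 -!catA !cat_cons; apply.
Qed.

End Token.

Section Core.
Variables (V : finType) (G : rel V) (J : seq V).
Hypothesis uJ : uniq J.

(** Rotations with pivot in [inner K] put their new head in [K]. The ends of [J] are excluded
    because on a longer path they have neighbours outside [J]. *)
Definition inner (K : {set V}) : {set V} :=
  [set v in K | [&& v != head v J, v != last v J & [forall u, adjb J u v ==> (u \in K)]]].

Lemma innerP (K : {set V}) v : reflect [/\ v \in K, v <> head v J, v <> last v J & forall u, adjb J u v -> u \in K]
  (v \in inner K).
Proof.
rewrite inE; apply: (iffP and4P) => -[-> /eqP h1 /eqP h2 h3]; split => //; try exact/eqP.
  by move=> u; apply/implyP; move/forallP: h3.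
by apply/forallP => u; apply/implyP/h3.
Qed.

(** A vertex missing from [K] spoils itself and at most two neighbours; the [2] accounts for the
    ends of [J]. *)
Lemma inner_card (K : {set V}) : {subset K <= J} ->
  size J <= #|inner K| + 3 * #|[set x in J] :\: K| + 2.
Proof.
move=> KJ; set D := _ :\: K.
pose N := [set v in J | [exists u, (u \in D) && adjb J u v]].
have N2 : #|N| <= 2 * #|D|.
  apply: (adj_nbrs_card uJ) => v; rewrite inE => /andP[_ /existsP[u /andP[]]]; by exists u.
pose H := [set v in J | (v == head v J) || (v == last v J)].
have H2 : #|H| <= 2.
  rewrite /H; case: (J) => [|a J'].
    by rewrite (_ : [set _ in _ | _] = set0) ?cards0 //; apply/setP => v; rewrite !inE.
  apply: (@leq_trans #|[set a; last a J']|); last by rewrite cards2; case: (_ != _).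
  by apply: subset_leq_card; apply/subsetP => v; rewrite !inE => /andP[_].
have sub : [set x in J] \subset inner K :|: (D :|: (N :|: H)).
  apply/subsetP => v vJ; rewrite inE in vJ; rewrite !in_setU in_setD inE vJ.
  have [vK|vK] := boolP (v \in K); last by rewrite orbT.
  have [vN|vN] := boolP (v \in N); first by rewrite !orbT.
  have [vH|vH] := boolP (v \in H); first by rewrite !orbT.
  rewrite !orbF; apply/innerP; split => //.
  - by move=> E; case/negP: vH; rewrite inE vJ -E eqxx.
  - by move=> E; case/negP: vH; rewrite inE vJ -E eqxx orbT.
  move=> u uv; apply: contraNT vN => uK; rewrite inE vJ; apply/existsP; exists u.
  by rewrite uv andbT in_setD uK inE; have /andP[] := adjb_mem uv.
have := subset_leq_card sub; rewrite [#|[set x in J]|]cardsE (card_uniqP uJ).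
have := cardUle (inner K) (D :|: (N :|: H)); have := cardUle D (N :|: H); have := cardUle N H.
move: N2 H2; clear; lia.
Qed.

(** The argument of [clean_set], with edges into [inner] in place of neighbourhood sizes: [B] is a
    largest set without edges to the inner part of its complement, and a further bad [A] could be
    added to it. *)
Lemma expanding_core t : (forall A B : {set V}, {subset A <= J} -> {subset B <= J} -> t <= #|A| -> t <= #|B| -> ~~ nadj G A B) ->
  16 * t <= size J -> 0 < t ->
  exists K : {set V}, [/\ {subset K <= J}, 2 * t <= #|inner K| &
   forall A : {set V}, A \subset K -> A != set0 -> #|A| <= t ->
     exists a v, [/\ a \in A, v \in inner (K :\: A) & G a v]].
Proof.
move=> jn sJ t0; pose JS := [set x in J].
pose P (B : {set V}) := [/\ B \subset JS, #|B| <= 2 * t & forall a v, a \in B -> v \in inner (JS :\: B) -> ~~ G a v].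
have [|B [BJ B2 Bn] mx] := @ex_maxcard _ P.
  by exists set0; split; rewrite ?sub0set ?cards0 // => a v; rewrite inE.
have KJ (C : {set V}) : {subset JS :\: C <= J} by move=> x; rewrite !inE => /andP[].
have DD (C : {set V}) : C \subset JS -> [set x in J] :\: (JS :\: C) = C.
  by move=> CJ; rewrite setDDr setDv set0U; apply/setIidPr.
have Bt : #|B| < t.
  rewrite ltnNge; apply/negP => tB; have := inner_card (KJ B); rewrite DD // => le.
  have tI : t <= #|inner (JS :\: B)| by move: le B2 sJ t0; clear; lia.
  have : ~~ nadj G B (inner (JS :\: B)).
    apply: jn => // x; first by move/(subsetP BJ); rewrite inE.
    by move/innerP => [/KJ].
  case/negP; apply/nadjP => a v aB vI; split; last exact: Bn.
  by move=> av; case/innerP: vI => + _ _ _; rewrite -av in_setD aB.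
exists (JS :\: B); split => //.
  by have := inner_card (KJ B); rewrite DD //; move: Bt sJ t0; clear; lia.
move=> A AK A0 At; apply: contrapT => no.
have AJ : A \subset JS by apply: subset_trans AK (subsetDl _ _).
have /mx : P (B :|: A).
  split; first by rewrite subUset BJ.
    by apply: leq_trans (cardUle _ _) _; move: Bt At; clear; lia.
  move=> a v; rewrite in_setU -setDDl => /orP[aB|aA] vI; last first.
    by apply/negP => g; apply: no; exists a, v.
  apply: Bn => //; case/innerP: vI => vK h1 h2 h3; apply/innerP; split => //.
    by move: vK; rewrite in_setD => /andP[].
  by move=> u /h3; rewrite in_setD => /andP[].
rewrite cardsU (_ : B :&: A = set0) ?cards0 ?subn0; last first.
  apply/setP => x; rewrite !inE; apply/negP => /andP[xB /(subsetP AK)]; by rewrite in_setD xB.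
by move: A0; rewrite -card_gt0; clear; lia.
Qed.

End Core.

Section Hamilton.
Variables (V : finType) (G : rel V).
Hypothesis Gs : symmetric G.
Variables (X : {set V}) (t q r : nat).
Hypothesis t0 : 0 < t.
Hypothesis rq : r = 2 * q + 2.
Hypothesis q2 : 4 * r * t <= 2 ^ q.
Hypothesis expand : forall A : {set V}, A \subset X -> A != set0 -> #|A| <= 4 * r * t -> 4 * #|A| <= #|ext G A X|.
Hypothesis joined : forall A B : {set V}, A \subset X -> B \subset X -> t <= #|A| -> t <= #|B| -> ~~ nadj G A B.

Let KT := fun _ _ : V => True.

Definition longest p := [/\ uniq p, sorted G p, {subset p <= X}, 0 < size p &
  forall p', uniq p' -> sorted G p' -> {subset p' <= X} -> size p' <= size p].

Lemma longest_perm p p' : longest p -> perm_eq p p' -> sorted G p' -> longest p'.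
Proof.
move=> [up _ sp p0 mx] pe sp'; split => //.
- by rewrite -(perm_uniq pe).
- by move=> x; rewrite -(perm_mem pe); apply: sp.
- by rewrite -(perm_size pe).
- by rewrite -(perm_size pe).
Qed.

Lemma longest_nb p y w v : longest p -> perm_eq p (y :: w) -> sorted G (y :: w) -> G y v -> v \in X -> v \in p.
Proof.
move=> lp pe sw g vX; have [uq _ sq _ mx] := longest_perm lp pe sw.
rewrite (perm_mem pe); apply/negPn/negP => vp; have := mx (v :: y :: w).
rewrite cons_uniq vp uq (_ : sorted G (v :: y :: w)) /=; last by rewrite Gs g.
rewrite ltnn => H; suff : false by [].
by apply: H => // z; rewrite inE => /orP[/eqP->//|/sq].
Qed.

Lemma heads_step p i (A : {set V}) : longest p -> A \subset heads G KT p i -> 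
  [/\ A \subset X, {subset ext G A X <= p} & #|ext G (heads G KT p i) X| <= 2 * #|heads G KT p i.+1|].
Proof.
move=> lp; have [up sp pX _ _] := lp.
have hv y v : y \in heads G KT p i -> G y v -> v \in X -> v \in p.
  move=> /headsP[w rw] g vX; apply: (longest_nb lp (rotn_perm rw) _ g vX).
  exact: rotn_sorted rw sp.
move=> AH; split.
- by apply/subsetP => y /(subsetP AH)/heads_sub/pX.
- move=> v; rewrite !in_setD in_setI => /and3P[_ /nbP[y yA g] vX].
  by apply: hv g vX; apply: (subsetP AH).
apply: (adj_nbrs_card up) => v; rewrite in_setD in_setI => /and3P[vh /nbP[y yh g] vX].
have vp := hv _ _ yh g vX; case/headsP: yh => w rw.
exact: (posa_step up rw vp vh g).
Qed.

(** Outside neighbours number at least four times the heads, each is next on [p] to a head of the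
    following round, and a head serves at most two: the number of heads doubles. *)
Lemma heads_grow p : longest p -> 4 * r * t <= #|heads G KT p q|.
Proof.
move=> lp; have H i : 4 * r * t <= #|heads G KT p i| \/ 2 ^ i <= #|heads G KT p i|.
  elim: i => [|i IH].
    right; rewrite card_gt0; apply/set0Pn; have [_ _ _ p0 _] := lp.
    by case E: p p0 => [|y p'] // _; exists y; apply/headsP; exists p'; apply: rotn0.
  have [big|small] := leqP (4 * r * t) #|heads G KT p i|.
    by left; apply: leq_trans big (subset_leq_card (heads_mono _ _ _ (leqnSn i))).
  case: IH => IH; first by move: small; rewrite ltnNge IH.
  right; have [hX _ le] := heads_step lp (subxx (heads G KT p i)).
  have h0 : heads G KT p i != set0.
    by rewrite -card_gt0; apply: leq_trans IH; rewrite expn_gt0.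
  have := expand hX h0 (ltnW small); rewrite expnS; move: le IH; clear; lia.
by case: (H q) => // /(leq_trans q2).
Qed.

Lemma longest_size p : longest p -> 16 * t * r <= size p.
Proof.
move=> lp; have [A AH cA] := subset_card_eq (heads_grow lp).
have [AX sub _] := heads_step lp AH.
have A0 : A != set0.
  by rewrite -card_gt0 cA !muln_gt0 t0 rq addn2.
have := expand AX A0; rewrite cA leqnn => /(_ isT) le.
have cE : #|ext G A X| <= size p.
  apply: leq_trans (card_size p); apply: subset_leq_card; apply/subsetP => x; exact: sub.
by move: le cE; clear; nia.
Qed.

Definition segment (p : seq V) j := take (size p %/ r) (drop (j * (size p %/ r)) p).

Lemma segment_size p j : j < r -> size (segment p j) = size p %/ r.
Proof.
move=> jr; rewrite size_takel // size_drop.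
have : j.+1 * (size p %/ r) <= size p.
  by apply: leq_trans (leq_trunc_div (size p) r); rewrite mulnC leq_mul2l jr orbT.
by rewrite mulSn; clear; lia.
Qed.

Lemma segment_infix p j : infix (segment p j) p.
Proof.
rewrite -[X in infix _ X](cat_take_drop (j * (size p %/ r))); apply: infix_catl.
by rewrite -[X in infix _ X](cat_take_drop (size p %/ r)); apply: prefix_infix.
Qed.

(** The position determines the segment, so one vertex spoils at most one of them. *)
Lemma segment_index p j x : uniq p -> x \in segment p j -> index x p %/ (size p %/ r) = j.
Proof.
set l := size p %/ r => up xb.
have lt : index x (segment p j) < size (segment p j) by rewrite index_mem.
have sb : size (segment p j) <= l by rewrite size_take -/l; case: ifP => // /negbT; rewrite -leqNgt.
have E : p = take (j * l) p ++ drop (j * l) p by rewrite cat_take_drop.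
have xd : x \in drop (j * l) p by apply: mem_take xb.
have xt : x \notin take (j * l) p.
  by move: up; rewrite {1}E cat_uniq => /and3P[_ /hasPn/(_ _ xd)].
have jl : j * l <= size p.
  by rewrite leqNgt; apply/negP => lt'; move: xd; rewrite drop_oversize // ltnW.
have -> : index x p = j * l + index x (segment p j).
  rewrite {1}E index_cat (negbTE xt) size_takel //; congr (_ + _).
  by rewrite /segment -/l -{1}(cat_take_drop l (drop (j * l) p)) index_cat xb.
by rewrite divnMDl; [rewrite divn_small ?addn0 //|]; move: lt sb; clear; lia.
Qed.

(** One end [b] is chosen first and then kept while the other end [a] varies. Some segment, in one
    orientation, is intact on paths from [b] to at least [2 * t] ends [a]. Rotations of the formal
    sequence formed by [b] and the segment reach more than [t] heads in it, and joinedness links one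
    of these to one of the ends. *)
Lemma longest_closes p : longest p -> exists2 c, perm_eq c p & cycle G c.
Proof.
move=> lp; have [up sp pX _ _] := lp; have sz := longest_size lp.
have r0 : 0 < r by rewrite rq addn2.
set l := size p %/ r; have l16 : 16 * t <= l by rewrite leq_divRL.
pose J (j : 'I_r) := segment p j.
have uJ j : uniq (J j) by apply: infix_uniq (segment_infix _ _) up.
have JX j : {subset J j <= X} by move=> x /(mem_infix (segment_infix _ _))/pX.
have sJ j : size (J j) = l by apply: segment_size.
have coreJ j : exists K : {set V}, [/\ {subset K <= J j}, 2 * t <= #|inner (J j) K| &
   forall A : {set V}, A \subset K -> A != set0 -> #|A| <= t ->
     exists a v, [/\ a \in A, v \in inner (J j) (K :\: A) & G a v]].
  apply: expanding_core => //; last by rewrite sJ.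
  move=> A B AJ BJ; apply: joined; apply/subsetP => x; [move/AJ|move/BJ]; exact: JX.
have [K hK] := choice coreJ.
(* From [b] outside [Bad j], rotations can start inside segment [j]. As the segment is selected only
   later, [b] must be good for all of them. *)
pose Bad j : {set V} := [set b in X | [forall v in inner (J j) (K j), ~~ G b v]].
have badt j : #|Bad j| <= t.
  rewrite leqNgt; apply/negP => /ltnW/subset_card_eq[B BB cB].
  have [KJ I2 _] := hK j.
  have : ~~ nadj G B (inner (J j) (K j) :\: B).
    apply: joined; rewrite ?cB //.
    - by apply: subset_trans BB _; apply/subsetP => x; rewrite inE => /andP[].
    - by apply/subsetP => x; rewrite in_setD => /andP[_ /innerP[/KJ/JX]].
    - by have := cardsID B (inner (J j) (K j)); have := subset_leq_card (subsetIr (inner (J j) (K j)) B); move: I2 cB; clear; lia.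
  case/negP; apply/nadjP => b v bB; rewrite in_setD => /andP[vB vI]; split.
    by move=> bv; rewrite -bv bB in vB.
  by have := subsetP BB _ bB; rewrite inE => /andP[_ /forall_inP/(_ v vI)].
have rt0 : 0 < r * t by rewrite muln_gt0 r0.
have [b [bq bgood]] : exists b, b \in heads G KT p q /\ forall j, b \notin Bad j.
  apply: contrapT => no; have := @pigeon_card _ _ (heads G KT p q) Bad t _ badt.
  rewrite card_ord => H; have /H : forall x, x \in heads G KT p q -> exists i, x \in Bad i.
    move=> x xh; apply: contrapT => /forallNP nx; apply: no; exists x; split => // j; exact/negP/nx.
  by have := heads_grow lp; move: rt0; rewrite -mulnA; clear; lia.
case/headsP: bq => w rw; have pw := rotn_perm rw; have sw := rotn_sorted Gs rw sp.
pose p1 := rev (b :: w).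
have lp1 : longest p1.
  by apply: (longest_perm lp); [apply: perm_trans pw _; rewrite perm_sym perm_rev|rewrite sorted_revG].
have hg := heads_grow lp1; set S := heads G KT p1 q in hg.
have [ys sy hy] := rotn_intact rw.
pose Jo (jo : 'I_r * bool) := if jo.2 then rev (J jo.1) else J jo.1.
pose good jo a := b \notin Jo jo /\ exists X' Y', [/\ sorted G ((b :: X') ++ Jo jo ++ Y'),
  perm_eq ((b :: X') ++ Jo jo ++ Y') p & last b ((b :: X') ++ Jo jo ++ Y') = a].
have cover a : a \in S -> exists jo, good jo a.
  case/headsP=> w2 rw2; have [ys2 sy2 hy2] := rotn_intact rw2.
  (* The heads of the [q] rotations at either end, and [b], spoil at most [2 * q + 1] of the [r]
     segments. *)
  have [j0 jr jn] : exists2 j, j < r & j \notin [seq index x p %/ l | x <- b :: ys ++ ys2].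
    apply: avoid_nat; rewrite size_map /= size_cat; apply: (@leq_ltn_trans (q + q).+1).
      by rewrite ltnS leq_add.
    by rewrite rq; clear; lia.
  pose j := Ordinal jr.
  have nJ x : x \in b :: ys ++ ys2 -> x \notin J j.
    move=> xin; apply: contra jn => xJ; have -> : j0 = index x p %/ l by rewrite -[j0]/(nat_of_ord j) (segment_index up xJ).
    by apply/mapP; exists x.
  have : intact (J j) (rev (a :: w2)).
    rewrite intact_rev; apply: hy2.
      by move=> y yy; apply: nJ; rewrite inE mem_cat yy !orbT.
    rewrite /p1 intact_rev; apply: hy; last by rewrite /intact segment_infix.
    by move=> y yy; apply: nJ; rewrite inE mem_cat yy !orbT.
  have s2 : sorted G (rev (a :: w2)).
    by rewrite sorted_revG //; apply: (rotn_sorted Gs rw2); rewrite sorted_revG.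
  have pe2 : perm_eq (rev (a :: w2)) p.
    rewrite perm_rev perm_sym; apply: perm_trans (rotn_perm rw2); apply: perm_trans pw _.
    by rewrite perm_sym perm_rev.
  have hd : exists w3, rev (a :: w2) = b :: w3.
    have := rotn_last b rw2; rewrite /p1 /= rev_cons last_rcons => lb.
    by rewrite lastI rev_rcons lb; exists (rev (belast a w2)).
  have la : last b (rev (a :: w2)) = a by rewrite rev_cons last_rcons.
  case: hd => w3 E; rewrite E in s2 pe2 la *.
  have bJ : b \notin J j by apply: nJ; rewrite inE eqxx.
  have fin o : infix (Jo (j, o)) (b :: w3) -> good (j, o) a.
    have bJo : b \notin Jo (j, o) by rewrite /Jo /=; case: (o); rewrite ?mem_rev.
    move=> /infixP[X0 [Y' EX]]; split => //; case: X0 EX => [|c X'] EX.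
      have : 0 < size (Jo (j, o)) by rewrite /Jo /=; case: (o); rewrite ?size_rev sJ; move: l16 t0; clear; lia.
      by case E2: (Jo (j, o)) EX bJo => [|d Jd] // [<- _]; rewrite inE eqxx.
    case: EX => EX1 EX; exists X', Y'; rewrite cat_cons -EX; split => //.
  by case/orP=> h; [exists (j, false)|exists (j, true)]; apply: fin.
pose F jo : {set V} := [set a | `[< good jo a >]].
(* The [4 * r * t] ends are distributed over [2 * r] pairs of a segment and an orientation. *)
have [jo big] : exists jo, 2 * t <= #|F jo|.
  apply: contrapT => /forallNP no; have := @pigeon_card _ _ S F (2 * t).-1.
  rewrite card_prod card_ord card_bool => H.
  have /H : forall x, x \in S -> exists i, x \in F i.
    by move=> x /cover[jo g]; exists jo; rewrite inE; apply/asboolP.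
  have h2 : forall i, #|F i| <= (2 * t).-1.
    by move=> i; have /negP := no i; rewrite -ltnNge; clear; lia.
  move/(_ h2) => le; have {}le := leq_trans hg le.
  have : r * 2 * (2 * t).-1 < r * 2 * (2 * t).
    by rewrite ltn_pmul2l; [move: t0; clear; lia|rewrite muln_gt0 r0].
  by move: le; clear; nia.
have [a0 a0F] : exists a, a \in F jo.
  by apply/set0Pn; rewrite -card_gt0; apply: leq_trans big; rewrite muln_gt0 t0.
have [bJ _] : good jo a0 by move: a0F; rewrite inE => /asboolP.
set Jx := Jo jo in bJ.
have [KJ I2 clos] := hK jo.1; set Kx := K jo.1 in KJ I2 clos.
have memJ x : (x \in Jx) = (x \in J jo.1) by rewrite /Jx /Jo; case: (jo.2); rewrite ?mem_rev.
have adjJ u v : adjb Jx u v = adjb (J jo.1) u v by rewrite /Jx /Jo; case: (jo.2); rewrite ?adjb_rev.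
have uJx : uniq (b :: Jx).
  by rewrite cons_uniq bJ /Jx /Jo; case: (jo.2); rewrite ?rev_uniq uJ.
(* New heads stay in the core, and no edge at [b] is broken, because the actual paths may have
   further vertices between [b] and the segment. *)
pose KK (y x : V) := y \in Kx /\ x != b.
have Kb y x : KK y x -> y != b /\ x != b.
  by case=> /KJ yJ ->; split => //; apply: contraNneq bJ => <-; rewrite memJ.
have [c [i Ec] cm] : exists2 c, (exists i, c = #|heads G KK (b :: Jx) i|) & forall j, (exists i, j = #|heads G KK (b :: Jx) i|) -> j <= c.
  apply: (@ex_max_nat _ #|V|); first by exists #|heads G KK (b :: Jx) 0|, 0.
  by move=> j [i ->]; apply: max_card.
set H := heads G KK (b :: Jx) i in Ec.
have stab k : heads G KK (b :: Jx) k \subset H.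
  have [ki|ik] := leqP k i; first exact: heads_mono.
  have /eqP-> // : H == heads G KK (b :: Jx) k.
  by rewrite eqEcard heads_mono ?(ltnW ik) //= -Ec; apply: cm; exists k.
have innadj (W : {set V}) u v : W \subset Kx -> v \in inner (J jo.1) W -> adjb (b :: Jx) u v -> u \in W.
  move=> WK /innerP[vW vh vl vu]; rewrite /adjb /=.
  have vJ : v \in J jo.1 by apply: KJ; apply: (subsetP WK).
  have vb : v != b by apply: contraNneq bJ => <-; rewrite memJ.
  have vhx : v <> head v Jx.
    rewrite /Jx /Jo; case: (jo.2) => //.
    by move=> vE; apply: vl; rewrite vE; case/lastP: (J jo.1) => [|J' z] //; rewrite rev_rcons last_rcons.
  move=> uv; apply: vu; rewrite -adjJ /adjb; move: uv.
  move: (adjs Jx u v) (adjs Jx v u) => P Q; case: (Jx) vhx => [|d Jd] //= vhx.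
  case/orP=> /orP[/andP[/eqP e1 /eqP e2]|->]; rewrite ?orbT //.
    by case: vhx.
  by rewrite e1 eqxx in vb.
have step y v (W : {set V}) : y \in H -> W \subset Kx -> v \in inner (J jo.1) W -> G y v -> v \notin H ->
    exists2 u, u \in H & u \in W.
  move=> yH WK vI g vH; have [vW _ _ _] := innerP _ _ _ vI.
  have vJ : v \in Jx by rewrite memJ; apply: KJ; apply: (subsetP WK).
  case/headsP: yH => w2 rw2.
  have vp : v \in b :: Jx by rewrite inE vJ orbT.
  have Kv u : adjb (b :: Jx) u v -> KK u v.
    move=> uv; split; first by apply: (subsetP WK); apply: innadj uv.
    by apply: contraNneq bJ => <-.
  have [u uh uv] := posa_step uJx rw2 vp vH g Kv.
  by exists u; [apply: (subsetP (stab i.+1))|apply: innadj uv].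
pose T := H :&: Kx.
have bH : b \in H by apply: (subsetP (stab 0)); apply/headsP; exists Jx; apply: rotn0.
have T0 : T != set0.
  have bX : b \in X by apply: pX; rewrite (perm_mem pw) inE eqxx.
  have := bgood jo.1; rewrite inE bX /= => /forallPn[v]; rewrite negb_imply negbK => /andP[vI g].
  have [vH|vH] := boolP (v \in H).
    by apply/set0Pn; exists v; rewrite in_setI vH; case/innerP: vI.
  have [u uH uK] := step b v Kx bH (subxx _) vI g vH.
  by apply/set0Pn; exists u; rewrite in_setI uH.
(* If [T] were small, the core would give an edge from [T] to an inner vertex outside, and rotating
   there would produce a core head outside [T], against stability. *)
have Tt : t < #|T|.
  rewrite ltnNge; apply/negP => Tt; have [a [v [aT vI g]]] := clos T (subsetIr _ _) T0 Tt.
  have aH : a \in H by move: aT; rewrite in_setI => /andP[].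
  have vH : v \notin H.
    case/innerP: vI => + _ _ _; rewrite in_setD in_setI => /andP[+ vK].
    by rewrite vK andbT.
  have [u uH] := step a v _ aH (subsetDl _ _) vI g vH.
  by rewrite in_setD in_setI uH /= => /andP[/negP].
have [S1 S1T cS1] := subset_card_eq (ltnW Tt).
have FX : F jo \subset X.
  apply/subsetP => a; rewrite inE => /asboolP[_ [X' [Y' [_ pe <-]]]]; apply: pX.
  by rewrite -(perm_mem pe) cat_cons /=; apply: mem_last.
(* With [S1] removed from the ends, the failure of [nadj] is an edge and not a common vertex. *)
have : ~~ nadj G S1 (F jo :\: S1).
  apply: joined.
  - by apply: subset_trans S1T _; apply/subsetP => x; rewrite in_setI => /andP[_ /KJ/JX].
  - exact: subset_trans (subsetDl _ _) FX.
  - by rewrite cS1.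
  - by have := cardsID S1 (F jo); have := subset_leq_card (subsetIr (F jo) S1); move: big cS1; clear; lia.
move/forall_inPn => [s sS1 /forall_inPn[a]]; rewrite in_setD negb_and negbK => /andP[aS aF] sa.
have g : G s a.
  by case/orP: sa => [/eqP sa|/negPn//]; rewrite -sa sS1 in aS.
have : s \in H by have := subsetP S1T _ sS1; rewrite in_setI => /andP[].
case/headsP=> w4 /(token_realize Gs uJx Kb)[q1 [q2' [o [Eq ho real]]]].
move: aF; rewrite inE => /asboolP[_ [X' [Y' [s5 pe5 la]]]].
have [s6 pe6 l6] := real X' Y' s5.
have sq1 : q1 <> [::].
  move=> q10; move: Eq; rewrite q10 => -[sb _]; have := subsetP S1T _ sS1.
  by rewrite in_setI => /andP[_ /KJ]; rewrite -memJ sb (negbTE bJ).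
exists (q1 ++ tok b o X' ++ q2' ++ Y'); first exact: perm_trans pe6 pe5.
have {}l6 := l6 b; rewrite la in l6.
case Eq1: q1 sq1 Eq s6 l6 => [|s' q1'] // _ [Es Ew4] s6 l6; rewrite -Es in s6 l6 *.
by move: s6 l6; rewrite cat_cons cycle_consG /= => -> ->; rewrite Gs.
Qed.

(** The cycle on a longest path has no edge leaving it inside [X], since this would give a longer
    path. If it missed a vertex, it and its complement would have no outside neighbours, hence at
    least [t] vertices each by expansion, against joinedness. *)
Lemma joined_hamiltonian : X != set0 -> exists c, [/\ cycle G c, uniq c & size c = #|X|].
Proof.
move=> X0; pose Q m := exists p, [/\ uniq p, sorted G p, {subset p <= X} & size p = m].
have [||m [p [up sp pX pm]] mx] := @ex_max_nat Q #|V|.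
- by exists 0, [::].
- by move=> i [p [up _ _ <-]]; rewrite -(card_uniqP up) max_card.
have lp : longest p.
  split => //; first rewrite pm; last by move=> p' u' s' x'; rewrite pm; apply: mx; exists p'.
  by case/set0Pn: X0 => x xX; apply: mx; exists [:: x]; split => // y; rewrite inE => /eqP->.
have [c pc cc] := longest_closes lp.
have uc : uniq c by rewrite (perm_uniq pc).
exists c; split => //; rewrite (perm_size pc) -(card_uniqP up) -[#|p|]cardsE.
apply/eqP; rewrite eqn_leq subset_leq_card /=; last by apply/subsetP => x; rewrite inE; apply: pX.
rewrite leqNgt; apply/negP => lt; set P := [set x in p] in lt.
have PX : P \subset X by apply/subsetP => x; rewrite inE; apply: pX.
have [x [v [xP vX vP g]]] : exists x v, [/\ x \in P, v \in X, v \notin P & G x v].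
  apply: contrapT => no.
  have D0 : X :\: P != set0.
    by rewrite -card_gt0 cardsD (setIidPr PX) subn_gt0.
  have P0 : P != set0.
    by rewrite /P; case: (p) lp => [[]//|y p' _]; apply/set0Pn; exists y; rewrite !inE eqxx.
  have big (A : {set V}) : A \subset X -> A != set0 -> (forall a v, a \in A -> v \in X -> v \notin A -> ~~ G a v) -> t <= #|A|.
    move=> AX A0 nA; rewrite leqNgt; apply/negP => At.
    have : 4 * #|A| <= #|ext G A X|.
      apply: expand => //; apply: leq_trans (ltnW At) _; rewrite leq_pmull // muln_gt0 /= rq addn2 //.
    rewrite (_ : ext G A X = set0) ?cards0; first by move: A0; rewrite -card_gt0; clear; lia.
    apply/setP => v; rewrite in_set0; apply/negP; rewrite in_setD in_setI => /and3P[vA /nbP[a aA g] vX].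
    by have := nA a v aA vX vA; rewrite g.
  have : ~~ nadj G P (X :\: P).
    apply: joined => //; first exact: subsetDl.
      by apply: big => // a v aP vX vP; apply/negP => g; apply: no; exists a, v.
    apply: big => //; first exact: subsetDl.
    move=> a v; rewrite !in_setD => /andP[aP aX] vX; rewrite vX andbT negbK => vP.
    by apply/negP => g; apply: no; exists v, a; rewrite Gs.
  case/negP; apply/nadjP => a v aP; rewrite in_setD => /andP[vP vX]; split.
    by move=> av; rewrite -av aP in vP.
  by apply/negP => g; apply: no; exists a, v.
have xc : x \in c by rewrite (perm_mem pc); move: xP; rewrite inE.
have [k c' Ec] := rot_to xc.
case/negP: vP; rewrite inE; apply: (longest_nb lp _ _ g vX (w := c')).
  by rewrite perm_sym -Ec; apply: perm_trans pc; rewrite perm_rot.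
by apply: cycle_sorted; rewrite -Ec rot_cycle.
Qed.

End Hamilton.

(** * Disjoint stars and completion to exactly [n] vertices *)

Section Packing.
Variables (V : finType) (G : rel V).
Implicit Types (A B X Y : {set V}).

Definition packing X B (f : V -> {set V}) :=
  [/\ [disjoint B & X], forall s, s \in B -> f s \subset nb G [set s] :&: X,
      forall s, s \in B -> #|f s| = 10 &
      forall s s', s \in B -> s' \in B -> s != s' -> [disjoint f s & f s']].

Lemma packing_card X B f A : packing X B f -> A \subset B -> #|\bigcup_(s in A) f s| = 10 * #|A|.
Proof.
move=> [_ _ c10 dj]; have [N] := ubnP #|A|; elim: N A => // N IH A ltN AB.
have [->|[s sA]] := set_0Vmem A; first by rewrite big_set0 !cards0.
rewrite (big_setD1 s) //= cardsU (_ : _ :&: _ = set0); last first.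
  apply/setP => x; rewrite in_set0 in_setI; apply/negP => /andP[xs /bigcupP[s']].
  rewrite in_setD1 => /andP[ss' s'A]; apply/negP.
  by rewrite (disjointFr (dj s s' _ _ _) xs) // ?(subsetP AB) // eq_sym.
have lt : #|A :\ s| < #|A| by rewrite (cardsD1 s A) sA.
rewrite cards0 subn0 IH ?c10 ?(subsetP AB) //.
- by rewrite (cardsD1 s A) sA; clear; lia.
- by move: lt ltN; clear; lia.
- exact: subset_trans (subsetDl _ _) AB.
Qed.

Lemma max_packing X d : exists B f, [/\ packing X B f, #|B| <= d &
  #|B| = d \/ #|B| < d /\ forall v, v \notin X :|: B -> #|(nb G [set v] :&: X) :\: \bigcup_(s in B) f s| < 10].
Proof.
have [|B [cB [f pk]] mx] := @ex_maxcard _ (fun B => #|B| <= d /\ exists f, packing X B f).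
  exists set0; rewrite cards0; split => //; exists (fun _ => set0); split => [|s|s|s]; rewrite ?inE //.
  by rewrite disjoint_subset; apply/subsetP => x; rewrite inE.
exists B, f; split => //; have [eq|neq] := eqVneq #|B| d; [by left|right].
split; first by rewrite ltn_neqAle neq.
move=> v; rewrite in_setU negb_or => /andP[vX vB]; rewrite ltnNge; apply/negP => /subset_card_eq[L LS cL].
have [dB fN f10 dj] := pk.
have cvB : #|v |: B| = #|B|.+1 by rewrite cardsU1 vB.
suff /mx : #|v |: B| <= d /\ exists f, packing X (v |: B) f by rewrite cvB ltnn.
split; first by rewrite cvB ltn_neqAle neq.
exists (fun s => if s == v then L else f s).
have neqv s : s \in B -> (s == v) = false by move=> sB; apply: contraNF vB => /eqP <-.
have dL s : s \in B -> [disjoint L & f s].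
  move=> sB; rewrite disjoint_subset; apply/subsetP => x /(subsetP LS).
  rewrite in_setD => /andP[nx _]; rewrite inE; apply: contra nx => xs; by apply/bigcupP; exists s.
split.
- rewrite disjoint_subset; apply/subsetP => x; rewrite in_setU1 inE => /orP[/eqP->//|xB].
  by rewrite (disjointFr dB xB).
- move=> s; rewrite in_setU1 => /orP[/eqP->|sB]; rewrite ?eqxx ?neqv //; last exact: fN.
  exact: subset_trans LS (subsetDl _ _).
- by move=> s; rewrite in_setU1 => /orP[/eqP->|sB]; rewrite ?eqxx ?neqv //; apply: f10.
move=> s s'; rewrite !in_setU1 => /orP[/eqP->|sB] /orP[/eqP->|s'B] ss'.
- by rewrite eqxx in ss'.
- by rewrite eqxx neqv //; apply: dL.
- by rewrite eqxx neqv // disjoint_sym; apply: dL.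
- by rewrite !neqv //; apply: dj.
Qed.

End Packing.

Section CoreTheorem.
Variables (V : finType) (G : rel V).
Hypothesis Gs : symmetric G.
Hypothesis Gi : irreflexive G.
Variables (n M h : nat).
Hypothesis M0 : 0 < M.
Hypothesis h0 : 0 < h.
Hypothesis hM : M <= 2 ^ h.
Hypothesis h2M : 2 ^ h <= 2 * M.
Hypothesis hn : 1000 * (1000 * (10 * (M * (h.+1 * h.+1)))) <= n.
Hypothesis nV : n <= #|V|.
Hypothesis alpha : forall A : {set V}, indep G A -> #|A| < M.
Hypothesis P2 : forall A : {set V}, M <= #|A| -> n <= #|cn G A|.
Hypothesis P22 : forall A B : {set V}, nadj G A B ->
  M <= #|A| -> M <= #|B| -> 2 * n <= #|cn G (A :|: B)| + 2.
Hypothesis star : forall Y : {set V}, #|V| < #|Y| + n -> exists U : {set V},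
  [/\ U \subset Y, #|U| <= M & forall A : {set V}, M <= #|A| -> ~~ nadj G A U].

Theorem expanding_cycle : exists c, [/\ cycle G c, uniq c & size c = n].
Proof.
pose w := M * h.+1; pose g := 300 * M * h.+1.
have gE : g = 300 * w by rewrite /g mulnA.
have wh : w <= M * (h.+1 * h.+1) by rewrite mulnA leq_pmulr.
have Mw : M <= w by rewrite leq_pmulr.
have gn : 200 * g <= n by move: hn gE wh; clear; lia.
have [//|[X [cX Xn jX]]] := cycle_or_joined Gs Gi M0 h0 hM h2M gn nV alpha P2 P22.
rewrite -/g in cX.
have far (Y A : {set V}) : Y \subset X -> A \subset Y -> M <= #|A| -> #|Y| < #|ext G A Y| + #|A| + M.
  move=> YX AY AM; rewrite ltnNge; apply/negP => le.
  have : nadj G A (Y :\: cn G A).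
    by rewrite nadj_cn disjoint_subset; apply/subsetP => x; rewrite in_setD => /andP[nx _]; exact: nx.
  move/jX; apply => //; first exact: subset_trans AY YX.
    exact: subset_trans (subsetDl _ _) YX.
  have := cardsID (cn G A) Y.
  have E : Y :&: cn G A = A :|: ext G A Y.
    apply/setP => x; rewrite /cn /ext in_setI !in_setU in_setD in_setI.
    have [xA|xA] := boolP (x \in A); first by rewrite (subsetP AY).
    by rewrite /= andbC.
  rewrite E; have := cardUle A (ext G A Y); move: le; clear; lia.
have [|X0 [X0X cX0 exp0]] := @clean_set _ G 10 M X.
  move=> B BX /andP[B1 B2]; have := far X B (subxx _) BX B1.
  by move: B2 cX gn gE Mw M0; clear; lia.
have sX0 : #|X| <= #|X0| + M.
  by have := cardsID X0 X; rewrite (setIidPr X0X); move: cX0; clear; lia.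
have X0n : #|X0| < n by apply: leq_ltn_trans (subset_leq_card X0X) Xn.
have exp1 (A : {set V}) : A \subset X0 -> 20 * #|A| <= n -> 10 * #|A| <= #|ext G A X0|.
  move=> AX A20; have [AM|MA] := leqP #|A| M.
    have [->|A0] := eqVneq A set0; first by rewrite cards0.
    exact: ltnW (exp0 A AX A0 AM).
  have := far X0 A X0X AX (ltnW MA); move: A20 sX0 cX gn gE Mw M0; clear; lia.
pose d := n - #|X0|.
have d3 : d <= 3 * g by move: cX sX0 Mw gE; rewrite /d; clear; lia.
have [B [f [pk cB alt]]] := max_packing G X0 d.
have [dB fN f10 dj] := pk.
(* [t] is at least [d + M], so a set of [t] vertices keeps [M] in [X0]. For [2 ^ q >= 4 * r * t]:
   [r] is at most [42 * 2 ^ h] and [w] at most [2 ^ h * 2 ^ h], whence [3 * h], and [2 ^ 20] covers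
   the constants. *)
pose t := 4 * g; pose q := 3 * h + 20; pose r := 2 * q + 2.
have t1 : 20 * (4 * r * t) <= n.
  have e1 : 4 * r * t = 4800 * (r * w) by rewrite /t gE; clear; nia.
  have e2 : r * w <= 42 * (M * (h.+1 * h.+1)).
    have r42 : r <= 42 * h.+1 by rewrite /r /q; clear; lia.
    apply: (@leq_trans (42 * h.+1 * w)); first by rewrite leq_mul2r r42 orbT.
    by rewrite /w; clear; nia.
  by rewrite e1; move: e2 hn; clear; lia.
have t2 : 4 * r * t <= 2 ^ q.
  have e1 : 4 * r * t = 4800 * (r * w) by rewrite /t gE; clear; nia.
  have hh : h.+1 <= 2 ^ h by apply: ltn_expl.
  have e2 : r <= 42 * 2 ^ h by rewrite /r /q; move: hh; clear; lia.
  have e3 : w <= 2 ^ h * 2 ^ h by rewrite /w; apply: leq_mul.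
  have e4 : r * w <= 42 * 2 ^ h * (2 ^ h * 2 ^ h) by apply: leq_mul.
  have e5 : 2 ^ q = 1024 * (1024 * (2 ^ h * (2 ^ h * 2 ^ h))).
    rewrite /q expnD (_ : 3 * h = h + (h + h)) ?expnD; last by clear; lia.
    by rewrite (_ : 20 = 10 + 10) // expnD (_ : 2 ^ 10 = 1024) //; clear; lia.
  by rewrite e1 e5; move: e4; rewrite -!mulnA; clear; lia.
(* If the stars run out, the set [U] given by [star] sees in [X0] only leaves already used and at
   most ten more per vertex; the rest of [X0] is a large set nonadjacent to [U]. *)
case: alt => [Bd|[Bd small]]; last first.
  exfalso; pose Y := ~: (X0 :|: B).
  have cY : #|V| < #|Y| + n.
    have := cardsC (X0 :|: B); rewrite -/Y => <-; rewrite addnC ltn_add2l.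
    by apply: leq_ltn_trans (cardUle _ _) _; move: cB Bd X0n; rewrite /d; clear; lia.
  have [U [UY UM nU]] := star cY.
  pose LL := \bigcup_(s in B) f s.
  have cL : #|LL| = 10 * #|B| := packing_card pk (subxx _).
  have cN (W : {set V}) : W \subset Y -> #|(nb G W :&: X0) :\: LL| <= 10 * #|W|.
    have [N] := ubnP #|W|; elim: N W => // N IH W ltN WY.
    have [->|[v vW]] := set_0Vmem W; first by rewrite nb0 set0I set0D cards0.
    have E : W = [set v] :|: (W :\ v) by rewrite setD1K.
    have lt : #|W| = (#|W :\ v|).+1 by rewrite (cardsD1 v W) vW.
    rewrite {1}E nbU setIUl setDUl; apply: leq_trans (cardUle _ _) _.
    rewrite lt mulnS; apply: leq_add.
      apply: ltnW; apply: small; have := subsetP WY _ vW; by rewrite inE.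
    apply: IH; first by move: ltN; rewrite lt; clear; lia.
    exact: subset_trans (subsetDl _ _) WY.
  pose A := X0 :\: nb G U.
  have AM : M <= #|A|.
    have e1 := cardsID (nb G U) X0; have e2 := cN U UY.
    have e3 : #|X0 :&: nb G U| <= #|LL| + #|(nb G U :&: X0) :\: LL|.
      rewrite setIC -(cardsID LL (nb G U :&: X0)) leq_add2r.
      exact: subset_leq_card (subsetIr _ _).
    move: e1 e2 e3 cL cB d3 UM sX0 cX gn gE Mw M0; rewrite -/A; clear; lia.
  have /negP[] := nU A AM; apply/nadjP => x y xA yU.
  move: xA; rewrite in_setD => /andP[xN xX]; split.
    by move=> xy; have := subsetP UY _ yU; rewrite -xy inE in_setU xX.
  by apply: contra xN => gxy; apply/nbP; exists y; rewrite // Gs.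
have XB0 : X0 :&: B = set0 by apply/eqP; rewrite setIC setI_eq0.
pose XX := X0 :|: B.
have cXX : #|XX| = n by rewrite /XX cardsU XB0 cards0 subn0 Bd /d subnKC // ltnW.
have XXs (A : {set V}) : A \subset XX -> #|A| <= #|A :&: X0| + #|A :&: B|.
  move=> AX; apply: leq_trans (cardUle _ _); rewrite -setIUr (setIidPl AX) //.
have := @joined_hamiltonian _ G Gs XX t q r; rewrite cXX; apply => //.
- by rewrite /t gE; move: M0 Mw; clear; lia.
(* Both parts of [A] expand tenfold into [X0], except that leaves of [A1] may lie in [A0]; the two
   bounds together still give a factor above four. *)
- move=> A AX _ At; pose A0 := A :&: X0; pose A1 := A :&: B.
  have c0 : #|A| <= #|A0| + #|A1| := XXs A AX.
  have A0A : #|A0| <= #|A| by apply: subset_leq_card; apply: subsetIl.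
  have ex0 : 10 * #|A0| <= #|ext G A0 X0|.
    by apply: exp1; [exact: subsetIr|move: At A0A t1; clear; lia].
  have i0 : #|ext G A0 X0| <= #|ext G A XX|.
    apply: subset_leq_card; apply/subsetP => x; rewrite /ext !in_setD !in_setI in_setU => /and3P[nA xN xX].
    rewrite xX /= andbT; move: nA; rewrite xX andbT => ->.
    by rewrite (subsetP (nbS G (subsetIl A X0))).
  have i1 : 10 * #|A1| <= #|ext G A XX| + #|A0|.
    rewrite -(packing_card pk (subsetIr A B)); apply: leq_trans (cardUle _ _).
    apply: subset_leq_card; apply/subsetP => x /bigcupP[s]; rewrite in_setI => /andP[sA sB] xs.
    have := subsetP (fN s sB) _ xs; rewrite in_setI => /andP[xN xX].
    rewrite in_setU /ext in_setD !in_setI in_setU xX /= andbT.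
    have -> : x \in nb G A by apply: (subsetP (nbS G _)) xN; rewrite sub1set.
    by rewrite !andbT orNb.
  move: c0 ex0 i0 i1; clear; lia.
- move=> A C AX CX At Ct; apply/negP => nAC.
  have sub (D : {set V}) : D \subset XX -> t <= #|D| -> M <= #|D :&: X0|.
    move=> DX Dt; have := XXs D DX; have := subset_leq_card (subsetIr D B).
    by move: Dt d3 gE Mw Bd; rewrite /t; clear; lia.
  apply: (jX (A :&: X0) (C :&: X0)); try exact: sub.
  - exact: subset_trans (subsetIr _ _) X0X.
  - exact: subset_trans (subsetIr _ _) X0X.
  - by apply: nadjS nAC; apply: subsetIl.
- by rewrite -card_gt0 cXX; apply: leq_ltn_trans X0n.
Qed.

End CoreTheorem.

(** * Upper bound *)

Section Systems.
Variables (V : finType) (G : rel V).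
Implicit Types (A B U W : {set V}) (l : seq nat).

(* Equivalently, the complement of [G] contains the complete multipartite graph with part
   sizes [l] inside [W]. *)
Fixpoint sys W l : Prop := if l is a :: l' then
  exists A, [/\ A \subset W, #|A| = a & sys (W :\: cn G A) l'] else True.

Lemma sysS W W' l : W \subset W' -> sys W l -> sys W' l.
Proof.
elim: l W W' => [|a l IH] W W' //= sW [A [AW cA sA]]; exists A; split => //.
  exact: subset_trans AW sW.
by apply: IH sA; apply: setSD.
Qed.

Lemma sys_cons W A a l : a <= #|A| -> A \subset W -> sys (W :\: cn G A) l -> sys W (a :: l).
Proof.
move=> /subset_card_eq[A' A'A cA'] AW sA; exists A'; split => //.
  exact: subset_trans A'A AW.
by apply: sysS sA; apply: setDS; apply: cnS.
Qed.

(** The union of the parts; it becomes the set [U] in the hypothesis [star]. *)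
Lemma sys_span W l : sys W l -> exists U, [/\ U \subset W, #|U| <= sumn l & sys U l].
Proof.
elim: l W => [|a l IH] W /=; first by move=> _; exists set0; rewrite sub0set cards0.
move=> [A [AW cA /IH[U [UW cU sU]]]]; exists (A :|: U); split.
- by rewrite subUset AW (subset_trans UW) // subsetDl.
- by rewrite -cA; apply: cardU_le.
exists A; split => //; first exact: subsetUl.
apply: sysS sU; apply/subsetP => x xU; rewrite in_setD in_setU xU orbT andbT.
by have := subsetP UW _ xU; rewrite in_setD => /andP[].
Qed.

Lemma sys_indep W l : indep G W -> sumn l <= #|W| -> sys W l.
Proof.
elim: l W => [|a l IH] W //= iW le.
have [A AW cA] : exists2 A : {set V}, A \subset W & #|A| = a by apply: subset_card_eq; move: le; clear; lia.
exists A; split => //; apply: (@sysS (W :\: A)).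
  apply/subsetP => x; rewrite !in_setD /cn in_setU negb_or => /andP[-> xW]; rewrite xW !andbT /=.
  by apply/negP => /nbP[y yA g]; have := iW y x (subsetP AW _ yA) xW; rewrite g.
apply: IH; first by move=> x y; rewrite !in_setD => /andP[_ xW] /andP[_ yW]; apply: iW.
by rewrite cardsD (setIidPr AW) cA; move: le; clear; lia.
Qed.

End Systems.

Section Induced.
Variables (V : finType) (G : rel V) (W : {set V}).
Let T := {x : V | x \in W}.
Definition induced : rel T := fun x y => G (val x) (val y).

Lemma cn_val (A : {set T}) x : val x \in cn G (val @: A) -> x \in cn induced A.
Proof.
rewrite /cn !in_setU => /orP[/imsetP[y yA /val_inj->]|/nbP[z /imsetP[y yA ->] g]]; first by rewrite yA.
by rewrite orbC; apply/orP; left; apply/nbP; exists y.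
Qed.

Lemma sys_val (U : {set T}) l : sys induced U l -> sys G (val @: U) l.
Proof.
elim: l U => [|a l IH] U //= [A [AU cA /IH sA]]; exists (val @: A); split.
- exact: imsetS.
- by rewrite card_imset //; apply: val_inj.
apply: sysS sA; apply/subsetP => x /imsetP[y /setDP[yU yn] ->].
rewrite in_setD (imset_f val yU) andbT; apply: contra yn; exact: cn_val.
Qed.

Lemma cycle_val c : cycle induced c -> cycle G (map val c).
Proof. by rewrite cycle_map. Qed.

Lemma card_induced : #|{: T}| = #|W|.
Proof. by rewrite card_sig; apply: eq_card => x; rewrite inE. Qed.

End Induced.

Section UpperBound.
Variables (n M h : nat).
Hypothesis M0 : 0 < M.
Hypothesis h0 : 0 < h.
Hypothesis hM : M <= 2 ^ h.
Hypothesis h2M : 2 ^ h <= 2 * M.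
Hypothesis hn : 1000 * (1000 * (10 * (M * (h.+1 * h.+1)))) <= n.

Definition has_cycle (V : finType) (G : rel V) := exists c, [/\ cycle G c, uniq c & size c = n].

(** If a hypothesis of [expanding_cycle] fails, parts can be split off: deleting the closed
    neighbourhood of a violating set costs at most [n.-1] vertices for one part, or [2 * n - 3] for
    two, so the induction finds the other parts in what is left. *)
Lemma upper_bound (V : finType) (G : rel V) (ms : seq nat) s : symmetric G -> irreflexive G ->
  0 < s -> sumn ms + s <= M -> size ms * n.-1 + s <= #|V| -> has_cycle G \/ sys G setT (rcons ms s).
Proof.
have [N] := ubnP (size ms); elim: N V G ms => // N IH V G ms ltN Gs Gi s0 sM cV.
have IHW (W : {set V}) ms' : size ms' < size ms -> sumn ms' + s <= M -> size ms' * n.-1 + s <= #|W| ->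
    has_cycle G \/ sys G W (rcons ms' s).
  move=> lt sm cW; case: (IH _ (induced G (W := W)) ms').
  - by move: lt ltN; clear; lia.
  - by move=> x y; apply: Gs.
  - by move=> x; apply: Gi.
  - by [].
  - by [].
  - by rewrite card_induced.
  - move=> [c [cc uc sc]]; left; exists (map val c); split.
    + exact: cycle_val.
    + by rewrite map_inj_uniq //; apply: val_inj.
    + by rewrite size_map.
  move/sys_val => sW; right; apply: sysS sW; apply/subsetP => x /imsetP[y _ ->]; exact: valP.
case: ms ltN sM cV IHW => [|m ms] ltN sM cV IHW.
  right; have [A _ cA] : exists2 A : {set V}, A \subset setT & #|A| = s.
    by apply: subset_card_eq; rewrite cardsT; move: cV; rewrite mul0n.
  by exists A; split => //; apply: subsetT.
apply: contrapT => /not_orP[noC noS].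
have {}IHW (W : {set V}) ms' : size ms' <= size ms -> sumn ms' + s <= M -> size ms' * n.-1 + s <= #|W| -> sys G W (rcons ms' s).
  by move=> h1 h2 h3; case: (IHW W ms') => // /noC.
have mM : m + sumn ms + s <= M by [].
have cV' : n.-1 + size ms * n.-1 + s <= #|V| by move: cV; rewrite /= mulSn.
have n0 : 0 < n.
  apply: leq_trans hn; rewrite !muln_gt0 M0 //.
apply: noC; apply: (@expanding_cycle V G Gs Gi n M h) => //.
- by move: cV' s0 n0; clear; lia.
- move=> A iA; rewrite ltnNge; apply/negP => AM; apply: noS; apply: (@sysS _ _ A); first exact: subsetT.
  apply: sys_indep => //; apply: leq_trans AM; apply: leq_trans sM.
  by rewrite sumn_rcons.
- move=> A AM; rewrite leqNgt; apply/negP => lt; apply: noS.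
  apply: (sys_cons (A := A)) => //; first by move: mM AM; clear; lia.
  apply: IHW => //; first by move: mM; clear; lia.
  by rewrite setTD; have := cardsC (cn G A); move: cV' lt n0; clear; lia.
- move=> A B nAB AM BM; rewrite leqNgt; apply/negP => lt; apply: noS.
  apply: (sys_cons (A := A)) => //; first by move: mM AM; clear; lia.
  have BA : B \subset [set: V] :\: cn G A.
    apply/subsetP => x xB; rewrite in_setD in_setT andbT.
    by move: nAB; rewrite nadj_cn => /disjointFr ->.
  (* With [ms] empty there are only two parts, and [B] itself serves for [s]. *)
  case: ms ltN sM cV IHW mM cV' => [|m' ms] ltN sM cV IHW mM cV'.
    by apply: (sys_cons (A := B)) => //; move: mM BM; clear; rewrite /=; lia.
  apply: (sys_cons (A := B)) => //; first by move: mM BM; clear; rewrite /=; lia.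
  have -> : [set: V] :\: cn G A :\: cn G B = ~: cn G (A :|: B).
    apply/setP => x; rewrite !in_setD in_setC in_setT andbT /cn nbU !in_setU -!negb_or.
    by case: (x \in A); case: (x \in B); rewrite ?orbT ?orbF //= orbC.
  apply: IHW => //; first by move: mM; clear; rewrite /=; lia.
  by have := cardsC (cn G (A :|: B)); move: cV' lt n0; rewrite /= mulSn; clear; lia.
(* [Y] has room for all parts but the first; a set of [M] vertices nonadjacent to their union would
   supply that one. *)
- move=> Y cY; have sY : sys G Y (rcons ms s).
    by apply: IHW => //; [move: mM; clear; lia|move: cY cV'; clear; lia].
  have [U [UY cU sU]] := sys_span sY; exists U; split => //.
    by apply: leq_trans cU _; rewrite sumn_rcons; move: mM; clear; lia.
  move=> A AM; apply/negP => nAU; apply: noS.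
  apply: (sys_cons (A := A)) => //; first by move: mM AM; clear; lia.
  apply: sysS sU; apply/subsetP => x xU; rewrite in_setD in_setT andbT.
  by move: nAU; rewrite nadj_cn => /disjointFr ->.
Qed.

End UpperBound.

(** * Chromatic number and smallest colour class of a complete multipartite graph *)

Lemma bigminn_le (I : eqType) (r : seq I) (P : pred I) (F : I -> nat) x0 j :
  j \in r -> P j -> \big[minn/x0]_(i <- r | P i) F i <= F j.
Proof.
elim: r => // a r IH; rewrite inE big_cons => /orP[/eqP<- Pj|jr Pj].
  by rewrite Pj geq_minl.
case: ifP => _; last exact: IH.
by apply: leq_trans (geq_minr _ _) _; apply: IH.
Qed.

Lemma bigminn_ge (I : Type) (r : seq I) (P : pred I) (F : I -> nat) x0 m :
  m <= x0 -> (forall i, P i -> m <= F i) -> m <= \big[minn/x0]_(i <- r | P i) F i.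
Proof.
move=> mx mF; elim/big_ind: _ => // a b ma mb.
by rewrite leq_min ma.
Qed.

Section CompleteMultipartite.
Variables (v k : nat) (f : 'I_v -> 'I_k).
Hypothesis fsurj : forall i : 'I_k, exists x : 'I_v, f x = i.

Definition part (i : 'I_k) : {set 'I_v} := [set x | f x == i].

Lemma part_gt0 i : 0 < #|part i|.
Proof. by have [x <-] := fsurj i; rewrite card_gt0; apply/set0Pn; exists x; rewrite inE. Qed.

Lemma sum_part : \sum_(i < k) #|part i| = v.
Proof.
rewrite -[RHS]card_ord -[RHS]sum1_card (partition_big f xpredT) //=.
by apply: eq_bigr => i _; rewrite -sum1_card; apply: eq_bigl => x; rewrite inE.
Qed.

(* Representatives of the parts use up all the colours. *)
Lemma colour_part (c : 'I_v -> 'I_k) : (forall x y, f x != f y -> c x != c y) ->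
  forall i, exists j, forall x, f x = j -> c x = i.
Proof.
move=> cP i; have [rp rpP] := choice fsurj.
have inj : injective (c \o rp).
  move=> a b /= E; apply/eqP; apply: contraT => ab.
  by have := cP (rp a) (rp b); rewrite !rpP E eqxx => /(_ ab).
have [g _ gK] := injF_bij inj.
exists (g i) => x fx; have := gK (c x); rewrite /= => E.
suff : g (c x) = g i by move=> E2; rewrite -(gK i) /= -E2.
apply/eqP; apply: contraT => ne; have := cP (rp (g (c x))) x.
by rewrite rpP fx E eqxx => /(_ ne).
Qed.

Lemma proper_f : proper_col (complete_multipartite f) [ffun x => f x].
Proof. by apply/forallP => x; apply/forallP => y; apply/implyP; rewrite !ffunE. Qed.

Lemma chromatic_parts : chromatic_number (complete_multipartite f) = k.
Proof.
have [rp rpP] := choice fsurj.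
have rinj : injective rp by move=> a b E; rewrite -(rpP a) E rpP.
have kv : k <= v by have := leq_card _ rinj; rewrite !card_ord.
apply/eqP; rewrite eqn_leq; apply/andP; split.
  have kv' : k < #|'I_v|.+1 by rewrite card_ord.
  apply: (@bigminn_le _ _ _ (fun c : 'I_(#|'I_v|.+1) => c : nat) _ (Ordinal kv')).
    by rewrite mem_index_enum.
  by apply/existsP; exists [ffun x => f x]; apply: proper_f.
apply: bigminn_ge; first by rewrite card_ord.
move=> c /existsP[g /forallP gP]; have inj : injective (g \o rp).
  move=> a b /= E; apply/eqP; apply: contraT => ab.
  have /forallP/(_ (rp b))/implyP := gP (rp a); rewrite /complete_multipartite !rpP E eqxx.
  by move/(_ ab).
by have := leq_card _ inj; rewrite !card_ord.
Qed.

(** By [colour_part] every colour class contains a whole part. *)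
Lemma sigma_parts (i0 : 'I_k) : (forall i, #|part i0| <= #|part i|) ->
  sigma_num (complete_multipartite f) = #|part i0|.
Proof.
move=> mn; rewrite /sigma_num chromatic_parts; apply/eqP; rewrite eqn_leq; apply/andP; split.
  apply: leq_trans (@bigminn_le _ _ _ (fun g : {ffun 'I_v -> 'I_k} => \big[minn/#|'I_v|]_(i < k) #|[set x | g x == i]|) _ [ffun x => f x] _ _) _.
  - by rewrite mem_index_enum.
  - exact: proper_f.
  apply: leq_trans (@bigminn_le _ _ _ (fun i => #|[set x | [ffun x0 => f x0] x == i]|) _ i0 _ _) _ => //.
    by rewrite mem_index_enum.
  by apply: subset_leq_card; apply/subsetP => x; rewrite !inE ffunE.
apply: bigminn_ge; first exact: max_card.
move=> g /forallP gP; apply: bigminn_ge; first exact: max_card.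
move=> i _; have [|j hj] := @colour_part g _ i.
  by move=> x y fxy; have /forallP/(_ y)/implyP := gP x; apply.
apply: leq_trans (mn j) _; apply: subset_leq_card; apply/subsetP => x; rewrite !inE => /eqP/hj->.
by [].
Qed.

End CompleteMultipartite.

(** * Copies of cycles and complete multipartite graphs *)

Section Embedding.
Variables (V : finType) (G : rel V).
Hypothesis Gs : symmetric G.

Lemma contains_cycle n c : cycle G c -> uniq c -> size c = n -> 0 < n -> contains (cycle_graph n) G.
Proof.
move=> cc uc sc n0; have [x0 c0] : exists x0, x0 \in c.
  by case: (c) sc n0 => [<-//|x c' _ _]; exists x; rewrite inE eqxx.
have step i : i < n -> G (nth x0 c i) (nth x0 c (i.+1 %% n)).
  move=> ltn; case: c cc uc sc c0 => [|x c] cc uc sc c0; first by move: ltn; rewrite -sc.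
  have := cc => /(pathP x0)/(_ i); rewrite size_rcons -[(size c).+1]/(size (x :: c)) sc => /(_ ltn).
  have E : nth x0 (x :: rcons c x) i = nth x0 (x :: c) i.
    by rewrite -rcons_cons nth_rcons [size _]sc ltn.
  rewrite E nth_rcons; have [lt|ge] := ltnP i.+1 n.
    by rewrite modn_small // (_ : i < size c) //; move: lt; rewrite -sc /= ltnS.
  have eq : i.+1 = n by apply/eqP; rewrite eqn_leq ltn.
  have ic : i = size c by move: sc eq => /= <- [].
  have -> : (i < size c) = false by rewrite ic ltnn.
  by rewrite -ic eqxx eq modnn.
exists (fun i : 'I_n => nth x0 c i); split.
  by move=> i j /eqP; rewrite nth_uniq ?sc // => /eqP/val_inj.
by move=> i j /orP[/eqP->|/eqP->]; [|rewrite Gs]; apply: step.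
Qed.

Lemma sys_family (I : eqType) (W : {set V}) (sz : I -> nat) (s : seq I) : uniq s -> sys G W (map sz s) ->
  exists F : I -> {set V}, [/\ forall i, i \in s -> F i \subset W, forall i, i \in s -> #|F i| = sz i &
    forall i j, i \in s -> j \in s -> i != j -> nadj G (F i) (F j)].
Proof.
elim: s W => [|a s IH] W /=; first by exists (fun _ => set0).
move=> /andP[as_ us] [A [AW cA /(IH _ us)[F [FW cF nF]]]].
have ne i : i \in s -> (i == a) = false by move=> is_; apply: contraNF as_ => /eqP <-.
have nA i : i \in s -> nadj G A (F i).
  move=> is_; rewrite nadj_cn disjoint_subset; apply/subsetP => x /(subsetP (FW i is_)).
  by rewrite in_setD => /andP[nx _]; exact: nx.
exists (fun i => if i == a then A else F i); split.
- move=> i; rewrite inE; case: eqP => //= _ is_; apply: subset_trans (FW i is_) (subsetDl _ _).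
- by move=> i; rewrite inE; case: eqP => [->|] //= _ /cF.
move=> i j; rewrite !inE => /orP[/eqP->|is_] /orP[/eqP->|js_] ij.
- by rewrite eqxx in ij.
- by rewrite eqxx ne //; apply: nA.
- by rewrite eqxx ne // nadjC //; apply: nA.
- by rewrite !ne //; apply: nF.
Qed.

Lemma contains_multipartite v k (f : 'I_v -> 'I_k) (F : 'I_k -> {set V}) :
  (forall i, #|F i| = #|part f i|) -> (forall i j, i != j -> nadj G (F i) (F j)) ->
  contains (complete_multipartite f) (compl G).
Proof.
move=> cF nF; have D x : exists y, y \in F (f x).
  apply/set0Pn; rewrite -card_gt0 cF card_gt0; apply/set0Pn; exists x; by rewrite inE.
have [d dP] := choice D.
pose g x := nth (d x) (enum (F (f x))) (index x (enum (part f (f x)))).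
have lt x : index x (enum (part f (f x))) < size (enum (F (f x))).
  by rewrite -cardE cF cardE index_mem mem_enum inE.
have gF x : g x \in F (f x) by rewrite -mem_enum; apply: mem_nth.
have inj : injective g.
  move=> x y E; have [fxy|fxy] := eqVneq (f x) (f y); last first.
    by have /nadjP/(_ _ _ (gF x) (gF y))[] := nF _ _ fxy.
  move: E; rewrite /g (set_nth_default (d y) (d x)) // fxy => /eqP.
  have ltx := lt x; rewrite fxy in ltx.
  rewrite nth_uniq ?enum_uniq // => /eqP E.
  have xin : x \in enum (part f (f y)) by rewrite mem_enum inE fxy.
  have yin : y \in enum (part f (f y)) by rewrite mem_enum inE.
  by rewrite -(nth_index x xin) E nth_index.
exists g; split => // x y fxy; have /nadjP/(_ _ _ (gF x) (gF y))[/eqP ne ng] := nF _ _ fxy.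
by rewrite /compl ne ng.
Qed.

End Embedding.

(** * Lower bound *)

Section LowerBound.
Variables (n : nat).
Hypothesis n3 : 3 <= n.

(** Blocks of [n.-1] consecutive numbers as disjoint cliques; the last block may be incomplete. *)
Definition clusters N : rel 'I_N := fun x y => (x != y) && (x %/ n.-1 == y %/ n.-1).

Lemma cluster_card (A N w : nat) (T : finType) (g : T -> 'I_N) (S : {set T}) :
  injective g -> (forall x, x \in S -> A <= g x < A + w) -> #|S| <= w.
Proof.
move=> inj gS; have lt x : x \in S -> g x - A < w by move/gS; clear; lia.
have [->|[x0 x0S]] := set_0Vmem S; first by rewrite cards0.
have w0 : 0 < w by have := lt _ x0S; clear; lia.
case: w w0 gS lt => // w _ gS lt.
rewrite -[w.+1]card_ord; have inj' : {in S &, injective (fun x => inord (g x - A) : 'I_w.+1)}.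
  move=> x y xS yS /(congr1 val); rewrite /= !inordK ?lt // => E.
  by apply: inj; apply: val_inj; have := gS _ xS; have := gS _ yS; move: E => /=; clear; lia.
by rewrite -(card_in_imset inj') max_card.
Qed.

Lemma clusters_cycle_free N : ~ contains (cycle_graph n) (@clusters N).
Proof.
move=> [g [inj gE]]; have n1 : 0 < n.-1 by move: n3; clear; lia.
have n0 : 0 < n by move: n3; clear; lia.
pose i0 := Ordinal n0.
have same i (lt : i < n) : g (Ordinal lt) %/ n.-1 = g i0 %/ n.-1.
  elim: i lt => [|i IH] lt; first by congr (g _ %/ _); apply: val_inj.
  rewrite -(IH (ltnW lt)); have /gE : cycle_graph n (Ordinal (ltnW lt)) (Ordinal lt).
    by rewrite /cycle_graph /= modn_small // eqxx.
  by move=> /andP[_ /eqP ->].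
have := @cluster_card (g i0 %/ n.-1 * n.-1) N n.-1 _ g setT inj.
rewrite cardsT card_ord => H; have : n <= n.-1; last by move: n3; clear; lia.
apply: H => x _; have := same x (ltn_ord x); rewrite (_ : Ordinal _ = x); last exact: val_inj.
by move=> <-; rewrite leq_trunc_div -mulSnr ltn_ceil.
Qed.

(** Block numbers form a proper colouring of the embedded graph, so by [colour_part] the last block
    would contain a whole part; but it has fewer than [s] vertices. *)
Lemma clusters_multipartite_free v k (f : 'I_v -> 'I_k) N s : (forall i : 'I_k, exists x : 'I_v, f x = i) ->
  0 < k -> (forall i, s <= #|part f i|) -> s < n -> N < k.-1 * n.-1 + s -> 
  ~ contains (complete_multipartite f) (compl (@clusters N)).
Proof.
move=> fs k0 mn sn ltN [g [inj gE]]; have n1 : 0 < n.-1 by move: n3; clear; lia.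
have ck x : g x %/ n.-1 < k.
  rewrite ltn_divLR //; have := ltn_ord (g x); have : k * n.-1 = k.-1 * n.-1 + n.-1.
    by rewrite -mulSnr prednK.
  by move: ltN sn; clear; lia.
pose c x := Ordinal (ck x).
have kk : k.-1 < k by rewrite prednK.
have cP x y : f x != f y -> c x != c y.
  by move/gE; rewrite /compl /clusters => /andP[ne]; rewrite ne.
have [j hj] := colour_part fs cP (Ordinal kk).
have := @cluster_card (k.-1 * n.-1) N s.-1 _ g (part f j) inj.
move=> H; have {}H : #|part f j| <= s.-1.
  apply: H => x; rewrite inE => /eqP/hj/(congr1 val) /= E.
  have := leq_trunc_div (g x) n.-1; rewrite E; have := ltn_ord (g x); move: ltN; clear; lia.
have := mn j; have := part_gt0 fs j; move: H; clear; lia.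
Qed.

End LowerBound.

Lemma multipartite_good (v k n h : nat) (f : 'I_v -> 'I_k) :
  (forall i : 'I_k, exists x : 'I_v, f x = i) -> 0 < k -> 2 <= v -> 0 < h -> v <= 2 ^ h -> 2 ^ h <= 2 * v ->
  1000 * (1000 * (10 * (v * (h.+1 * h.+1)))) <= n -> is_good n (complete_multipartite f).
Proof.
move=> fs k0 v2 h0 hM h2M hn.
have v0 : 0 < v by move: v2; clear; lia.
have vn : 3 * v <= n.
  apply: leq_trans hn; have : v <= v * (h.+1 * h.+1) by rewrite leq_pmulr.
  by move: (v * (h.+1 * h.+1)) => w; clear; lia.
(* A smallest part goes last, in the role of [s], which makes [sigma_num] the additive term; [i1]
   only starts the minimisation. *)
pose i1 := Ordinal k0; pose i0 := [arg min_(i < i1) #|part f i|].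
have mn i : #|part f i0| <= #|part f i| by rewrite /i0; case: arg_minnP => // j _; apply.
pose sz i := #|part f i|; pose s := rem i0 (enum 'I_k).
have pe : perm_eq (enum 'I_k) (i0 :: s) by apply: perm_to_rem; rewrite mem_enum.
have ss : size s = k.-1 by have := perm_size pe; rewrite size_enum_ord => /(congr1 predn) /= ->.
have us : uniq (rcons s i0) by rewrite rcons_uniq -cons_uniq -(perm_uniq pe) enum_uniq.
have sE : sumn (map sz s) + sz i0 = v.
  have : \sum_(i <- enum 'I_k) sz i = v.
    by rewrite big_enum -[RHS](sum_part f); apply: eq_bigl => i; rewrite inE.
  by rewrite (perm_big _ pe) big_cons /= addnC sumnE big_map.
rewrite /is_good (chromatic_parts fs) (sigma_parts fs mn) !subn1; split.
  move=> G Gi Gs.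
  have := @upper_bound n v h v0 h0 hM h2M hn 'I_(k.-1 * n.-1 + sz i0) G (map sz s) (sz i0) Gs Gi.
  case.
  - exact: part_gt0.
  - by rewrite sE.
  - by rewrite size_map ss card_ord.
  - move=> [c [cc uc sc]]; left; apply: (contains_cycle Gs cc uc sc).
    by move: vn v0; clear; lia.
  rewrite -map_rcons => /(sys_family Gs us)[F [_ cF nF]]; right.
  have ins i : i \in rcons s i0 by rewrite mem_rcons -(perm_mem pe) mem_enum.
  by apply: (contains_multipartite (F := F)) => [i|i j]; [apply: cF|apply: nF].
move=> N' ltN; move=> /(_ (@clusters n N')) H.
have n3 : 3 <= n by move: vn v0; clear; lia.
case: H.
- by move=> x; rewrite /clusters eqxx.
- by move=> x y; rewrite /clusters eq_sym [X in _ && X]eq_sym.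
- exact: clusters_cycle_free.
apply: (clusters_multipartite_free n3 fs k0 mn _ ltN).
apply: (@leq_ltn_trans v); last by move: vn v0; clear; lia.
by have := max_card (part f i0); rewrite card_ord.
Qed.

(** * Real estimates of logarithms and constants *)

Section RealBounds.
Local Open Scope R_scope.

Lemma ln2_ge : / 2 <= ln 2.
Proof.
have h := exp_le_3.
apply: Rnot_lt_le => lt.
have : exp (ln 2) < exp (/ 2) by apply: exp_increasing.
rewrite exp_ln; last lra.
move=> l1; have e : exp (/2) * exp (/2) = exp 1 by rewrite -exp_plus; congr exp; lra.
have : 2 * 2 < exp (/2) * exp (/2) by apply: Rmult_gt_0_lt_compat; lra.
by rewrite e; lra.
Qed.

(** For [k <= 1] the two bounds on [m] contradict each other. *)
Lemma size_bounds (v k : nat) (m : R) : 2 <= m -> m <= INR k ^ 22 -> INR v = m * INR k ->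
  (2 <= v)%N /\ 2 <= INR k.
Proof.
move=> m2 mk vE; have k2 : (2 <= k)%N.
  rewrite leqNgt; apply/negP => k1; move: mk; have : k = 0%N \/ k = 1%N by move: k1; clear; lia.
  case=> ->; first by rewrite [INR 0]/= pow_i; [lra|apply/ltP].
  by rewrite [INR 1]/= pow1; lra.
have k2R : 2 <= INR k by rewrite -[2]/(INR 2); apply: le_INR; apply/leP.
split => //; have v4 : 4 <= INR v by rewrite vE; nra.
by apply/leP; apply: INR_le; rewrite /=; lra.
Qed.

Lemma order_bound (v k : nat) (m : R) : 2 <= INR k -> m <= INR k ^ 22 -> INR v = m * INR k ->
  INR v <= INR k ^ 23.
Proof.
move=> k2 mk ->; rewrite -[INR k ^ 23]/(INR k * INR k ^ 22) Rmult_comm.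
by apply: Rmult_le_compat_l; lra.
Qed.

(** [2 ^ h <= 2 * k ^ 23] and [/ 2 <= ln 2] bound [h.+1] by [2 + 46 * ln k], and [2 <= 4 * ln k]. *)
Lemma log_bound (v k h : nat) : 2 <= INR k -> INR v <= INR k ^ 23 ->
  (2 ^ h <= 2 * v)%N -> INR h.+1 <= 50 * ln (INR k) /\ / 2 <= ln (INR k).
Proof.
move=> k2R vk hv.
have lk : / 2 <= ln (INR k).
  apply: Rle_trans ln2_ge _; case: (Req_dec 2 (INR k)) => [->|ne]; first exact: Rle_refl.
  by apply: Rlt_le; apply: ln_increasing; lra.
split => //.
have hR : 2 ^ h <= 2 * INR v.
  have : INR (2 ^ h)%N <= INR (2 * v)%N by apply: le_INR; apply/leP.
  have -> : INR (2 * v)%N = 2 * INR v by rewrite -[muln 2 v]/(Nat.mul 2 v) mult_INR.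
  have -> // : INR (2 ^ h)%N = 2 ^ h.
  elim: (h) => [|j IH] //; rewrite expnS -[muln 2 _]/(Nat.mul 2 _) mult_INR IH //.
have lnh : INR h * ln 2 <= ln 2 + 23 * ln (INR k).
  have p1 : 0 < 2 ^ h by apply: pow_lt; lra.
  have p2 : 0 < INR k ^ 23 by apply: pow_lt; lra.
  have le : 2 ^ h <= 2 * INR k ^ 23 by lra.
  rewrite -(ln_pow 2 _ h); last lra.
  have -> : 23 * ln (INR k) = ln (INR k ^ 23) by rewrite ln_pow; [rewrite /=; lra|lra].
  rewrite -ln_mult; [|lra|lra].
  case: (Req_dec (2 ^ h) (2 * INR k ^ 23)) => [->|ne]; first exact: Rle_refl.
  by apply: Rlt_le; apply: ln_increasing; lra.
have l2 := ln2_ge; rewrite S_INR.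
have h0 : 0 <= INR h by apply: pos_INR.
have : (INR h - 1) * ln 2 <= 23 * ln (INR k) by lra.
case: (Rle_dec (INR h) 1) => [h1 _|h1 H]; first lra.
have : (INR h - 1) * / 2 <= (INR h - 1) * ln 2 by apply: Rmult_le_compat_l; lra.
by lra.
Qed.

Lemma large_n (v k h n : nat) (m : R) : INR v = m * INR k -> INR h.+1 <= 50 * ln (INR k) ->
  / 2 <= ln (INR k) -> 10 ^ 60 * m * INR k * ln (INR k) ^ 4 <= INR n ->
  (1000 * (1000 * (10 * (v * (h.+1 * h.+1)))) <= n)%N.
Proof.
move=> vE hl lk hn; apply/leP; apply: INR_le; apply: Rle_trans hn; rewrite -!multE !mult_INR.
have -> : INR 1000 = 1000 by rewrite INR_IZR_INZ.
have -> : INR 10 = 10 by rewrite INR_IZR_INZ.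
have h1 : (0 <= INR h.+1) by apply: pos_INR.
move: (INR h.+1) (ln (INR k)) hl lk h1 => x L xL L2 x0.
have v0 : (0 <= INR v) by apply: pos_INR.
(* [2500 * L ^ 2] becomes [10000 * L ^ 4] because [/ 4 <= L * L]. *)
have xx : (x * x <= 10000 * L ^ 4).
  have : (x * x <= (50 * L) * (50 * L)) by apply: Rmult_le_compat.
  have : (/ 4 <= L * L) by nra.
  have -> : (L ^ 4 = (L * L) * (L * L)) by ring.
  by nra.
have p : (10 ^ 11 <= 10 ^ 60) by apply: Rle_pow; [lra|apply/leP].
have L4 : (0 <= L ^ 4) by apply: pow_le; lra.
have vx : (INR v * (x * x) <= INR v * (10000 * L ^ 4)) by apply: Rmult_le_compat_l.
have vL : (0 <= INR v * L ^ 4) by apply: Rmult_le_pos.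
have -> : (10 ^ 60 * m * INR k * L ^ 4 = 10 ^ 60 * (INR v * L ^ 4)) by rewrite vE; ring.
apply: (Rle_trans _ (10 ^ 11 * (INR v * L ^ 4))); last exact: Rmult_le_compat_r.
have -> : (10 ^ 11 * (INR v * L ^ 4) = 1000 * (1000 * (10 * (INR v * (10000 * L ^ 4))))) by ring.
by lra.
Qed.

End RealBounds.

Theorem theorem6p1 :
  exists C' : R, Rlt 0 C' /\
    forall (k : nat) (m : R),
      Rle C' m -> Rle m (Rpow_def.pow (INR k) 22) ->
      forall (v : nat) (f : 'I_v -> 'I_k),
        INR v = Rmult m (INR k) ->
        (forall i : 'I_k, exists x : 'I_v, f x = i) ->
        forall n : nat, (3 <= n)%N ->
          Rle (Rmult (Rmult (Rmult (Rpow_def.pow 10 60) m) (INR k))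
                     (Rpow_def.pow (ln (INR k)) 4))
              (INR n) ->
          is_good n (complete_multipartite f).
Proof.
(* [m >= 2] together with [m <= k ^ 22] forces [k >= 2], so [ln k] is bounded below. *)
exists (IZR 2); split; first lra.
move=> k m m2 mk v f vE fs n _ hn; pose h := up_log 2 v.
have [v2 k2] := size_bounds m2 mk vE.
have vk := order_bound k2 mk vE.
have hv : v <= 2 ^ h by apply: up_logP.
have h0 : 0 < h by rewrite up_log_gt0.
have h2v : 2 ^ h <= 2 * v.
  have := @up_log_bounds 2 v isT v2; rewrite -/h => /andP[lt _].
  by rewrite -(prednK h0) expnS leq_mul2l ltnW.
have [hl lk] := log_bound k2 vk h2v.
have k0 : 0 < k by rewrite lt0n; apply/eqP => k0; move: k2; rewrite k0 /=; lra.
apply: (multipartite_good fs k0 v2 h0 hv h2v).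
exact: large_n vE hl lk hn.
Qed.
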